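(* Let $V$ be a finite-dimensional real Euclidean space and let $G\subset \mathbf{O}(V)$ be a compact Lie group acting linearly on $V$, with Lie algebra $\mathfrak{g}\cong\mathfrak{su}_2$. Let $n_1,\dots,n_L$ be the dimensions of the irreducible components (counted with multiplicity) of the real representation of $\mathfrak{g}$ on $V$, and let $q(V):=\sum_{i=1}^{L}\left\lfloor \frac{n_i}{2}\right\rfloor$. If the topological quotient $V/G$ is a topological manifold, then $q(V)>2$.
   Context: Manifolds are without boundary. $V/G$ denotes the orbit space with the quotient topology. *)

(* Defs.v *)
From HB Require Import structures.
From mathcomp Require Import all_boot all_order all_algebra.
From mathcomp Require Import generic_quotient complex.
From mathcomp Require Import all_classical all_reals all_analysis.

Set Implicit Arguments.
Unset Strict Implicit.
Unset Printing Implicit Defensive.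

Import Order.TTheory GRing.Theory Num.Theory.
Import numFieldNormedType.Exports.

Local Open Scope classical_set_scope.
Local Open Scope ring_scope.
Local Open Scope complex_scope.
Local Open Scope sesquilinear_scope.
Local Open Scope quotient_scope.

(* The Euclidean space V is 'cV[R]_n with its standard inner product, on which
   matrices act by left multiplication. *)

Definition orthogonal_group (R : realType) (n : nat) : set 'M[R]_n :=
  [set g | g^T *m g = 1%:M].

Record is_orthogonal_subgroup (R : realType) (n : nat) (G : set 'M[R]_n) :
    Prop := IsOrthogonalSubgroup {
  orthogonal_subgroup_sub : G `<=` @orthogonal_group R n;
  orthogonal_subgroup_1 : G 1%:M;
  orthogonal_subgroup_mul : forall g h, G g -> G h -> G (g *m h);
  orthogonal_subgroup_inv : forall g, G g -> G (invmx g) }.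

Section OrbitSpace.
Variables (R : realType) (n : nat) (G : set 'M[R]_n).
Hypothesis hG : is_orthogonal_subgroup G.

Definition orbit_rel : rel 'cV[R]_n :=
  fun x y => `[< exists2 g, G g & y = g *m x >].

Lemma orbit_rel_refl : reflexive orbit_rel.
Proof.
move=> x; apply/asboolP; exists 1%:M; last by rewrite mul1mx.
exact: orthogonal_subgroup_1 hG.
Qed.

Lemma orbit_rel_sym : symmetric orbit_rel.
Proof.
suff sym x y : orbit_rel x y -> orbit_rel y x
  by move=> x y; apply/idP/idP => /sym.
move=> /asboolP[g Gg ->]; apply/asboolP; exists (invmx g).
  exact: (orthogonal_subgroup_inv hG).
have gO : g^T *m g = 1%:M := orthogonal_subgroup_sub hG Gg.
have [_ gU] := mulmx1_unit gO.
by rewrite mulKmx.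
Qed.

Lemma orbit_rel_trans : transitive orbit_rel.
Proof.
move=> y x z /asboolP[g Gg ->] /asboolP[h Gh ->]; apply/asboolP.
exists (h *m g); last by rewrite mulmxA.
exact: (orthogonal_subgroup_mul hG).
Qed.

Definition orbit_equiv : equiv_rel 'cV[R]_n :=
  EquivRel orbit_rel orbit_rel_refl orbit_rel_sym orbit_rel_trans.

Definition orbit_space : topologicalType :=
  quotient_topology {eq_quot orbit_equiv}.

End OrbitSpace.

Definition locally_euclidean (R : realType) (d : nat) (X : topologicalType) :=
  forall x : X, exists (U : set X) (f : X -> 'rV[R]_d) (h : 'rV[R]_d -> X),
    [/\ open U, U x & open (f @` U)] /\
    [/\ {within U, continuous f}, {within f @` U, continuous h} &
        forall y, U y -> h (f y) = y].

Definition topological_manifold (R : realType) (X : topologicalType) :=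
  [/\ hausdorff_space X, @second_countable X &
      exists d : nat, locally_euclidean R d X].

Definition mx_exp (R : realType) (n : nat) (A : 'M[R]_n) : 'M[R]_n :=
  limn (series (fun k : nat => (k`!%:R)^-1 *: (A ^+ k))).

(* The Lie algebra of a closed linear group, realized inside 'M[R]_n; its
   bracket is the matrix commutator. *)
Definition lie_algebra (R : realType) (n : nat) (G : set 'M[R]_n) :
    set 'M[R]_n :=
  [set A | forall t : R, G (mx_exp (t *: A))].

Definition lie_bracket (K : pzRingType) (m : nat) (A B : 'M[K]_m) : 'M[K]_m :=
  A *m B - B *m A.

Definition su2 (R : realType) : set 'M[R[i]]_2 :=
  [set A | A ^t* = - A /\ \tr A = 0].

(* The values of phi outside su2 are irrelevant. *)
Definition isomorphic_to_su2 (R : realType) (n : nat) (g : set 'M[R]_n) :=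
  exists phi : 'M[R[i]]_2 -> 'M[R]_n,
    [/\ set_bij (@su2 R) g phi,
        forall (a : R) A B, @su2 R A -> @su2 R B ->
          phi (a%:C *: A + B) = a *: phi A + phi B &
        forall A B, @su2 R A -> @su2 R B ->
          phi (lie_bracket A B) = lie_bracket (phi A) (phi B)].

Definition invariant_subspace (R : realType) (n : nat) (g : set 'M[R]_n)
    (W : {vspace 'cV[R]_n}) :=
  forall A v, g A -> v \in W -> A *m v \in W.

Definition irreducible_subspace (R : realType) (n : nat) (g : set 'M[R]_n)
    (W : {vspace 'cV[R]_n}) :=
  [/\ W != 0%VS, invariant_subspace g W &
      forall U : {vspace 'cV[R]_n}, (U <= W)%VS -> invariant_subspace g U ->
        U = 0%VS \/ U = W].

Definition irreducible_decomposition (R : realType) (n : nat)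
    (g : set 'M[R]_n) (L : nat) (W : 'I_L -> {vspace 'cV[R]_n}) :=
  [/\ directv (\sum_(i < L) W i), (\sum_(i < L) W i)%VS = fullv &
      forall i, irreducible_subspace g (W i)].

(* q(V): the dimensions of the W i do not depend, up to order, on the chosen
   irreducible decomposition W. *)
Definition q_of (R : realType) (n L : nat) (W : 'I_L -> {vspace 'cV[R]_n}) :
    nat :=
  (\sum_(i < L) (\dim (W i))./2)%N.

(* Main.v *)
(** Let T be the orthogonal complement of the vectors killed by the Lie algebra. Since
    n <= 3 (n / 2) for n >= 2 (with n / 2 rounded down), q(V) <= 2 forces dim T <= 6, and
    dim T >= 3 because su(2) has no nontrivial orthogonal representation of dimension
    at most 2.

    In the four remaining cases the orbit of 0 can be moved away from itself by a small
    continuous deformation of the identity of V/G. To a vector v and a real s one attaches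
    the vectors w such that w - v lies in T, |w|^2 = |v|^2 + s^2, and w satisfies one more
    G-invariant condition: none if dim T is 3 or 4, where the identity component is
    transitive on the spheres of T; equality of the cubic invariants of v and w if
    dim T = 5, where T consists of the traceless symmetric 3 x 3 matrices; and if dim T = 6,
    where T is R^3 (x) R^2, that the Gram matrix on R^2 grows by a multiple of the identity.
    Such w exist and form a single orbit: maximizing a linear form along the orbit of a
    compact subgroup brings the component of w in T to a canonical form, which the
    invariants determine. The resulting map (v, s) |-> G w is continuous, is the quotient
    map at s = 0, and avoids the orbit of 0 for s <> 0.

    In a chart at the orbit of 0 this would give, for small s, a map from a cube to R^d
    that is close to the identity but misses an interior point, contradicting Brouwer's
    fixed point theorem. The latter is obtained from Scarf's combinatorial lemma. *)

Require Import Defs.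
From mathcomp Require Import all_boot all_order all_algebra.

Set Implicit Arguments.
Unset Strict Implicit.
Unset Printing Implicit Defensive.

(** * Scarf's lemma *)

Section Scarf.
Variables (X I : finType) (r : I -> X -> nat) (c : X -> I).
Hypothesis r_inj : forall i, injective (r i).
Implicit Types (C : {set X}) (J : {set I}).

(** [G] need not be connected, and only exponentials of its Lie algebra are at hand for moving
    vectors. An element off the identity component may act as -1 on a 5-dimensional T, reversing the
    cubic invariant, or mix the two coordinates of R^2 when dim T = 6. So the extra condition
    compares v with w, both sides changing alike under [G], whereas canonical forms are reached
    inside the compact sets [fixing], [fixing5], [fixing6], which respect the invariants and fix the
    vectors killed by the Lie algebra.

    For dim T = 5 or 6 the orbits in a sphere of T have positive codimension, so the norm alone
    would leave many orbits over one (v, s). The deformation is a relation because w need not admit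
    a continuous choice; its closed graph and a norm bound suffice for continuity on the orbit
    space.

    No classification of representations is used. The structure of T comes from brackets, skewness
    and dimension: skew operators in odd dimension are singular, which gives vectors of weight 0,
    and two independent ones force dimension 6. *)

Definition least_in (i : I) (C : {set X}) (x : X) : bool :=
  [forall y in C, r i x <= r i y].

(** Replaces a triangulation. Dominant pairs with [#|C| = #|J|] (rooms) act as top cells, and those
    with one index more (doors) as their facets. *)
Definition dominant (C : {set X}) (J : {set I}) : bool :=
  [forall x, exists i in J, least_in i C x].

Lemma least_inP i C x : reflect (forall y, y \in C -> r i x <= r i y) (least_in i C x).
Proof. exact: forall_inP. Qed.

Lemma dominantP C J :
  reflect (forall x, exists2 i, i \in J & least_in i C x) (dominant C J).
Proof.
apply: (iffP forallP) => [h x|h x]; first by have /exists_inP := h x.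
by apply/exists_inP.
Qed.

Lemma least_in_inj i C x y : x \in C -> y \in C ->
  least_in i C x -> least_in i C y -> x = y.
Proof.
move=> xC yC /least_inP/(_ _ yC) h1 /least_inP/(_ _ xC) h2.
by apply: (@r_inj i); apply/eqP; rewrite eqn_leq h1 h2.
Qed.

Definition door_room (D R : {set X} * {set I}) : bool :=
  [exists x, [&& x \notin D.1, R.1 == x |: D.1 & R.2 == D.2]] ||
  [exists j, [&& j \in D.2, R.1 == D.1 & R.2 == D.2 :\ j]].

Lemma door_roomP (D R : {set X} * {set I}) : reflect
  ((exists2 x, x \notin D.1 & R = (x |: D.1, D.2)) \/
   (exists2 j, j \in D.2 & R = (D.1, D.2 :\ j))) (door_room D R).
Proof.
case: D R => C J [C' J']; apply: (iffP orP) => /=.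
  case=> /existsP[z /and3P[zC /eqP/= -> /eqP/= ->]]; [left|right]; by exists z.
by case=> -[z zC [-> ->]]; [left|right]; apply/existsP; exists z; rewrite zC !eqxx.
Qed.

Section Rooms.
Variables (C : {set X}) (J : {set I}) (y0 : X).
Hypotheses (domCJ : dominant C J) (cardJ : #|J| = #|C|.+1) (y0C : y0 \in C).

Let a (i : I) : X := [arg min_(y < y0 in C) r i y].

Let aC i : a i \in C.
Proof. by rewrite /a; case: arg_minnP. Qed.

Let a_least i : least_in i C (a i).
Proof. by rewrite /a; case: arg_minnP => // x _ h; apply/least_inP => y /h. Qed.

Let aE i x : x \in C -> least_in i C x -> x = a i.
Proof. by move=> xC h; apply: (least_in_inj xC (aC i) h (a_least i)). Qed.

Let aJ : a @: J = C.
Proof.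
apply/setP => x; apply/imsetP/idP => [[i _ ->]//|xC].
by have /dominantP/(_ x)[i iJ h] := domCJ; exists i => //; apply: aE.
Qed.

(** These points lie strictly above the least point of [C] in every order of [J] but [j], so [j]
    alone can dominate them. *)
Let M j : {set X} := [set x | [forall i in J :\ j, r i (a i) < r i x]].

Let MP j x : reflect (forall i, i \in J -> i != j -> r i (a i) < r i x) (x \in M j).
Proof.
rewrite inE; apply: (iffP forall_inP) => h i => [iJ ij|].
  by apply: h; rewrite !inE ij.
by rewrite !inE => /andP[ij iJ]; apply: h.
Qed.

Let xmax j : X := [arg max_(x > odflt y0 [pick x in M j] in M j) r j x].

Let rho j := if M j == set0 then (C, J :\ j) else (xmax j |: C, J).

Let xmaxP j : M j != set0 -> xmax j \in M j /\ forall z, z \in M j -> r j z <= r j (xmax j).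
Proof.
move=> Mj.
have h : odflt y0 [pick x in M j] \in M j.
  by case: pickP => //= h; case/set0Pn: Mj => z; rewrite h.
by rewrite /xmax; case: arg_maxnP => // x xM xmx; split.
Qed.

Let xM_least j x : j \in J -> x \in M j -> least_in j C x.
Proof.
move=> jJ /MP xM; have /dominantP/(_ x)[i iJ h] := domCJ.
have [<-//|ij] := eqVneq i j.
by have := xM i iJ ij; rewrite ltnNge (least_inP _ _ _ h).
Qed.

(** Pigeonhole: [a] maps [J] onto [C], and [J] has one element more. *)
Let double_index : exists j1 j2, [/\ j1 \in J, j2 \in J, j1 != j2,
  a @: (J :\ j1) = C & a @: (J :\ j2) = C].
Proof.
have /dinjectivePn[j1 j1J [j2]] : ~~ dinjectiveb a J.
  apply/negP => /dinjectiveP/card_in_imset; rewrite aJ cardJ => /eqP.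
  by rewrite eqn_leq ltnn andbF.
rewrite !inE => /andP[j21 j2J] a12.
have gen k l : k \in J -> l \in J -> k != l -> a k = a l -> a @: (J :\ k) = C.
  move=> kJ lJ kl akl; apply/eqP; rewrite eqEsubset; apply/andP; split.
    by apply/subsetP => _ /imsetP[i _ ->].
  rewrite -{1}aJ; apply/subsetP => _ /imsetP[i iJ ->].
  have [->|ik] := eqVneq i k; last by apply: imset_f; rewrite !inE ik.
  by rewrite akl; apply: imset_f; rewrite !inE eq_sym kl.
exists j1, j2; split => //; first by rewrite eq_sym.
- by apply: (gen j1 j2) => //; rewrite eq_sym.
- by apply: (gen j2 j1).
Qed.

Let a_inj j : j \in J -> a @: (J :\ j) = C -> {in J :\ j &, injective a}.
Proof.
move=> jJ h; apply/imset_injP; rewrite h; apply/eqP.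
by have := cardsD1 j J; rewrite jJ cardJ add1n => -[].
Qed.

Let rho_room j : j \in J -> a @: (J :\ j) = C ->
  let R := rho j in [/\ dominant R.1 R.2, #|R.1| = #|R.2| & door_room (C, J) R].
Proof.
move=> jJ aj; rewrite /rho; case: ifPn => [/eqP Mj|Mj] /=.
  split; last by apply/door_roomP; right; exists j.
  - apply/dominantP => z; have : z \notin M j by rewrite Mj inE.
    rewrite inE negb_forall_in => /exists_inP[i iJ]; rewrite -leqNgt => h.
    exists i => //; apply/least_inP => y yC; apply: leq_trans h _.
    exact: (least_inP _ _ _ (a_least i)).
  - by have := cardsD1 j J; rewrite jJ cardJ add1n => -[].
have [xM xmx] := xmaxP Mj.
have xNC : xmax j \notin C.
  rewrite -aj; apply/negP => /imsetP[i]; rewrite !inE => /andP[ij iJ] xE.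
  by have /MP/(_ _ iJ ij) := xM; rewrite {1}xE ltnn.
split; last by apply/door_roomP; left; exists (xmax j).
- apply/dominantP => z; have [zM|zM] := boolP (z \in M j).
    exists j => //; apply/least_inP => y /setU1P[->|yC]; first exact: xmx.
    apply: leq_trans (xmx _ zM) _.
    exact: (least_inP _ _ _ (xM_least jJ xM)).
  move: zM; rewrite inE negb_forall_in => /exists_inP[i iJ]; rewrite -leqNgt => h.
  move: iJ; rewrite !inE => /andP[ij iJ]; exists i => //.
  apply/least_inP => y /setU1P[->|yC].
    by apply: leq_trans h _; apply: ltnW; have /MP := xM; apply.
  by apply: leq_trans h _; exact: (least_inP _ _ _ (a_least i)).
- by rewrite cardsU1 xNC cardJ.
Qed.

Let room_rho R : dominant R.1 R.2 -> door_room (C, J) R ->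
  exists2 j, j \in J & a @: (J :\ j) = C /\ R = rho j.
Proof.
move=> domR /door_roomP[[x /= xC RE]|[j /= jJ RE]]; rewrite RE /= in domR; last first.
  have aj : a @: (J :\ j) = C.
    apply/setP => y; apply/imsetP/idP => [[i _ ->]//|yC].
    by have /dominantP/(_ y)[i iJ h] := domR; exists i => //; apply: aE.
  exists j => //; split=> //; rewrite RE /rho; case: eqP => // /eqP/set0Pn[z /MP zM].
  have /dominantP/(_ z)[i] := domR; rewrite !inE => /andP[ij iJ] /least_inP/(_ _ (aC i)).
  by rewrite leqNgt zM.
have /dominantP/(_ x)[j jJ xj] := domR.
have xC' : x \in x |: C by rewrite !inE eqxx.
have sub i y : least_in i (x |: C) y -> least_in i C y.
  by move=> /least_inP h; apply/least_inP => z zC; apply: h; rewrite !inE zC orbT.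
have key y : y \in C -> exists2 i, (i \in J :\ j) & least_in i (x |: C) y.
  move=> yC; have /dominantP/(_ y)[i iJ yi] := domR.
  exists i => //; rewrite !inE iJ andbT; apply/eqP => ij.
  have yC' : y \in x |: C by rewrite !inE yC orbT.
  by move: xC; rewrite (least_in_inj xC' yC' xj) ?yC // -ij.
have aj : a @: (J :\ j) = C.
  apply/setP => y; apply/imsetP/idP => [[i _ ->]//|yC].
  by have [i iJ h] := key y yC; exists i => //; apply: aE => //; apply: sub.
have xM : x \in M j.
  apply/MP => i iJ ij.
  have [i' i'J h] := key (a i) (aC i).
  have ii' : i = i'.
    apply: (a_inj jJ aj) => //; first by rewrite !inE ij.
    by apply: aE => //; apply: sub.
  rewrite -ii' in h; rewrite ltn_neqAle (least_inP _ _ _ h) // andbT.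
  by apply/eqP => /r_inj axE; move: xC; rewrite -axE aC.
exists j => //; split=> //; rewrite RE /rho; case: eqP => [M0|/eqP M0].
  by move: xM; rewrite M0 inE.
congr (_ |: _, _); have [_ /(_ _ xM) h1] := xmaxP M0.
have [zM _] := xmaxP M0; apply: (@r_inj j); apply/eqP; rewrite eqn_leq h1 /=.
have /dominantP/(_ (xmax j))[i iJ /least_inP h] := domR.
have [ij|ij] := eqVneq i j; first by have := h x xC'; rewrite ij.
have /MP/(_ _ iJ ij) := zM; rewrite ltnNge h // !inE aC orbT //.
Qed.

(** The pseudomanifold property, an interior facet lying in two cells. The rooms are [rho j1] and
    [rho j2], for the two indices sharing their least point in [C]. *)
Lemma card_rooms_of_door :
  #|[set R : {set X} * {set I} | [&& dominant R.1 R.2, #|R.1| == #|R.2| &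
       door_room (C, J) R]]| = 2.
Proof.
have [j1 [j2 [j1J j2J j12 a1 a2]]] := double_index.
have -> : [set R | [&& dominant R.1 R.2, #|R.1| == #|R.2| &
       door_room (C, J) R]] = [set rho j1; rho j2].
  apply/setP => R; rewrite !inE; apply/and3P/orP; last first.
    by case=> /eqP ->; [have [d e i] := rho_room j1J a1|have [d e i] := rho_room j2J a2];
      split=> //; apply/eqP.
  case=> dR _ iR; have [j jJ [aj ->]] := room_rho dR iR.
  have : a j \in a @: (J :\ j) by rewrite aj.
  case/imsetP => j'; rewrite !inE => /andP[jj' j'J] ajE.
  have sep k : k \in J -> a @: (J :\ k) = C -> (j == k) || (j' == k).
    move=> kJ /(a_inj kJ) inj; case: eqVneq => //= jk; apply/negPn/negP => j'k.
    by move: jj'; rewrite (inj j' j) ?eqxx // !inE ?j'k ?jk.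
  have := sep _ j1J a1; have := sep _ j2J a2.
  case: (eqVneq j j1) => [->|_]; first by rewrite eqxx; left.
  case: (eqVneq j j2) => [->|_] /=; first by rewrite eqxx; right.
  by move=> /eqP -> /eqP h; move: j12; rewrite h eqxx.
rewrite cards2; suff -> : rho j1 != rho j2 by [].
rewrite /rho; case: ifPn => M1; case: ifPn => M2; apply/eqP => -[].
- move=> /setP/(_ j1); rewrite !inE eqxx j12 j1J //.
- by move=> _ /setP/(_ j1); rewrite !inE eqxx j1J.
- by move=> _ /setP/(_ j2); rewrite !inE eqxx j2J.
(* If both rooms arose by adding one and the same point, this point would be [j2]-least as a member
   of [M j2], but strictly above [a j2] in the order [j2] as a member of [M j1]. *)
move=> E.
have [x1M _] := xmaxP M1; have [x2M _] := xmaxP M2.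
have x1C : xmax j1 \notin C.
  rewrite -a1; apply/negP => /imsetP[i]; rewrite !inE => /andP[ij iJ] xE.
  by have /MP/(_ _ iJ ij) := x1M; rewrite {1}xE ltnn.
have : xmax j1 \in xmax j2 |: C by rewrite -E !inE eqxx.
rewrite !inE (negbTE x1C) orbF => /eqP x12.
have /MP/(_ j2 j2J) := x1M; rewrite eq_sym j12 => /(_ isT).
have /least_inP/(_ _ (aC j2)) := xM_least j2J x2M.
by rewrite -x12 leqNgt => /negbTE ->.
Qed.

End Rooms.

Variable i0 : I.

(** Doors showing every colour of [J] except [i0], as in the parity proof of Sperner's lemma. *)
Definition good_door (D : {set X} * {set I}) : bool :=
  [&& dominant D.1 D.2, #|D.2| == #|D.1|.+1, i0 \in D.2 &
      c @: D.1 == D.2 :\ i0].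

(** Such a room has no good door or exactly two. If deleting [x] gives one, its partner depends on
    the colour of [x]: a colour outside [J] is added as an index, and a colour occurring twice
    allows the other point of that colour to be deleted instead. *)
Lemma room_doors (R : {set X} * {set I}) : dominant R.1 R.2 -> #|R.1| = #|R.2| ->
  c @: R.1 != R.2 ->
  ~~ odd #|[set D | good_door D && door_room D R]|.
Proof.
case: R => C J /= domR cardR notfinal.
have [->|/set0Pn[D0]] := eqVneq [set D | good_door D && door_room D (C, J)] set0.
  by rewrite cards0.
rewrite inE => /andP[gD0 iD0].
have dom1 x : dominant (C :\ x) J.
  apply/dominantP => z; have /dominantP/(_ z)[i iJ /least_inP h] := domR.
  by exists i => //; apply/least_inP => y /setD1P[_]; apply: h.
have dom2 j : dominant C (j |: J).
  apply/dominantP => z; have /dominantP/(_ z)[i iJ h] := domR.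
  by exists i => //; rewrite !inE iJ orbT.
have type1P D : good_door D && door_room D (C, J) ->
    (exists2 x, x \in C & D = (C :\ x, J) /\ (i0 \in J /\ c @: (C :\ x) = J :\ i0)) \/
    (exists2 j, j \notin J & D = (C, j |: J) /\ (i0 \in j |: J /\ c @: C = (j |: J) :\ i0)).
  case: D => C' J' /andP[/and4P[/= _ _ i0J' /eqP cE] /door_roomP/= [[x xC' [CE JE]]|[j jJ' [CE JE]]]].
    left; exists x; first by rewrite CE setU11.
    by rewrite CE JE setU1K.
  right; exists j; first by rewrite JE setD11.
  by rewrite CE JE setD1K.
have mk1 x : x \in C -> i0 \in J -> c @: (C :\ x) = J :\ i0 ->
    good_door (C :\ x, J) && door_room (C :\ x, J) (C, J).
  move=> xC i0J cE; apply/andP; split.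
    apply/and4P; split => //=; last exact/eqP.
    by rewrite -cardR (cardsD1 x C) xC.
  by apply/door_roomP; left; exists x; rewrite /= ?inE ?eqxx // setD1K.
have mk2 j : j \notin J -> i0 \in j |: J -> c @: C = (j |: J) :\ i0 ->
    good_door (C, j |: J) && door_room (C, j |: J) (C, J).
  move=> jJ i0J cE; apply/andP; split.
    apply/and4P; split => //=; last exact/eqP.
    by rewrite cardsU1 jJ cardR.
  by apply/door_roomP; right; exists j; rewrite /= ?inE ?eqxx // setU1K.
(* Were [i0] the index added to form the door, the colours of [C] would be exactly [J] and the room
   would be final. *)
have i0J : i0 \in J.
  have [[x _ [_ []]]//|[j jJ [_ []]]] := type1P _ (introT andP (conj gD0 iD0)).
  rewrite !inE => /orP[/eqP ->|//]; rewrite setU1K // => cE.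
  by move: notfinal; rewrite cE eqxx.
have cardJ0 : #|J| = #|J :\ i0|.+1 by rewrite (cardsD1 i0 J) i0J.
have type2 x j : x \in C -> j \notin J -> c x = j -> c @: (C :\ x) = J :\ i0 ->
    c @: C = (j |: J) :\ i0 ->
    [set D | good_door D && door_room D (C, J)] = [set (C :\ x, J); (C, j |: J)].
  move=> xC jJ cx c1 c2; apply/setP => D; rewrite inE; rewrite in_set2; apply/idP/orP; last first.
    by case=> /eqP ->; [exact: mk1|apply: mk2 => //; rewrite !inE i0J orbT].
  case/type1P => [[x' x'C [-> [_ cE]]]|[j' j'J [-> [_ cE]]]].
    left; suff -> : x = x' by [].
    apply/eqP/negPn/negP => xx'.
    have : j \in c @: (C :\ x') by rewrite -cx; apply: imset_f; rewrite !inE xx'.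
    by rewrite cE !inE (negbTE jJ) andbF.
  right; suff -> : j = j' by [].
  have : j \in (j' |: J) :\ i0.
    rewrite -cE c2 !inE eqxx /= andbT; apply/eqP => ji0.
    by move: jJ; rewrite ji0 i0J.
  by rewrite !inE (negbTE jJ) orbF => /andP[_ /eqP].
have [[x xC [_ [_ c1]]]|[j jJ [_ [_ c2]]]] := type1P _ (introT andP (conj gD0 iD0)); last first.
  have jc : j \in c @: C.
    rewrite c2 !inE eqxx /= andbT; apply/eqP => ji0.
    by move: jJ; rewrite ji0 i0J.
  have /imsetP[x xC jE] := jc.
  have cardjJ : #|(j |: J) :\ i0| = #|J|.
    have := cardsD1 i0 (j |: J); rewrite !inE i0J orbT cardsU1 jJ add1n.
    by rewrite add1n => -[].
  have cinj : {in C &, injective c}.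
    by apply/imset_injP; rewrite c2 cardjJ cardR.
  rewrite (type2 x j) //.
    rewrite cards2; case: eqP => // -[_ /setP/(_ j)].
    by rewrite !inE eqxx (negbTE jJ).
  have -> : J :\ i0 = (c @: C) :\ j.
    rewrite c2; apply/setP => z; rewrite !inE.
    by case: (eqVneq z j) => [->|]; rewrite ?(negbTE jJ) ?andbF.
  apply/setP => z; rewrite !inE; apply/imsetP/andP.
    case=> y; rewrite !inE => /andP[yx yC] ->; split; last exact: imset_f.
    by rewrite jE; apply: contra_neq yx => /cinj; apply.
  case=> zj /imsetP[y yC zE]; exists y => //; rewrite !inE yC andbT.
  by apply: contra_neq zj => yx; rewrite zE yx -jE.
have [cxi0|cxi0] := eqVneq (c x) i0.
  have : c @: C = J by rewrite -(setD1K xC) imsetU1 c1 cxi0 setD1K.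
  by move=> cE; move: notfinal; rewrite cE eqxx.
have cC : c @: C = c x |: (J :\ i0) by rewrite -{1}(setD1K xC) imsetU1 c1.
have [cxJ|cxJ] := boolP (c x \in J); last first.
  rewrite (type2 x (c x)) //; last first.
    rewrite cC; apply/setP => z; rewrite !inE.
    by case: (eqVneq z (c x)) => [->|]; rewrite ?cxi0.
  rewrite cards2; case: eqP => // -[_ /setP/(_ (c x))].
  by rewrite !inE eqxx (negbTE cxJ).
have cxJ0 : c x \in J :\ i0 by rewrite !inE cxi0.
have cC' : c @: C = J :\ i0 by rewrite cC; apply/setUidPr; rewrite sub1set.
have := cxJ0; rewrite -c1 => /imsetP[x' /setD1P[x'x x'C] cxx'].
have cardC1 y : y \in C -> #|C :\ y| = #|J :\ i0|.
  by move=> yC; have := cardsD1 y C; rewrite yC cardR cardJ0 add1n => -[].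
have cinj y : y \in C -> c @: (C :\ y) = J :\ i0 -> {in C :\ y &, injective c}.
  by move=> yC h; apply/imset_injP; rewrite h cardC1.
have -> : [set D | good_door D && door_room D (C, J)] = [set (C :\ x, J); (C :\ x', J)].
  apply/setP => D; rewrite inE; rewrite in_set2; apply/idP/orP; last first.
    case=> /eqP ->; apply: mk1 => //.
    apply/setP => z; rewrite -c1; apply/imsetP/imsetP => -[y].
      rewrite !inE => /andP[yx' yC] ->.
      have [->|yx] := eqVneq y x; first by exists x' => //; rewrite !inE x'x.
      by exists y => //; rewrite !inE yx.
    rewrite !inE => /andP[yx yC] ->.
    have [->|yx'] := eqVneq y x'; first by exists x => //; rewrite !inE eq_sym x'x.
    by exists y => //; rewrite !inE yx'.
  case/type1P => [[y yC [-> [_ cE]]]|[j' j'J [_ [_ cE]]]]; last first.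
    have : j' \in J :\ i0.
      rewrite -cC' cE !inE eqxx /= andbT; apply/eqP => ji0.
      by move: j'J; rewrite ji0 i0J.
    by rewrite !inE (negbTE j'J) andbF.
  have [->|yx] := eqVneq x y; first by left.
  have [->|yx'] := eqVneq x' y; first by right.
  by move: x'x; rewrite (cinj y yC cE x' x) ?eqxx // !inE ?yx ?yx'.
rewrite cards2; case: eqP => // -[/setP/(_ x')].
by rewrite !inE eqxx x'x x'C.
Qed.

Hypothesis X0 : 0 < #|X|.

(** The only candidate adds the [r i0]-largest point. This boundary door is the source of the odd
    count. *)
Lemma card_rooms_outer :
  #|[set R : {set X} * {set I} | [&& dominant R.1 R.2, #|R.1| == #|R.2| &
       door_room (set0, [set i0]) R]]| = 1.
Proof.
have /card_gt0P[x1 _] := X0.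
pose m := [arg max_(x > x1 in predT) r i0 x].
have mP z : r i0 z <= r i0 m by rewrite /m; case: arg_maxnP => // y _; apply.
apply/eqP/cards1P; exists ([set m], [set i0]).
apply/setP => R; rewrite !inE; apply/and3P/eqP.
  case=> dR _ /door_roomP/= [[x _ RE]|[j]]; last first.
    rewrite inE => /eqP -> RE; move: dR; rewrite RE /= setDv => /dominantP/(_ x1)[i].
    by rewrite inE.
  rewrite RE setU0; congr ([set _], _).
  move: dR; rewrite RE /= setU0 => /dominantP/(_ m)[i /set1P -> /least_inP/(_ x)].
  rewrite inE eqxx => /(_ isT) h; apply: (@r_inj i0); apply/eqP.
  by rewrite eqn_leq h mP.
move=> ->; split => /=; last by apply/door_roomP; left; exists m; rewrite /= ?inE // setU0.
- apply/dominantP => z; exists i0; first by rewrite inE.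
  by apply/least_inP => y /set1P ->.
- by rewrite !cards1.
Qed.

(* Double counting of incidences between doors and rooms: the door (set0, [set i0])
   lies in one room and every other good door in two, so some room carries an odd
   number of good doors. *)
Theorem scarf : exists (C : {set X}) (J : {set I}),
  [/\ J != set0, dominant C J & c @: C = J].
Proof.
have /card_gt0P[x1 _] := X0.
pose room := [set R : {set X} * {set I} | dominant R.1 R.2 && (#|R.1| == #|R.2|)].
have [/existsP[[C J]]|/existsPn nofinal] :=
    boolP [exists R, (R \in room) && (c @: R.1 == R.2)].
  rewrite inE /= => /andP[/andP[dCJ _] /eqP cE]; exists C, J; split=> //.
  have /dominantP/(_ x1)[i iJ _] := dCJ.
  by apply/set0Pn; exists i.
pose N := \sum_(D | good_door D) \sum_(R in room) (door_room D R : nat).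
have cnt D : \sum_(R in room) (door_room D R : nat) =
    #|[set R : {set X} * {set I} | [&& dominant R.1 R.2, #|R.1| == #|R.2| &
       door_room D R]]|.
  rewrite -big_mkcondr sum1dep_card; apply: eq_card => R; rewrite !inE.
  by rewrite andbA.
have evenN : ~~ odd N.
  rewrite /N exchange_big /= -dvdn2; apply: dvdn_sum => R; rewrite inE => /andP[dR /eqP cR].
  rewrite -big_mkcondr sum1dep_card dvdn2.
  have := nofinal R; rewrite inE dR cR eqxx /= => nf.
  exact: room_doors.
have outer : good_door (set0, [set i0]).
  apply/and4P; split => /=.
  - apply/dominantP => z; exists i0; rewrite ?inE //.
    by apply/least_inP => y; rewrite inE.
  - by rewrite cards0 cards1.
  - by rewrite inE.
  - by rewrite imset0 setDv.
have oddN : odd N.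
  rewrite /N (bigD1 (set0, [set i0])) //= cnt card_rooms_outer oddD /=.
  rewrite -dvdn2; apply: dvdn_sum => -[C J] /andP[/and4P[/= dCJ /eqP cJ i0J /eqP cE] ne].
  rewrite cnt; case: (set_0Vmem C) => [C0|[y yC]].
    case/eqP: ne; move: cJ; rewrite C0 cards0 => /eqP/cards1P[i JE].
    by move: i0J; rewrite JE inE => /eqP ->.
  by rewrite (card_rooms_of_door dCJ cJ yC).
by rewrite oddN in evenN.
Qed.

End Scarf.

From mathcomp Require Import generic_quotient complex.
From mathcomp Require Import all_classical all_reals all_analysis.
From mathcomp Require Import zify lra ring.

Import Order.TTheory GRing.Theory Num.Theory.
Import numFieldNormedType.Exports.

Local Open Scope classical_set_scope.
Local Open Scope ring_scope.

(** * Brouwer's fixed point theorem *)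

Section Grid.
Variables d N : nat.

Definition grid := {x : {ffun 'I_d.+1 -> 'I_N.+1} | (\sum_i x i == N)%N}.

Lemma grid_of (z : 'I_d.+1 -> nat) : (\sum_i z i)%N = N ->
  exists x : grid, forall i, val x i = z i :> nat.
Proof.
move=> zN; have zlt i : (z i < N.+1)%N by rewrite ltnS -zN (bigD1 i) //= leq_addr.
have sN : (\sum_i [ffun i => Ordinal (zlt i)] i == N)%N.
  by apply/eqP; rewrite -[RHS]zN; apply: eq_bigr => i _; rewrite ffunE.
by exists (exist _ [ffun i => Ordinal (zlt i)] sN) => i; rewrite ffunE.
Qed.

Lemma card_grid : (0 < #|{: grid}|)%N.
Proof.
have [x _] : exists x : grid, forall i, val x i = (if i == ord0 then N else 0%N) :> nat.
  by apply: grid_of; rewrite -big_mkcond big_pred1_eq.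
by apply/card_gt0P; exists x.
Qed.

(** Compares the [i]-th coordinates first; the enumeration rank breaks ties, because Scarf's lemma
    requires injective ranks. *)
Definition grid_rank (i : 'I_d.+1) (x : grid) : nat :=
  (val x i * #|{: grid}| + enum_rank x)%N.

Lemma grid_rank_inj i : injective (grid_rank i).
Proof.
move=> x y; rewrite /grid_rank => /(congr1 (modn^~ #|{: grid}|)).
by rewrite !modnMDl !modn_small // => /val_inj/enum_rank_inj.
Qed.

Lemma grid_rank_le i x y : (grid_rank i x <= grid_rank i y)%N -> (val x i <= val y i)%N.
Proof.
move=> /(leq_div2r #|{: grid}|); rewrite /grid_rank !divnMDl ?card_grid //.
by rewrite !divn_small // !addn0.
Qed.

(** If the numbers [(m i).+1] over [J] summed to at most [N], some grid point would exceed all the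
    minima [m i] and escape dominance. So the minima nearly exhaust [N], and the remainder, at most
    [#|J| - 1 <= d], bounds both the spread on [J] and the coordinates off [J]. *)
Lemma dominant_small (C : {set grid}) (J : {set 'I_d.+1}) :
  J != finset.set0 -> C != finset.set0 -> dominant grid_rank C J ->
  (forall x y i, x \in C -> y \in C -> i \in J -> (val x i <= val y i + d)%N) /\
  (forall x i, x \in C -> i \notin J -> (val x i <= d)%N).
Proof.
move=> /finset.set0Pn[j0 j0J] /finset.set0Pn[y0 y0C] dom.
pose m i := val [arg min_(y < y0 in C) (val y i : nat)] i : nat.
have mle i y : y \in C -> (m i <= val y i)%N.
  by move=> yC; rewrite /m; case: arg_minnP => // z _; apply.
have big : (N < \sum_(i in J) (m i).+1)%N.
  rewrite ltnNge; apply/negP => le.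
  pose K := (N - \sum_(i in J) (m i).+1)%N.
  (* The slack [K] is placed on [j0] to make the coordinates add up to [N]. *)
  pose z i : nat := (if i \in J then (m i).+1 + (if i == j0 then K else 0) else 0)%N.
  have [x xz] : exists x : grid, forall i, val x i = z i :> nat.
    apply: grid_of; rewrite /z -big_mkcond big_split /= -big_mkcondr /=.
    have -> : (\sum_(i in J | i == j0) K = K)%N.
      by apply: (big_pred1 j0) => i; rewrite /= andbC; case: (eqVneq i j0) => [->|//]; rewrite j0J.
    by rewrite subnKC.
  have /dominantP/(_ x)[i iJ /least_inP h] := dom.
  have : (val x i <= m i)%N.
    apply: grid_rank_le; apply: h.
    by case: arg_minnP.
  by rewrite xz /z iJ; lia.
have cardJ : (#|J| <= d.+1)%N by rewrite -[X in (_ <= X)%N]card_ord; exact: max_card.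
have sJ : (\sum_(i in J) (m i).+1 = \sum_(i in J) m i + #|J|)%N.
  rewrite -sum1_card -big_split /=; apply: eq_bigr => i _; by rewrite addn1.
have key x : x \in C ->
    (\sum_(i in J) (val x i - m i) + \sum_(i | i \notin J) val x i <= d)%N.
  move=> xC; have /eqP := valP x; rewrite (bigID (fun i => i \in J)) /= => xN.
  have : (\sum_(i in J) val x i = \sum_(i in J) m i + \sum_(i in J) (val x i - m i))%N.
    rewrite -big_split /=; apply: eq_bigr => i _; rewrite subnKC //; exact: mle.
  move=> E; rewrite -(leq_add2l (\sum_(i in J) m i)) addnA -E xN -ltnS -addnS.
  by apply: leq_trans big _; rewrite sJ leq_add2l.
split=> [x y i xC yC iJ|x i xC iJ].
  have := key x xC; rewrite (bigD1 i) //=; have := mle i y yC.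
  move=> h1 h2; rewrite -leq_subLR; apply: leq_trans h2.
  by rewrite -addnA; apply: leq_trans (leq_addr _ _); exact: leq_sub2l.
have := key x xC; rewrite [X in (_ + X)%N](bigD1 i) //=; apply: leq_trans.
by rewrite addnCA leq_addr.
Qed.
End Grid.

Section Brouwer.
Variable R : realType.

Lemma continuous_sum (T : topologicalType) (I : Type) (s : seq I) (F : I -> T -> R) :
  (forall i, continuous (F i)) -> continuous (fun x => \sum_(i <- s) F i x).
Proof. by move=> h; apply: continuous_big => //; exact: add_continuous. Qed.

Definition simplex d : set 'rV[R]_d.+1 :=
  [set u | (forall i, 0 <= u ord0 i) /\ \sum_i u ord0 i = 1].

(** A grid point is coloured by a coordinate that [f] does not decrease; one exists because both
    coordinate sums are 1. Scarf's lemma then yields a small cluster carrying every colour of [J],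
    while the coordinates outside [J] are small. *)
Lemma approximate_fixed_point d (f : 'rV[R]_d.+1 -> 'rV[R]_d.+1) (e : R) :
  0 < e -> (forall u, simplex u -> simplex (f u)) ->
  exists2 u, simplex u & forall i, u ord0 i <= e \/
    exists2 x, simplex x & `|x - u| <= e /\ x ord0 i <= f x ord0 i.
Proof.
move=> e0 fS.
have [N N0 Ne] : exists2 N, (0 < N)%N & d%:R <= e * N%:R.
  have := archi_boundP (divr_ge0 (ler0n R d) (ltW e0)).
  set N := Num.bound _ => h; exists N.+1 => //.
  rewrite mulrC -ler_pdivrMr //; apply: ltW; apply: lt_le_trans h _.
  by rewrite ler_nat.
have NR : 0 < N%:R :> R by rewrite ltr0n.
pose p (x : grid d N) : 'rV[R]_d.+1 := \row_i ((val x i : nat)%:R / N%:R).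
have pS x : simplex (p x).
  split=> [i|]; first by rewrite mxE divr_ge0.
  under eq_bigr do rewrite mxE.
  rewrite -mulr_suml -natr_sum; have /eqP -> := valP x.
  by rewrite divff // gt_eqF.
pose c x : 'I_d.+1 := odflt ord0 [pick i | p x ord0 i <= f (p x) ord0 i].
have cP x : p x ord0 (c x) <= f (p x) ord0 (c x).
  rewrite /c; case: pickP => //= h; exfalso.
  have [_ s1] := pS x; have [_ s2] := fS _ (pS x).
  have : \sum_i f (p x) ord0 i < \sum_i p x ord0 i.
    apply: ltr_sum => [|i _]; first by apply/hasP; exists ord0; rewrite ?mem_index_enum.
    by rewrite ltNge h.
  by rewrite s1 s2 ltxx.
have [C [J [J0 dom cC]]] := scarf c (@grid_rank_inj d N) (@ord0 d) (card_grid d N).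
have C0 : C != finset.set0.
  by apply: contraNneq J0 => C0; rewrite -cC C0 imset0.
have [h1 h2] := dominant_small J0 C0 dom.
have /finset.set0Pn[x xC] := C0.
have nle (a b : nat) : (a <= b + d)%N -> a%:R / N%:R - b%:R / N%:R <= e.
  move=> ab; rewrite -mulrBl ler_pdivrMr //; apply: le_trans Ne.
  by rewrite lerBlDl -natrD ler_nat.
exists (p x) => // i; have [iJ|iJ] := boolP (i \in J); last first.
  left; rewrite mxE; have := nle (val x i) 0%N (h2 _ _ xC iJ).
  by rewrite mul0r subr0.
right; move: iJ; rewrite -cC => /imsetP[y yC ->].
exists (p y) => //; split => //.
rewrite [leLHS]mx_normrE; apply/bigmax_leP; split=> [|[k j] _ /=]; first exact: ltW.
rewrite !mxE ler_norml; apply/andP; split; last first.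
  apply: nle; have [jJ|jJ] := boolP (j \in J); first exact: h1.
  by apply: leq_trans (h2 _ _ yC jJ) _; rewrite leq_addl.
rewrite lerNl opprB; apply: nle; have [jJ|jJ] := boolP (j \in J); first exact: h1.
by apply: leq_trans (h2 _ _ xC jJ) _; rewrite leq_addl.
Qed.

Lemma compact_simplex d : compact (@simplex d).
Proof.
apply: bounded_closed_compact.
  exists 1; split; first exact: num_real.
  move=> M M1 u [u0 u1] /=; rewrite [leLHS]mx_normrE; apply/bigmax_leP.
  split=> [|[k j] _ /=]; first by apply: ltW; apply: lt_trans M1.
  rewrite ord1 ger0_norm //; apply: le_trans (ltW M1).
  rewrite -u1 (bigD1 j) //= lerDl; exact: sumr_ge0.
have -> : @simplex d = \bigcap_i [set u | 0 <= u ord0 i] `&`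
    [set u | \sum_i u ord0 i = 1].
  by apply/seteqP; split=> [u [u0 u1]|u [u0 u1]]; split=> // i; [move=> _|]; apply: u0.
apply: closedI.
  apply: closed_bigI => i _.
  apply: (@closed_comp _ _ (fun u : 'rV[R]_d.+1 => u ord0 i) [set x | 0 <= x]).
    by move=> u _; apply: coord_continuous.
  exact: closed_ge.
apply: (@closed_comp _ _ (fun u : 'rV[R]_d.+1 => \sum_i u ord0 i) [set x | x = 1]).
  by move=> u _; apply: continuous_sum => i; exact: coord_continuous.
exact: closed_eq.
Qed.

Lemma coord_le_norm m n (x : 'M[R]_(m, n)) i j : `|x i j| <= `|x|.
Proof.
rewrite [leRHS]mx_normrE; apply/bigmax_geP; right => /=.
by exists (i, j).
Qed.

(** Without a fixed point some positive coordinate strictly decreases at each [u], which refutes the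
    approximate statement near [u] for all small [e]. Compactness makes [e] uniform. *)
Theorem brouwer_simplex d (f : 'rV[R]_d.+1 -> 'rV[R]_d.+1) :
  (forall u, simplex u -> forall e, 0 < e ->
    \forall x \near u, simplex x -> `|f u - f x| < e) ->
  (forall u, simplex u -> simplex (f u)) ->
  exists2 u, simplex u & f u = u.
Proof.
move=> fc fS; apply: contrapT => nofix.
have bad u : simplex u -> exists i, f u ord0 i < u ord0 i.
  move=> uS; apply: contrapT => h; apply: nofix; exists u => //.
  have le i : u ord0 i <= f u ord0 i.
    by rewrite leNgt; apply/negP => ?; apply: h; exists i.
  have [_ s1] := uS; have [_ s2] := fS _ uS.
  have s0 : \sum_i (f u ord0 i - u ord0 i) = 0 by rewrite sumrB s1 s2 subrr.
  apply/rowP => i; apply/eqP; rewrite -subr_eq0; apply/eqP.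
  by apply: (psumr_eq0P _ s0) => // j _; rewrite subr_ge0.
have /compact_near_coveringP := @compact_simplex d.
move=> /(_ R (0^'+) (fun e u => ~ forall i, u ord0 i <= e \/
    exists2 x, simplex x & `|x - u| <= e /\ x ord0 i <= f x ord0 i)) [].
  move=> u uS; have [i fi] := bad u uS.
  have ui0 : 0 < u ord0 i by apply: le_lt_trans fi; have [] := fS _ uS.
  pose e := (u ord0 i - f u ord0 i) / 2.
  have e0 : 0 < e by rewrite divr_gt0 // subr_gt0.
  have /nbhs_normP[r /= r0 hr] := fc u uS e e0.
  have [r' r'0 [r'r r'e r'u]] : exists2 r', 0 < r' & [/\ r' + r' <= r, r' + r' <= e & r' + r' <= u ord0 i].
    exists (Num.min (r / 2) (Num.min (e / 2) (u ord0 i / 2))).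
      by rewrite !lt_min; apply/and3P; split; apply: divr_gt0.
    have le t : Num.min (r / 2) (Num.min (e / 2) (u ord0 i / 2)) <= t / 2 ->
      Num.min (r / 2) (Num.min (e / 2) (u ord0 i / 2)) +
      Num.min (r / 2) (Num.min (e / 2) (u ord0 i / 2)) <= t by set m := Num.min _ _; lra.
    by split; apply: le; rewrite !ge_min lexx ?orbT.
  have ur' : nbhs u [set x | `|u - x| < r'].
    apply/(@nbhs_normP R 'rV[R]_d.+1 u (fun x => `|u - x| < r')); exists r' => //.
  exists ([set x | `|u - x| < r'], [set t | 0 < t < r']); first split=> //.
    by near=> t; apply/andP; split; near: t; [exact: nbhs_right_gt|exact: nbhs_right_lt].
  move=> [x t] /= [xu /andP[t0 tr]] /(_ i) [xt|[y yS [yx fy]]].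
    have := coord_le_norm (u - x) ord0 i; rewrite !mxE => /le_lt_trans /(_ xu).
    by rewrite ltr_norml; lra.
  have uy : `|u - y| < r.
    rewrite -(subrKA x); apply: le_lt_trans (ler_normD _ _) _.
    by rewrite (distrC x); lra.
  have /le_lt_trans := coord_le_norm (u - y) ord0 i; rewrite !mxE.
  have uye : `|u - y| < e.
    rewrite -(subrKA x); apply: le_lt_trans (ler_normD _ _) _.
    by rewrite (distrC x); lra.
  move=> /(_ _ uye); rewrite ltr_norml => /andP[_ h1].
  have : `|f u - f y| < e by exact: hr.
  have /le_lt_trans h := coord_le_norm (f u - f y) ord0 i.
  move=> /h; rewrite !mxE ltr_norml => /andP[h2 _].
  by move: h1 h2 fy; rewrite /e; lra.
move=> e /= e0 he; have [u uS h] := approximate_fixed_point (ltr0Sn R 0) fS.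
have e20 : 0 < e / 2 by rewrite divr_gt0.
have [v vS hv] := approximate_fixed_point e20 fS.
have : ball 0 e (e / 2).
  by rewrite /ball /= sub0r normrN gtr0_norm //; lra.
by move=> /he /(_ e20 _ vS); apply.
Unshelve. all: by end_near.
Qed.

(** The point sought is a fixed point of [y |-> c + (y - phi y)], which maps the cube to itself. To
    use the simplex, [psi] embeds the displacements bounded by [e] in it, and [rho] inverts [psi] up
    to translation by [c]. *)
Theorem brouwer_cube d (c : 'rV[R]_d) (e : R) (phi : 'rV[R]_d -> 'rV[R]_d) :
  0 < e ->
  (forall y, `|y - c| <= e -> forall r, 0 < r ->
    \forall x \near y, `|x - c| <= e -> `|phi y - phi x| < r) ->
  (forall y, `|y - c| <= e -> `|phi y - y| <= e) ->
  exists2 y, `|y - c| <= e & phi y = c.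
Proof.
move=> e0 phic phie.
(* At this scale the [d] numbers [(y j + e) / M] sum to at most 1, leaving a nonnegative zeroth
   barycentric coordinate; [d.+1] keeps [M] positive when [d] is 0. *)
pose M : R := 2 * e * d.+1%:R.
have M0 : 0 < M by rewrite !mulr_gt0.
pose clamp (t : R) := Num.max (- e) (Num.min e t).
have clampP t : - e <= clamp t <= e.
  by rewrite /clamp le_max lexx /= ge_max ge_min lexx /= andbT; lra.
have clamp_id t : - e <= t <= e -> clamp t = t.
  by move=> /andP[h1 h2]; rewrite /clamp min_r // max_r.
have clamp_lip s t : `|clamp s - clamp t| <= `|s - t|.
  wlog ts : s t / t <= s => [hw|].
    by have [/hw//|/ltW/hw] := leP t s; rewrite distrC (distrC t).
  rewrite (ger0_norm (_ : 0 <= s - t)) ?subr_ge0 // /clamp !maxEle !minEle.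
  by case: (leP e s) => ?; case: (leP e t) => ?;
    do !(case: ifPn; rewrite -?ltNge => ?); rewrite ler_norml; lra.
pose rho (u : 'rV[R]_d.+1) : 'rV[R]_d :=
  \row_i (c ord0 i + clamp (M * u ord0 (lift ord0 i) - e)).
have rhoP u : `|rho u - c| <= e.
  rewrite [leLHS]mx_normrE; apply/bigmax_leP; split=> [|[k j] _ /=]; first exact: ltW.
  by rewrite ord1 !mxE addrAC subrr add0r ler_norml clampP.
pose psi (y : 'rV[R]_d) : 'rV[R]_d.+1 :=
  \row_i (if unlift ord0 i is Some j then (y ord0 j + e) / M
          else 1 - \sum_j (y ord0 j + e) / M).
pose f u := psi (rho u - phi (rho u)).
have fS u : simplex u -> simplex (f u).
  move=> _; rewrite /f; set y := rho u - _.
  have yj j : - e <= y ord0 j <= e.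
    rewrite -ler_norml; apply: le_trans (coord_le_norm _ _ _) _.
    by rewrite /y distrC; apply: phie.
  have sM : \sum_j (y ord0 j + e) / M <= 1.
    rewrite -mulr_suml ler_pdivrMr // mul1r /M.
    apply: (@le_trans _ _ (\sum_(j < d) (2 * e))).
      by apply: ler_sum => j _; have := yj j; lra.
    by rewrite sumr_const card_ord -[leLHS]mulr_natr ler_wpM2l ?ler_nat // mulr_ge0 // ltW.
  split=> [i|].
    rewrite mxE; case: unliftP => [j _|_]; last by rewrite subr_ge0.
    by apply: divr_ge0; [have := yj j; lra|exact: ltW].
  rewrite big_ord_recl mxE unlift_none.
  rewrite [X in _ + X](eq_bigr (fun j => (y ord0 j + e) / M)) ?subrK // => j _.
  by rewrite mxE liftK.
have psi_lip y y' : `|psi y - psi y'| <= `|y - y'| / (2 * e).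
  have yj j : `|(y ord0 j + e) / M - (y' ord0 j + e) / M| <= `|y - y'| / M.
    rewrite -mulrBl opprD addrACA subrr addr0 normrM (gtr0_norm (_ : 0 < M^-1)) ?invr_gt0 //.
    rewrite ler_pM2r ?invr_gt0 //.
    by have := coord_le_norm (y - y') ord0 j; rewrite !mxE.
  have eM k : (k <= d.+1)%N -> `|y - y'| / M *+ k <= `|y - y'| / (2 * e).
    move=> kd; rewrite /M -mulr_natr invfM mulrA -mulrA ler_piMr //.
      by rewrite divr_ge0 // mulr_ge0 // ltW.
    by rewrite mulrC ler_pdivrMr ?ltr0n // mul1r ler_nat.
  rewrite [leLHS]mx_normrE; apply/bigmax_leP; split=> [|[k j] _ /=].
    by rewrite divr_ge0 // mulr_ge0 // ltW.
  rewrite !mxE; case: unliftP => [i _|_]; first exact: le_trans (yj i) (eM 1%N isT).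
  rewrite opprD addrACA subrr add0r -opprD normrN -sumrB.
  apply: le_trans (ler_norm_sum _ _ _) _.
  apply: le_trans (ler_sum _ (fun i _ => yj i)) _.
  by rewrite sumr_const card_ord; apply: eM.
have [u uS fu] : exists2 u, simplex u & f u = u.
  apply: brouwer_simplex fS => u uS r r0.
  have re0 : 0 < r * e by rewrite mulr_gt0.
  have /nbhs_normP[t /= t0 ht] := phic _ (rhoP u) _ re0.
  pose s := Num.min t (r * e) / M.
  have s0 : 0 < s by rewrite divr_gt0 // lt_min t0.
  apply/(@nbhs_normP R 'rV[R]_d.+1 u (fun x => simplex x -> `|f u - f x| < r)).
  exists s => // x /= ux _.
  have rho_lip : `|rho u - rho x| < Num.min t (r * e).
    apply: (@le_lt_trans _ _ (M * `|u - x|)); last by rewrite mulrC -ltr_pdivlMr.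
    rewrite [leLHS]mx_normrE; apply/bigmax_leP; split=> [|[k j] _ /=].
      by rewrite mulr_ge0 // ltW.
    rewrite ord1 !mxE opprD addrACA subrr add0r.
    apply: le_trans (clamp_lip _ _) _.
    rewrite opprD opprK addrACA addNr addr0 -mulrBr normrM (gtr0_norm M0) ler_pM2l //.
    by have := coord_le_norm (u - x) ord0 (lift ord0 j); rewrite !mxE.
  move: rho_lip; rewrite lt_min => /andP[h1 h2].
  have h3 : `|phi (rho u) - phi (rho x)| < r * e by apply: ht => //; exact: rhoP.
  apply: le_lt_trans (psi_lip _ _) _.
  rewrite ltr_pdivrMr ?mulr_gt0 // opprD addrACA -opprD.
  apply: le_lt_trans (ler_normB _ _) _.
  by rewrite mulrCA mulr_natl mulr2n; apply: ltrD.
exists (rho u) => //; apply/rowP => j.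
have [h _] := fS u uS.
have : f u ord0 (lift ord0 j) = u ord0 (lift ord0 j) by rewrite fu.
rewrite /f mxE liftK; set y := rho u - _.
have yj : - e <= y ord0 j <= e.
  rewrite -ler_norml; apply: le_trans (coord_le_norm _ _ _) _.
  by rewrite /y distrC; apply: phie.
move=> /(congr1 (fun t => t * M)); rewrite divfK ?gt_eqF // => yE.
have : rho u ord0 j = c ord0 j + y ord0 j.
  by rewrite mxE mulrC -yE addrK clamp_id.
by rewrite /y !mxE; lra.
Qed.
End Brouwer.

(** * Deforming a point away from itself in an orbit space *)

Section MatrixTopology.
Variable R : realType.

Lemma cvg_mx (T : Type) (F : set_system T) (FF : Filter F) m n
    (f : T -> 'M[R]_(m, n)) (M : 'M[R]_(m, n)) :
  (forall i j, f x i j @[x --> F] --> M i j) -> f x @[x --> F] --> M.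
Proof.
move=> h A [P MP sPA].
apply: (filterS (P := fun x => forall i j, P i j (f x i j))).
  by move=> x Px; apply: sPA.
by apply: filter_forall => i; apply: filter_forall => j; apply: h (MP i j).
Qed.

Lemma continuous_mx (T : topologicalType) m n (f : T -> 'M[R]_(m, n)) :
  (forall i j, continuous (fun x => f x i j)) -> continuous f.
Proof. by move=> h x; apply: cvg_mx => i j; apply: h. Qed.

Lemma continuous_entry (T : topologicalType) m n (f : T -> 'M[R]_(m, n)) i j :
  continuous f -> continuous (fun x => f x i j).
Proof.
move=> fc x; apply: (@continuous_comp _ _ _ f (fun M : 'M[R]_(m, n) => M i j)).
  exact: fc.
exact: coord_continuous.
Qed.

Lemma continuous_trmx (T : topologicalType) m n (f : T -> 'M[R]_(m, n)) :
  continuous f -> continuous (fun x => (f x)^T).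
Proof.
move=> fc; apply: continuous_mx => i j.
by under eq_fun do rewrite mxE; exact: continuous_entry.
Qed.

Lemma continuous_mulR (T : topologicalType) (f g : T -> R) :
  continuous f -> continuous g -> continuous (fun x => f x * g x).
Proof. by move=> fc gc x; apply: cvgM; [exact: fc|exact: gc]. Qed.

Lemma continuous_addR (T : topologicalType) (f g : T -> R) :
  continuous f -> continuous g -> continuous (fun x => f x + g x).
Proof. by move=> fc gc x; apply: cvgD; [exact: fc|exact: gc]. Qed.

Lemma continuous_oppR (T : topologicalType) (f : T -> R) :
  continuous f -> continuous (fun x => - f x).
Proof. by move=> fc x; apply: cvgN; exact: fc. Qed.

Lemma continuous_mulmx (T : topologicalType) m n p (f : T -> 'M[R]_(m, n))
    (g : T -> 'M[R]_(n, p)) :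
  continuous f -> continuous g -> continuous (fun x => f x *m g x).
Proof.
move=> fc gc; apply: continuous_mx => i j; under eq_fun do rewrite mxE.
apply: continuous_sum => k; apply: continuous_mulR; exact: continuous_entry.
Qed.

Lemma compact_bounded_closed_mx m (A : set 'cV[R]_m) (M : R) :
  (forall v, A v -> `|v| <= M) -> closed A -> compact A.
Proof.
move=> bA cA.
have trE : [set u : 'rV[R]_m | A u^T] = (fun u : 'rV[R]_m => u^T) @^-1` A by [].
have cB : compact [set u : 'rV[R]_m | A u^T].
  apply: bounded_closed_compact.
    exists M; split=> [|x Mx u /= /bA uM]; first exact: num_real.
    apply: le_trans (ltW Mx); apply: le_trans uM.
    rewrite [leLHS]mx_normrE; apply/bigmax_leP; split=> // -[k j] _ /=.
    by have := coord_le_norm u^T j k; rewrite mxE.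
  apply: (@closed_comp _ _ (fun u : 'rV[R]_m => u^T) A) => // u _.
  by apply: continuous_trmx => x; exact: cvg_id.
have -> : A = (fun u : 'rV[R]_m => u^T) @` [set u : 'rV[R]_m | A u^T].
  apply/seteqP; split=> [v Av|_ [u Au <-]//].
  by exists v^T; rewrite /= trmxK.
apply: continuous_compact cB; apply: continuous_subspaceT.
by apply: continuous_trmx => x; exact: cvg_id.
Qed.

End MatrixTopology.

Section Labile.
Variables (R : realType) (n : nat) (G : set 'M[R]_n).
Hypothesis hG : is_orthogonal_subgroup G.
Variable Phi : 'cV[R]_n -> R -> 'cV[R]_n -> Prop.
Hypothesis Phi_equivariant :
  forall g v s w, G g -> Phi v s w -> Phi (g *m v) s (g *m w).
Hypothesis Phi_total : forall v s, exists w, Phi v s w.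
Hypothesis Phi_orbit : forall v s w w', Phi v s w -> Phi v s w' ->
  exists2 g, G g & w' = g *m w.
Hypothesis Phi_refl : forall v, Phi v 0 v.
Hypothesis Phi_neq0 : forall v s, s != 0 -> ~ Phi v s 0.
Hypothesis Phi_closed :
  closed [set p : 'cV[R]_n * ('cV[R]_n * R) | Phi p.2.1 p.2.2 p.1].
Variable K : R.
Hypothesis K0 : 0 <= K.
Hypothesis Phi_bounded : forall v s w, Phi v s w -> `|w| <= K * (`|v| + `|s|).

Let X : topologicalType := orbit_space hG.
Let pi (v : 'cV[R]_n) : X := (\pi_X v)%qT.

Let pi_cont : continuous pi. Proof. exact: pi_continuous. Qed.

Let piP v w : pi v = pi w <-> exists2 g, G g & w = g *m v.
Proof.
have E : reflect (pi v = pi w) (orbit_rel G v w) := @eqmodP _ (orbit_equiv hG) v w.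
by split=> [/E/asboolP|?]; last by apply/E/asboolP.
Qed.

(** Upper semicontinuity of a set-valued map with closed graph and bounded values: the vectors of
    norm at most [B] outside [Om] form a compact set, each point of which is avoided near
    [(v0, s0)]. *)
Lemma Phi_usc v0 s0 (Om : set 'cV[R]_n) : open Om ->
  (forall w, Phi v0 s0 w -> Om w) ->
  \forall p \near (v0, s0), forall w, Phi p.1 p.2 w -> Om w.
Proof.
move=> oO h; pose B := K * (`|v0| + 1 + (`|s0| + 1)).
have cK : compact [set w | `|w| <= B /\ ~ Om w].
  apply: (@compact_bounded_closed_mx _ _ _ B) => [v []//|].
  rewrite (_ : mkset _ = [set w | `|w| <= B] `&` ~` Om) //.
  apply: closedI; last exact: open_closedC.
  apply: (@closed_comp _ _ (fun w : 'cV[R]_n => `|w|) [set x | x <= B]).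
    by move=> w _; exact: norm_continuous.
  exact: closed_le.
have /compact_near_coveringP := cK.
move=> /(_ _ (filter_prod (nbhs v0) (nbhs s0)) (fun p w => ~ Phi p.1 p.2 w)) [].
  move=> w [_ nO].
  have /closed_openC := Phi_closed; rewrite openE => /(_ (w, (v0, s0))) [].
    by move=> /= /h.
  by move=> [P Q] /= [Pw Qv] PQ; exists (P, Q) => //= -[w' p] /= [? ?]; exact: (PQ (w', p)).
move=> [A B'] /= [nA nB] AB.
have nA1 : nbhs v0 [set v : 'cV[R]_n | `|v| < `|v0| + 1].
  apply: (@norm_continuous R 'cV[R]_n v0 [set x | x < `|v0| + 1]).
  by apply: (@lt_nbhsl R); rewrite ltrDl.
have nB1 : nbhs s0 [set s : R | `|s| < `|s0| + 1].
  apply: (@norm_continuous R R s0 [set x | x < `|s0| + 1]).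
  by apply: (@lt_nbhsl R); rewrite ltrDl.
exists (A `&` [set v : 'cV[R]_n | `|v| < `|v0| + 1], B' `&` [set s : R | `|s| < `|s0| + 1]).
  by split; exact: filterI.
move=> [v s] /= [[Av /ltW h1] [Bs /ltW h2]] w Pw; apply: contrapT => nOw.
have np := AB (v, s) (conj Av Bs).
suff h' : [set w | `|w| <= B /\ ~ Om w] w by exact: np h' Pw.
split=> //; apply: le_trans (Phi_bounded Pw) _.
by rewrite /B ler_wpM2l // lerD.
Qed.

Let pi_open (A : set 'cV[R]_n) : open A -> open (pi @` A).
Proof.
move=> oA; rewrite /open /= /quotient_open.
have -> : \pi_X%qT @^-1` (pi @` A) = \bigcup_(g in G) ((fun v => g *m v) @^-1` A).
  apply/seteqP; split=> [v /= [w Aw /esym/piP[g Gg E]]|v [g Gg /= Agv]].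
    by exists g => //=; rewrite -E.
  by exists (g *m v) => //; apply/esym/piP; exists g.
apply: bigcup_open => g Gg; apply: open_comp => // v _.
by apply: (@continuous_mulmx _ _ _ _ _ (fun=> g) id); [exact: cst_continuous|move=> x; exact: cvg_id].
Qed.

Let F (x : X) (s : R) : X := pi (sval (cid (Phi_total (repr x) s))).

(** Equivariance and the single-orbit hypothesis cancel the two choices in [F], that of a
    representative and that of [w]. *)
Let F_pi v s w : Phi v s w -> F (pi v) s = pi w.
Proof.
move=> Pw; rewrite /F; case: cid => w0 /= Pw0.
have [g Gg E] : exists2 g, G g & v = g *m repr (pi v).
  by apply/piP; rewrite /pi reprK.
have := Phi_equivariant Gg Pw0; rewrite -E => /(Phi_orbit Pw)[k Gk E'].
have -> : pi w0 = pi (g *m w0) by apply/piP; exists g.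
by apply/esym/piP; exists k.
Qed.

Let F_near x0 s0 (Om : set X) : open Om -> Om (F x0 s0) ->
  exists A B, [/\ nbhs x0 A, nbhs s0 B & forall x s, A x -> B s -> Om (F x s)].
Proof.
move=> oO OF.
have [] := @Phi_usc (repr x0) s0 (pi @^-1` Om).
- by move/continuousP: pi_cont; apply.
- move=> w /F_pi; rewrite /pi reprK => h; by rewrite /= /pi -h.
move=> [A B] /= [nA nB] AB.
exists (pi @` A), B; split=> //.
  have : nbhs (repr x0) A by [].
  rewrite nbhsE => -[A' [oA' A'x] sA].
  apply: (@filterS _ (nbhs x0) _ (pi @` A')); first exact: image_subset.
  apply: open_nbhs_nbhs; split; first exact: pi_open.
  by exists (repr x0) => //; rewrite /pi reprK.
move=> _ s [v Av <-] Bs; have [w Pw] := Phi_total v s.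
by rewrite (F_pi Pw); apply: (AB (v, s)).
Qed.

Theorem not_locally_euclidean d : ~ locally_euclidean R d X.
Proof.
move=> /(_ (pi 0)) [U [f [h [[oU U0 oV] [fc hc hf]]]]].
set V := f @` U in oV hc.
pose c := f (pi 0).
have fcont x : U x -> {for x, continuous f}.
  move=> Ux; move: fc; rewrite continuous_open_subspace // => /(_ x).
  by apply; rewrite inE.
have hcont y : V y -> {for y, continuous h}.
  move=> Vy; move: hc; rewrite continuous_open_subspace // => /(_ y).
  by apply; rewrite inE.
have F0 x : F x 0 = x.
  have -> : x = pi (repr x) by rewrite /pi reprK.
  exact: F_pi (Phi_refl _).
have [e e0 eV] : exists2 e, 0 < e & forall y, `|y - c| <= e -> V y.
  have : nbhs c V by apply: open_nbhs_nbhs; split=> //; exists (pi 0).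
  move=> /nbhs_normP[r /= r0 hr]; exists (r / 2); first exact: divr_gt0.
  move=> y yc; apply: hr => /=; rewrite distrC; apply: le_lt_trans yc _.
  by rewrite ltr_pdivrMr // ltr_pMr // ltr1n.
have hU y : V y -> U (h y) /\ f (h y) = y.
  by move=> [x Ux <-]; rewrite hf.
have Fnear y s (r : R) : V y -> 0 < r -> U (F (h y) s) -> exists A B,
    [/\ nbhs y A, nbhs s B & forall y' s', A y' -> B s' ->
      U (F (h y') s') /\ `|f (F (h y) s) - f (F (h y') s')| < r].
  move=> Vy r0 UF.
  have nb : nbhs (F (h y) s) (U `&` [set x | `|f (F (h y) s) - f x| < r]).
    apply: filterI; first by apply: open_nbhs_nbhs.
    have := fcont _ UF => /cvgrPdist_lt; exact.
  move: nb; rewrite nbhsE => -[Om [oO OF] sO].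
  have [A [B [nA nB AB]]] := F_near oO OF.
  exists (h @^-1` A), B; split=> //; first exact: (hcont _ Vy).
  by move=> y' s' /= Ay Bs; apply: sO; apply: AB.
(* At s = 0 the map [F] is the identity. Compactness of the cube turns continuity there into one
   nonzero [s] whose displacement is at most [e] everywhere. *)
have [s s0 hs] : exists2 s, s != 0 & forall y, `|y - c| <= e ->
    U (F (h y) s) /\ `|f (F (h y) s) - y| <= e.
  have cQ : compact [set y : 'rV[R]_d | `|y - c| <= e].
    apply: bounded_closed_compact.
      exists (`|c| + e); split=> [|M Mx y /= yc]; first exact: num_real.
      apply: le_trans (ltW Mx); rewrite -(subrK c y) addrC.
      by apply: le_trans (ler_normD _ _) _; rewrite lerD2l.
    apply: (@closed_comp _ _ (fun y : 'rV[R]_d => `|y - c|) [set x | x <= e]).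
      move=> y _; apply: (@continuous_comp _ _ _ (fun y : 'rV[R]_d => y - c) (fun x => `|x|)).
        by apply: (@cvgB R 'rV[R]_d _ (nbhs y) _ id (fun=> c)); [exact: cvg_id|exact: cvg_cst].
      exact: norm_continuous.
    exact: closed_le.
  have /compact_near_coveringP := cQ.
  move=> /(_ _ (0^') (fun s y => U (F (h y) s) /\ `|f (F (h y) s) - y| <= e)) [].
    move=> y /eV Vy; have [Uy fy] := hU _ Vy.
    have e20 : 0 < e / 2 by rewrite divr_gt0.
    have [A [B [nA nB AB]]] : exists A B,
      [/\ nbhs y A, nbhs (0 : R) B & forall y' s', A y' -> B s' ->
      U (F (h y') s') /\ `|f (F (h y) 0) - f (F (h y') s')| < e / 2].
      by apply: Fnear => //; rewrite F0.
    have nA' : nbhs y [set y' | `|y - y'| < e / 2].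
      apply/(@nbhs_normP R 'rV[R]_d y (fun x => `|y - x| < e / 2)).
      by exists (e / 2).
    exists (A `&` [set y' | `|y - y'| < e / 2], B) => /=.
      split; first exact: filterI.
      by apply: (filterS _ nB).
    move=> [y' s'] /= [[Ay' yy'] Bs'].
    have [h1 h2] := AB _ _ Ay' Bs'; split=> //.
    rewrite F0 fy in h2.
    rewrite -(subrKA y) [e]splitr; apply: ltW; apply: le_lt_trans (ler_normD _ _) _.
    by apply: ltrD => //; rewrite distrC.
  move=> r /= r0 hr; exists (r / 2); first by rewrite gt_eqF // divr_gt0.
  move=> y yc; apply: (hr (r / 2)) => //=; last by rewrite gt_eqF // divr_gt0.
  by rewrite sub0r normrN gtr0_norm ?divr_gt0 // ltr_pdivrMr // ltr_pMr // ltr1n.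
have [y yc phiy] : exists2 y, `|y - c| <= e & f (F (h y) s) = c.
  apply: (@brouwer_cube R d c e (fun y => f (F (h y) s))) => // [y yc r r0|y /hs[]//].
  have [UF _] := hs _ yc.
  have [A [B [nA nB AB]]] := Fnear y s r (eV _ yc) r0 UF.
  apply: (filterS _ nA) => y' Ay' _.
  by have [] := AB _ _ Ay' (nbhs_singleton nB).
have [UF _] := hs _ yc.
(* The orbit of 0 is the single vector 0, so reaching the centre of the chart would mean [Phi v s 0]
   with [s] nonzero. *)
have : F (h y) s = pi 0 by rewrite -(hf _ UF) phiy hf.
rewrite /F; case: cid => w /= Pw /piP[g Gg gw].
have /(congr1 (mulmx (invmx g))) := gw.
have gO := orthogonal_subgroup_sub hG Gg.
have [_ gU] := mulmx1_unit gO.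
rewrite mulmx0 mulKmx // => w0; rewrite -w0 in Pw.
exact: Phi_neq0 s0 Pw.
Qed.
End Labile.

(** * Euclidean geometry and the matrix exponential *)

Section Dot.
Variables (R : realType) (n : nat).
Implicit Types u v w : 'cV[R]_n.

Definition dot u v : R := (u^T *m v) ord0 ord0.

Lemma dotE u v : dot u v = \sum_i u i ord0 * v i ord0.
Proof. by rewrite /dot mxE; apply: eq_bigr => i _; rewrite mxE. Qed.

Lemma dotC u v : dot u v = dot v u.
Proof. by rewrite !dotE; apply: eq_bigr => i _; rewrite mulrC. Qed.

Lemma dotDl u v w : dot (u + v) w = dot u w + dot v w.
Proof. by rewrite /dot raddfD mulmxDl mxE. Qed.

Lemma dotZl a u v : dot (a *: u) v = a * dot u v.
Proof. by rewrite /dot linearZ -scalemxAl mxE. Qed.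

Lemma dotDr u v w : dot w (u + v) = dot w u + dot w v.
Proof. by rewrite dotC dotDl !(dotC _ w). Qed.

Lemma dotZr a u v : dot v (a *: u) = a * dot v u.
Proof. by rewrite dotC dotZl dotC. Qed.

Lemma dotNl u v : dot (- u) v = - dot u v.
Proof. by rewrite -scaleN1r dotZl mulN1r. Qed.

Lemma dotNr u v : dot v (- u) = - dot v u.
Proof. by rewrite dotC dotNl dotC. Qed.

Lemma dotBl u v w : dot (u - v) w = dot u w - dot v w.
Proof. by rewrite dotDl dotNl. Qed.

Lemma dotBr u v w : dot w (u - v) = dot w u - dot w v.
Proof. by rewrite dotDr dotNr. Qed.

Lemma dot0l v : dot 0 v = 0.
Proof. by rewrite -(scale0r 0) dotZl mul0r. Qed.

Lemma dot0r v : dot v 0 = 0.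
Proof. by rewrite dotC dot0l. Qed.

Lemma dot_suml I (r : seq I) (P : pred I) (F : I -> 'cV[R]_n) v :
  dot (\sum_(i <- r | P i) F i) v = \sum_(i <- r | P i) dot (F i) v.
Proof.
by elim/big_rec2: _ => [|i x y _ <-]; rewrite ?dot0l ?dotDl.
Qed.

Lemma dot_ge0 v : 0 <= dot v v.
Proof. by rewrite dotE; apply: sumr_ge0 => i _; rewrite -expr2 sqr_ge0. Qed.

Lemma dot_eq0 v : dot v v = 0 -> v = 0.
Proof.
rewrite dotE => /psumr_eq0P h; apply/colP => i; rewrite mxE; apply/eqP.
by rewrite -sqrf_eq0 expr2 h // => j _; rewrite -expr2 sqr_ge0.
Qed.

Lemma dot_gt0 v : v != 0 -> 0 < dot v v.
Proof.
move=> v0; rewrite lt_neqAle dot_ge0 andbT eq_sym.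
by apply: contra_neq v0; exact: dot_eq0.
Qed.

Lemma dot_mulmx (A : 'M[R]_n) u v : dot (A *m u) v = dot u (A^T *m v).
Proof. by rewrite /dot trmx_mul mulmxA. Qed.

Lemma dot_ext u v : (forall w, dot u w = dot v w) -> u = v.
Proof. by move=> h; apply/eqP; rewrite -subr_eq0; apply/eqP/dot_eq0; rewrite dotBl h subrr. Qed.

Lemma cauchy_schwarz u v : dot u u = dot v v -> dot u v <= dot v v.
Proof.
move=> uv; have := dot_ge0 (u - v); rewrite dotBl !dotBr (dotC v u) uv; lra.
Qed.

Lemma dot_orthogonal (g : 'M[R]_n) u v :
  g^T *m g = 1%:M -> dot (g *m u) (g *m v) = dot u v.
Proof. by move=> gO; rewrite dot_mulmx mulmxA gO mul1mx. Qed.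

Lemma skew_of_dot (A : 'M[R]_n) : (forall u, dot (A *m u) u = 0) -> A^T = - A.
Proof.
move=> h; have h2 u v : dot (A *m u) v = - dot u (A *m v).
  have := h (u + v); rewrite mulmxDr !dotDl !dotDr !h (dotC u); lra.
apply/matrixP => i j; rewrite !mxE.
have := h2 (delta_mx j ord0) (delta_mx i ord0).
have dE (B : 'M[R]_n) k l : dot (B *m delta_mx k ord0) (delta_mx l ord0) = B l k.
  rewrite -colE dotE (bigD1 l) //= big1 ?addr0 => [|m ml].
    by rewrite !mxE !eqxx mulr1.
  by rewrite !mxE (negbTE ml) mulr0.
by rewrite dE dotC dE => ->; rewrite opprK.
Qed.

Lemma continuous_dot (T : topologicalType) (f g : T -> 'cV[R]_n) :
  continuous f -> continuous g -> continuous (fun x => dot (f x) (g x)).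
Proof.
move=> fc gc; rewrite /dot; apply: continuous_entry; apply: continuous_mulmx => //.
exact: continuous_trmx.
Qed.

End Dot.

Section Exponential.
Variables (R : realType) (n : nat).
Implicit Types A B g : 'M[R]_n.

Let expmxS A k : A ^+ k.+1 = A *m A ^+ k. Proof. exact: exprS. Qed.

Let expmxSr A k : A ^+ k.+1 = A ^+ k *m A. Proof. exact: exprSr. Qed.

Let mx_exp_series A : nat -> 'M[R]_n :=
  series (fun k : nat => (k`!%:R)^-1 *: (A ^+ k)).

(** The norm of a matrix is its largest entry, which is submultiplicative only up to the factor
    [n]. *)
Let bound A : R := n%:R * `|A|.

Let expr_entry A k i j : `|(A ^+ k) i j| <= bound A ^+ k.
Proof.
elim: k i j => [|k IH] i j.
  by rewrite !expr0 mxE; case: (i == j); rewrite ?normr1 ?normr0 ?ler01.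
rewrite exprS mxE; apply: le_trans (ler_norm_sum _ _ _) _.
apply: (@le_trans _ _ (\sum_(l < n) `|A| * bound A ^+ k)).
  apply: ler_sum => l _; rewrite normrM; apply: ler_pM => //; exact: coord_le_norm.
by rewrite sumr_const card_ord -mulr_natl mulrA exprS.
Qed.

Let bound_ge0 A : 0 <= bound A. Proof. by rewrite mulr_ge0. Qed.

Let exp_series_le (x : R) N : 0 <= x -> series (exp_coeff x) N <= expR x.
Proof.
move=> x0; rewrite /expR; apply: nondecreasing_cvgn_le; last exact: is_cvg_series_exp_coeff.
apply/nondecreasing_seqP => k; rewrite -subr_ge0 seriesSB.
exact: exp_coeff_ge0.
Qed.

Let entry_series A N i j : mx_exp_series A N i j =
  series (fun k => (k`!%:R)^-1 * (A ^+ k) i j) N.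
Proof.
by rewrite /mx_exp_series /series /= summxE; apply: eq_bigr => k _; rewrite mxE.
Qed.

Lemma mx_exp_cvg A : mx_exp_series A @ \oo --> mx_exp A.
Proof.
have [M hM] : exists M : 'M[R]_n, mx_exp_series A @ \oo --> M.
  exists (\matrix_(i, j) limn (series (fun k => (k`!%:R)^-1 * (A ^+ k) i j))).
  apply: cvg_mx => i j; rewrite mxE; under eq_cvg do rewrite entry_series.
  apply: (@normed_cvg R R).
  apply: (series_le_cvg (v_ := exp_coeff (bound A))).
  - by move=> k /=.
  - by move=> k; exact: exp_coeff_ge0.
  - move=> k /=; rewrite normrM ger0_norm ?invr_ge0 // /exp_coeff /= mulrC.
    by rewrite ler_pM2r ?invr_gt0 ?ltr0n ?fact_gt0.
  - exact: is_cvg_series_exp_coeff.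
by rewrite /mx_exp (cvg_lim _ hM) //; exact: norm_hausdorff.
Qed.

Lemma mx_exp_conj A g h : h *m g = 1%:M -> g *m mx_exp A = mx_exp (g *m A *m h) *m g.
Proof.
move=> hg.
have powE k : g *m A ^+ k = (g *m A *m h) ^+ k *m g.
  elim: k => [|k IH]; first by rewrite !expr0 mulmx1 mul1mx.
  rewrite !expmxSr mulmxA IH -!mulmxA; congr (_ *m _).
  by rewrite hg mulmx1.
have h1 : g *m mx_exp_series A N @[N --> \oo] --> g *m mx_exp A.
  apply: (@cvg_comp _ _ _ (mx_exp_series A) (mulmx g)); first exact: mx_exp_cvg.
  by apply: (@continuous_mulmx _ _ _ _ _ (fun=> g) id); [exact: cst_continuous|move=> x; exact: cvg_id].
have h2 : mx_exp_series (g *m A *m h) N *m g @[N --> \oo] --> mx_exp (g *m A *m h) *m g.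
  apply: (@cvg_comp _ _ _ (mx_exp_series (g *m A *m h)) (mulmxr g)); first exact: mx_exp_cvg.
  by apply: (@continuous_mulmx _ _ _ _ _ id (fun=> g)); [move=> x; exact: cvg_id|exact: cst_continuous].
have E : (fun N => g *m mx_exp_series A N) = (fun N => mx_exp_series (g *m A *m h) N *m g).
  apply/funext => N; rewrite /mx_exp_series /series /= mulmx_sumr mulmx_suml.
  by apply: eq_bigr => k _; rewrite -scalemxAr -scalemxAl powE.
rewrite E in h1; exact: (cvg_unique (@norm_hausdorff _ _) h1 h2).
Qed.

Lemma mx_exp_commute A B : B *m A = A *m B -> B *m mx_exp A = mx_exp A *m B.
Proof.
move=> BA.
have powE k : B *m A ^+ k = A ^+ k *m B.
  elim: k => [|k IH]; first by rewrite !expr0 mulmx1 mul1mx.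
  by rewrite !expmxS mulmxA BA -mulmxA IH mulmxA.
have h1 : B *m mx_exp_series A N @[N --> \oo] --> B *m mx_exp A.
  apply: (@cvg_comp _ _ _ (mx_exp_series A) (mulmx B)); first exact: mx_exp_cvg.
  by apply: (@continuous_mulmx _ _ _ _ _ (fun=> B) id); [exact: cst_continuous|move=> x; exact: cvg_id].
have h2 : mx_exp_series A N *m B @[N --> \oo] --> mx_exp A *m B.
  apply: (@cvg_comp _ _ _ (mx_exp_series A) (mulmxr B)); first exact: mx_exp_cvg.
  by apply: (@continuous_mulmx _ _ _ _ _ id (fun=> B)); [move=> x; exact: cvg_id|exact: cst_continuous].
have E : (fun N => B *m mx_exp_series A N) = (fun N => mx_exp_series A N *m B).
  apply/funext => N; rewrite /mx_exp_series /series /= mulmx_sumr mulmx_suml.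
  by apply: eq_bigr => k _; rewrite -scalemxAr -scalemxAl powE.
rewrite E in h1; exact: (cvg_unique (@norm_hausdorff _ _) h1 h2).
Qed.

Lemma mx_exp_fix A (v : 'cV[R]_n) : A *m v = 0 -> mx_exp A *m v = v.
Proof.
move=> Av.
have h1 : mx_exp_series A N *m v @[N --> \oo] --> mx_exp A *m v.
  apply: (@cvg_comp _ _ _ (mx_exp_series A) (mulmxr v)); first exact: mx_exp_cvg.
  by apply: (@continuous_mulmx _ _ _ _ _ id (fun=> v)); [move=> x; exact: cvg_id|exact: cst_continuous].
have h2 : mx_exp_series A N *m v @[N --> \oo] --> v.
  rewrite -(cvg_shiftn 1) /=.
  rewrite (_ : (fun N => _) = (fun=> v)); first exact: cvg_cst.
  apply/funext => N; rewrite addn1 /mx_exp_series /series /= big_nat_recl //= mulmxDl.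
  rewrite expr0 fact0 invr1 scale1r mul1mx mulmx_suml big1 ?addr0 // => k _.
  by rewrite expmxSr -scalemxAl -mulmxA Av mulmx0 scaler0.
exact: (cvg_unique (@norm_hausdorff _ _) h1 h2).
Qed.

(** For [|t| <= 1] every term from the third power on carries a factor at most [|t| ^+ 3]; what is
    left is a tail of the real exponential series of [bound A]. *)
Lemma mx_exp_expansion A : exists2 C : R, 0 <= C & forall t, `|t| <= 1 -> forall i j,
  `|(mx_exp (t *: A) - (1%:M + t *: A + (t ^+ 2 / 2) *: (A *m A))) i j| <= C * `|t| ^+ 3.
Proof.
exists (expR (bound A)) => [|t t1 i j]; first exact: expR_ge0.
set P := 1%:M + _ + _.
have h : mx_exp_series (t *: A) N i j - P i j @[N --> \oo] --> mx_exp (t *: A) i j - P i j.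
  apply: cvgB; last exact: cvg_cst.
  apply: (@cvg_comp _ _ _ (mx_exp_series (t *: A)) (fun M : 'M[R]_n => M i j)).
    exact: mx_exp_cvg.
  exact: coord_continuous.
have hn : `|mx_exp_series (t *: A) N i j - P i j| @[N --> \oo] --> `|mx_exp (t *: A) i j - P i j|.
  exact: cvg_norm.
rewrite [X in `|X|](_ : _ = mx_exp (t *: A) i j - P i j); last by rewrite !mxE.
apply: (@closed_cvg _ R _ _ _ (fun x : R => x <= expR (bound A) * `|t| ^+ 3) _ _ _ hn).
  exact: closed_le.
near=> N.
have N3 : (3 <= N)%N by near: N; exact: nbhs_infty_ge.
have powZ k : (t *: A) ^+ k = t ^+ k *: A ^+ k.
  elim: k => [|k IH]; first by rewrite !expr0 scale1r.
  by rewrite !expmxS IH -scalemxAl -scalemxAr scalerA exprS.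
rewrite entry_series /series /= (big_cat_nat (n := 3)) //=.
have -> : \sum_(0 <= k < 3) (k`!%:R)^-1 * ((t *: A) ^+ k) i j = P i j.
  rewrite !big_nat_recr //= big_geq // add0r !powZ /P !mxE.
  rewrite !factS fact0 !muln1 invr1 expr0 !expr1 !mul1r mulrA.
  by rewrite [2^-1 * _]mulrC.
rewrite addrAC subrr add0r; apply: le_trans (ler_norm_sum _ _ _) _.
apply: (@le_trans _ _ (\sum_(3 <= k < N) exp_coeff (bound A) k * `|t| ^+ 3)).
  rewrite big_nat_cond [leRHS]big_nat_cond; apply: ler_sum => k /andP[/andP[k3 _] _].
  rewrite powZ !mxE !normrM ger0_norm ?invr_ge0 // /exp_coeff /= normrX.
  rewrite [leRHS](_ : _ = k`!%:R^-1 * (`|t| ^+ 3 * bound A ^+ k)); last by ring.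
  apply: ler_wpM2l; first by rewrite invr_ge0.
  by apply: ler_pM => //; exact: ler_wiXn2l.
rewrite -mulr_suml ler_wpM2r ?exprn_ge0 //.
apply: le_trans (exp_series_le N (bound_ge0 A)).
rewrite /series /= [leRHS](big_cat_nat (n := 3)) //= lerDr.
by apply: sumr_ge0 => k _; exact: exp_coeff_ge0.
Unshelve. all: by end_near. Qed.

End Exponential.

(** * First and second variations along one-parameter groups *)

Section MaximumPrinciple.
Variables (R : realType) (n : nat).
Implicit Types (A g h : 'M[R]_n) (u v w : 'cV[R]_n).

(** Near 0 a nonzero linear term outweighs the others for [t] of the sign of [a]; once it is gone, a
    positive quadratic term outweighs the cubic error. *)
Lemma quadratic_max (a b C e : R) : 0 < e ->
  (forall t, `|t| < e -> a * t + b * t ^+ 2 <= C * `|t| ^+ 3) -> a = 0 /\ b <= 0.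
Proof.
move=> e0 h.
have C1 : 0 < `|b| + `|C| + 1 by rewrite ltr_wpDl // addr_ge0.
have a0 : a = 0.
  apply/eqP; apply/negPn/negP => a0.
  have a_gt0 : 0 < `|a| by rewrite normr_gt0.
  pose s := Num.min (e / 2) (Num.min 1 (`|a| / 2 / (`|b| + `|C| + 1))).
  have s0 : 0 < s by rewrite !lt_min ltr01 !divr_gt0.
  have se : s < e by rewrite !gt_min ltr_pdivrMr // ltr_pMr // ltr1n.
  have s1 : s <= 1 by rewrite !ge_min lexx orbT.
  have sa : s * (`|b| + `|C| + 1) <= `|a| / 2.
    by rewrite -ler_pdivlMr // !ge_min lexx !orbT.
  have := h (Num.sg a * s); rewrite !normrM normr_sg a0 mul1r (gtr0_norm s0) => /(_ se).
  rewrite mulrA (mulrC a) -normrEsg exprMn sqr_sg a0 mul1r.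
  have b1 : - `|b| <= b by rewrite lerNl -normrN ler_norm.
  have c1 := ler_norm C.
  have s20 : 0 <= s ^+ 2 by rewrite exprn_ge0 // ltW.
  have h1 : - `|b| * s ^+ 2 <= b * s ^+ 2 by rewrite ler_wpM2r.
  have h2 : C * s ^+ 3 <= `|C| * s ^+ 2.
    apply: (@le_trans _ _ (`|C| * s ^+ 3)); first by rewrite ler_wpM2r // exprn_ge0 // ltW.
    rewrite ler_wpM2l // exprS ler_piMl //.
  have h3 : s * (s * (`|b| + `|C| + 1)) <= s * (`|a| / 2) by rewrite ler_pM2l.
  have h4 : 0 < s * s by rewrite mulr_gt0.
  have h5 : 0 < `|a| * s by rewrite mulr_gt0.
  rewrite !expr2 in h1 h2 *; nra.
split=> //; rewrite leNgt; apply/negP => b0.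
pose s := Num.min (e / 2) (b / 2 / (`|C| + 1)).
have C0 : 0 < `|C| + 1 by rewrite ltr_wpDl.
have s0 : 0 < s by rewrite !lt_min !divr_gt0.
have se : s < e by rewrite !gt_min ltr_pdivrMr // ltr_pMr // ltr1n.
have sb : s * (`|C| + 1) <= b / 2 by rewrite -ler_pdivlMr // !ge_min lexx orbT.
have := h s; rewrite (gtr0_norm s0) => /(_ se); rewrite a0 mul0r add0r.
rewrite (exprS s 2) (mulrA C) ler_pM2r ?exprn_gt0 // => hb.
have : C * s <= `|C| * s by rewrite ler_wpM2r ?ler_norm // ltW.
lra.
Qed.

Lemma dot_exp A u v : exists C : R, forall t, `|t| <= 1 ->
  `|dot (mx_exp (t *: A) *m u) v -
    (dot u v + t * dot (A *m u) v + t ^+ 2 / 2 * dot (A *m (A *m u)) v)| <= C * `|t| ^+ 3.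
Proof.
have [C C0 hC] := mx_exp_expansion A.
exists (\sum_i \sum_j C * `|u j ord0| * `|v i ord0|) => t t1.
set M := mx_exp _.
pose N := M - (1%:M + t *: A + (t ^+ 2 / 2) *: (A *m A)).
rewrite [X in `|X|](_ : _ = dot (N *m u) v); last first.
  rewrite /N mulmxBl !mulmxDl mul1mx -!scalemxAl -mulmxA dotBl !dotDl !dotZl; ring.
rewrite dotE mulr_suml; apply: le_trans (ler_norm_sum _ _ _) _; apply: ler_sum => i _.
rewrite mxE mulr_suml mulr_suml; apply: le_trans (ler_norm_sum _ _ _) _.
apply: ler_sum => j _; rewrite !normrM.
rewrite [leRHS](_ : _ = (C * `|t| ^+ 3) * `|u j ord0| * `|v i ord0|); last by ring.
by rewrite ler_wpM2r // ler_wpM2r //; exact: hC.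
Qed.

Lemma local_max A u v (e : R) : 0 < e ->
  (forall t, `|t| < e -> dot (mx_exp (t *: A) *m u) v <= dot u v) ->
  dot (A *m u) v = 0 /\ dot (A *m (A *m u)) v <= 0.
Proof.
move=> e0 h; have [C hC] := dot_exp A u v.
have [] := @quadratic_max (dot (A *m u) v) (dot (A *m (A *m u)) v / 2) C (Num.min e 1).
- by rewrite lt_min e0 ltr01.
- move=> t; rewrite lt_min => /andP[te /ltW t1].
  have := hC t t1; rewrite ler_norml => /andP[h1 _]; have := h t te; lra.
by move=> -> h2; split=> //; lra.
Qed.

(* Maximizing [dot (h w) u] over [h] in [H] gives an [h] at which the first and
   second variations along one-parameter groups have the required sign. *)
Lemma maximum_principle (H S : set 'M[R]_n) w u : compact H -> H !=set0 ->
  (forall A, S A -> A^T = - A) ->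
  (forall A h, S A -> H h -> exists2 e : R, 0 < e &
     forall t, `|t| < e -> H (mx_exp (t *: A) *m h)) ->
  exists2 h, H h & forall A, S A ->
    dot (A *m (h *m w)) u = 0 /\ 0 <= dot (A *m (h *m w)) (A *m u).
Proof.
move=> cH H0 skS HS.
have fc : continuous (fun h : 'M[R]_n => dot (h *m w) u).
  apply: continuous_dot; last exact: cst_continuous.
  by apply: continuous_mulmx; [move=> x; exact: cvg_id|exact: cst_continuous].
have [h Hh hmax] : exists2 h, h \in H & forall k, k \in H -> dot (k *m w) u <= dot (h *m w) u.
  by apply: compact_EVT_max => //; exact: continuous_subspaceT.
rewrite inE in Hh; exists h => // A SA; have [e e0 he] := HS A h SA Hh.
have [h1 h2] : dot (A *m (h *m w)) u = 0 /\ dot (A *m (A *m (h *m w))) u <= 0.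
  apply: (local_max e0) => t te; rewrite mulmxA; apply: hmax; rewrite inE; exact: he.
split=> //; rewrite [dot (A *m _) u]dot_mulmx skS // mulNmx dotNr in h2; lra.
Qed.

End MaximumPrinciple.

Section LieAlgebra.
Variables (R : realType) (n : nat) (G : set 'M[R]_n).
Hypothesis hG : is_orthogonal_subgroup G.

Lemma orthogonalP g : G g -> g^T *m g = 1%:M.
Proof. exact: (orthogonal_subgroup_sub hG). Qed.

Lemma orthogonal_invmx g : G g -> invmx g = g^T.
Proof.
move=> Gg; have gO := orthogonalP Gg; have [_ gU] := mulmx1_unit gO.
by rewrite -[g^T]mulmx1 -(mulmxV gU) mulmxA gO mul1mx.
Qed.

Lemma orthogonal_tr g : G g -> G g^T.
Proof. by move=> Gg; rewrite -orthogonal_invmx //; exact: (orthogonal_subgroup_inv hG). Qed.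

Lemma orthogonal_trK g : G g -> g *m g^T = 1%:M.
Proof. by move=> Gg; apply: mulmx1C; exact: orthogonalP. Qed.

(** Since [mx_exp (t *: A)] is orthogonal, Cauchy-Schwarz makes t = 0 a maximum of its pairing of
    [u] with itself, and the first variation vanishes. *)
Lemma lie_skew A : lie_algebra G A -> A^T = - A.
Proof.
move=> gA; apply: skew_of_dot => u.
have [] // := @local_max R n A u u 1 ltr01 => t _.
apply: cauchy_schwarz; rewrite dot_orthogonal //; apply: orthogonalP; exact: gA.
Qed.

Lemma lie_conj A g : G g -> lie_algebra G A -> lie_algebra G (g *m A *m g^T).
Proof.
move=> Gg gA t; have gO := orthogonalP Gg.
have -> : t *: (g *m A *m g^T) = g *m (t *: A) *m g^T.
  by rewrite -scalemxAr -scalemxAl.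
have E := mx_exp_conj (t *: A) gO.
have -> : mx_exp (g *m (t *: A) *m g^T) = g *m mx_exp (t *: A) *m g^T.
  by rewrite E -[RHS]mulmxA orthogonal_trK // mulmx1.
apply: (orthogonal_subgroup_mul hG); last exact: orthogonal_tr.
by apply: (orthogonal_subgroup_mul hG).
Qed.

End LieAlgebra.

(** * Orthogonal families *)

Section OrthogonalFamilies.
Variables (R : realType) (n : nat).
Implicit Types (u v w : 'cV[R]_n) (s c : seq 'cV[R]_n) (T : {vspace 'cV[R]_n}).

Fixpoint orth s : bool :=
  if s is v :: s' then [&& v != 0, all (fun b => dot v b == 0) s' & orth s'] else true.

Lemma orth_cons v s : orth (v :: s) = [&& v != 0, all (fun b => dot v b == 0) s & orth s].
Proof. by []. Qed.

Lemma orth_neq0 s b : orth s -> b \in s -> b != 0.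
Proof.
elim: s => //= v s IH /and3P[v0 _ os]; rewrite inE => /orP[/eqP ->//|]; exact: IH.
Qed.

Lemma orth_dot s b b' : orth s -> b \in s -> b' \in s -> b != b' -> dot b b' = 0.
Proof.
elim: s => //= v s IH /and3P[v0 /allP vs os]; rewrite !inE.
move=> /orP[/eqP ->|bs] /orP[/eqP ->|b's]; first by rewrite eqxx.
- by move=> _; apply/eqP/vs.
- by move=> _; rewrite dotC; apply/eqP/vs.
- exact: IH.
Qed.

Lemma orth_uniq s : orth s -> uniq s.
Proof.
elim: s => //= v s IH /and3P[v0 /allP vs /IH ->]; rewrite andbT.
apply/negP => /vs /eqP/dot_eq0 h; by rewrite h eqxx in v0.
Qed.

Definition proj s u : 'cV[R]_n := \sum_(b <- s) (dot u b / dot b b) *: b.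

Lemma dot_proj s u b : orth s -> b \in s -> dot (proj s u) b = dot u b.
Proof.
move=> os bs; rewrite /proj dot_suml (bigD1_seq b) ?orth_uniq //= big_seq_cond big1.
  by rewrite addr0 dotZl divfK // gt_eqF // dot_gt0 // (orth_neq0 os).
by move=> c /andP[cs cb]; rewrite dotZl (orth_dot os cs bs cb) mulr0.
Qed.

Lemma proj_mem s u T : {subset s <= T} -> proj s u \in T.
Proof.
by move=> sT; rewrite /proj big_seq; apply: rpred_sum => b bs; apply: rpredZ; apply: sT.
Qed.

Lemma orth_free s : orth s -> free s.
Proof.
elim: s => [|v s IH] /=; first by rewrite nil_free.
case/and3P => v0 /allP vs os; rewrite free_cons IH // andbT.
apply/negP => vs'; have vE := @coord_span _ _ _ (in_tuple s) v vs'; case/eqP: v0; apply: dot_eq0.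
rewrite {1}vE dot_suml big1 // => i _; rewrite dotZl dotC.
by rewrite (eqP (vs _ (mem_nth _ _))) ?mulr0.
Qed.

Lemma orth_size s T : orth s -> {subset s <= T} -> (size s <= \dim T)%N.
Proof.
move=> /orth_free; rewrite /free => /eqP <- sT; apply: dimvS; exact/span_subvP.
Qed.

Lemma orth_complete s T v : orth s -> {subset s <= T} -> (\dim T <= size s)%N ->
  v \in T -> (forall b, b \in s -> dot v b = 0) -> v = 0.
Proof.
move=> os sT dT vT vs; apply/eqP/negPn/negP => v0.
have : (size (v :: s) <= \dim T)%N.
  apply: orth_size => /=; first by rewrite v0 os andbT; apply/allP => b /vs ->.
  by move=> b; rewrite inE => /orP[/eqP ->//|/sT].
by rewrite /= ltnNge dT.
Qed.

Lemma orth_expand s T v : orth s -> {subset s <= T} -> (\dim T <= size s)%N ->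
  v \in T -> v = proj s v.
Proof.
move=> os sT dT vT; apply/eqP; rewrite -subr_eq0; apply/eqP.
apply: (orth_complete os sT dT); first by rewrite rpredB ?proj_mem.
by move=> b bs; rewrite dotBl dot_proj // subrr.
Qed.

Lemma orth_extend s T : orth s -> (size s < \dim T)%N -> {subset s <= T} ->
  exists2 v, v \in T & v != 0 /\ forall b, b \in s -> dot v b = 0.
Proof.
move=> os sT sub; have /subvPn[u uT us] : ~~ (T <= << s >>)%VS.
  apply/negP => /dimvS; rewrite leqNgt => /negP; apply.
  exact: leq_ltn_trans (dim_span s) sT.
exists (u - proj s u); first by rewrite rpredB ?proj_mem.
split; last by move=> b bs; rewrite dotBl dot_proj // subrr.
apply: contraNneq us => /eqP; rewrite subr_eq0 => /eqP ->.
by apply: proj_mem => b bs; exact: memv_span.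
Qed.

Lemma orth_full s T : orth s -> {subset s <= T} ->
  exists c, [/\ orth (c ++ s), {subset c ++ s <= T} & size (c ++ s) = \dim T].
Proof.
move: {2}(\dim T - size s)%N (erefl (\dim T - size s)%N) => k.
elim: k s => [|k IH] s ks os sT.
  exists [::]; split=> //; apply/eqP; rewrite eqn_leq orth_size //=.
  by rewrite -subn_eq0 ks.
have [|v vT [v0 vs]] := orth_extend os _ sT; first by rewrite -subn_gt0 ks.
have [||| c [oc cT sc]] := IH (v :: s).
- by rewrite /= subnS ks.
- by rewrite /= v0 os andbT; apply/allP => b /vs ->.
- by move=> b; rewrite inE => /orP[/eqP ->//|/sT].
by exists (rcons c v); rewrite cat_rcons.
Qed.

Lemma orth_projection T v : exists2 t, t \in T & forall u, u \in T -> dot (v - t) u = 0.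
Proof.
have [] := @orth_full [::] T => // c [oc cT sc]; rewrite cats0 in oc cT sc.
exists (proj c v); first exact: proj_mem.
move=> u uT; rewrite (orth_expand oc cT _ uT) ?sc // /proj dotC dot_suml big_seq big1 // => b bc.
by rewrite dotZl [X in _ * X]dotC dotBl -/(proj c v) dot_proj // subrr mulr0.
Qed.

(** A skew matrix of odd size has determinant zero. It is applied to the form of [A] on the
    orthogonal complement of [s] in [T], a complement that [A] preserves because it kills [s]. *)
Lemma odd_kernel (A : 'M[R]_n) s T : A^T = - A -> (forall v, v \in T -> A *m v \in T) ->
  orth s -> {subset s <= T} -> (forall b, b \in s -> A *m b = 0) ->
  odd (\dim T - size s) ->
  exists2 u, u \in T & [/\ u != 0, A *m u = 0 & forall b, b \in s -> dot u b = 0].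
Proof.
move=> skA AT os sT As; have [c [oc cT sc]] := orth_full os sT.
rewrite -{1}sc size_cat addnK => odd_c.
have skd u v : dot (A *m u) v = - dot u (A *m v) by rewrite dot_mulmx skA mulNmx dotNr.
pose e (i : 'I_(size c)) := c`_i.
have ec i : e i \in c ++ s by rewrite mem_cat mem_nth.
pose Q := \matrix_(i, j) dot (e i) (A *m e j).
have Q0 : \det Q = 0.
  have QT : Q^T = - Q.
    by apply/matrixP => i j; rewrite !mxE dotC skd.
  have := det_tr Q; rewrite QT -scaleN1r detZ -signr_odd odd_c expr1 mulN1r => h.
  by lra.
have [x x0 xQ] : exists2 x : 'rV[R]_(size c), x != 0 & x *m Q = 0 by apply/det0P/eqP.
pose u := \sum_i x ord0 i *: e i.
have ue j : dot u (e j) = x ord0 j * dot (e j) (e j).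
  rewrite /u dot_suml (bigD1 j) //= dotZl big1 ?addr0 // => i ij.
  rewrite dotZl (orth_dot oc) ?mulr0 //.
  have := orth_uniq oc; rewrite cat_uniq => /and3P[uc _ _].
  by rewrite nth_uniq.
exists u.
  by apply: rpred_sum => i _; apply: rpredZ; apply: cT.
have us b : b \in s -> dot u b = 0.
  move=> bs; rewrite /u dot_suml big1 // => i _; rewrite dotZl (orth_dot oc) ?mulr0 //.
    by rewrite mem_cat bs orbT.
  have := orth_uniq oc; rewrite cat_uniq => /and3P[_ /hasPn/(_ _ bs) /= + _].
  by apply: contraNneq => <-; rewrite /e mem_nth.
split=> //.
  apply: contra_neq x0 => u0; apply/rowP => j; rewrite mxE; apply/eqP.
  have := ue j; rewrite u0 dot0l => /esym/eqP; rewrite mulf_eq0 => /orP[//|].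
  by rewrite gt_eqF // dot_gt0 // (orth_neq0 oc).
apply: (orth_complete oc cT); first by rewrite sc.
  by apply: AT; apply: rpred_sum => i _; apply: rpredZ; apply: cT.
move=> b; rewrite mem_cat => /orP[bc|bs]; last first.
  by rewrite skd As // dot0r oppr0.
have bi : (index b c < size c)%N by rewrite index_mem.
have bE : b = e (Ordinal bi) by rewrite /e /= nth_index.
have := congr1 (fun M : 'rV_ _ => M ord0 (Ordinal bi)) xQ; rewrite !mxE => h.
rewrite bE skd /u dot_suml; apply/eqP; rewrite oppr_eq0; apply/eqP.
by rewrite -[RHS]h; apply: eq_bigr => i _; rewrite dotZl mxE.
Qed.

End OrthogonalFamilies.

(** * The moving part of a triple of skew matrices *)

Section Moving.
Variables (R : realType) (n : nat) (A1 A2 A3 : 'M[R]_n).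
Hypotheses (sk1 : A1^T = - A1) (sk2 : A2^T = - A2) (sk3 : A3^T = - A3).
Implicit Types (u v w : 'cV[R]_n).

Definition fixed v := [/\ A1 *m v = 0, A2 *m v = 0 & A3 *m v = 0].

(** For skew operators the orthogonal complement of the sum of the images is the common kernel. *)
Definition moving : {vspace 'cV[R]_n} :=
  (limg (linfun (mulmx A1)) + limg (linfun (mulmx A2)) + limg (linfun (mulmx A3)))%VS.

Lemma skew_dot (A : 'M[R]_n) : A^T = - A -> forall u v, dot (A *m u) v = - dot u (A *m v).
Proof. by move=> skA u v; rewrite dot_mulmx skA mulNmx dotNr. Qed.

Lemma moving1 v : A1 *m v \in moving.
Proof.
rewrite -[A1 *m v](lfunE (mulmx A1)).
apply: (subvP (subv_trans (addvSl _ _) (addvSl _ _))); exact: memv_img (memvf _).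
Qed.

Lemma moving2 v : A2 *m v \in moving.
Proof.
rewrite -[A2 *m v](lfunE (mulmx A2)).
apply: (subvP (subv_trans (addvSr _ _) (addvSl _ _))); exact: memv_img (memvf _).
Qed.

Lemma moving3 v : A3 *m v \in moving.
Proof.
rewrite -[A3 *m v](lfunE (mulmx A3)).
apply: (subvP (addvSr _ _)); exact: memv_img (memvf _).
Qed.

Lemma moving_dot_fixed t z : t \in moving -> fixed z -> dot t z = 0.
Proof.
move=> /memv_addP[_ /memv_addP[_ /memv_imgP[a _ ->] [_ /memv_imgP[b _ ->] ->]]
  [_ /memv_imgP[c _ ->] ->]] [z1 z2 z3].
rewrite !lfunE /= !dotDl !skew_dot // z1 z2 z3 !dot0r; lra.
Qed.

Lemma fixed_of_dot v : (forall t, t \in moving -> dot v t = 0) -> fixed v.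
Proof.
move=> h; split; apply: dot_eq0; rewrite skew_dot // h ?oppr0 //;
  [exact: moving1|exact: moving2|exact: moving3].
Qed.

Lemma moving_fixed v : v \in moving -> fixed v -> v = 0.
Proof. by move=> vT fv; apply: dot_eq0; exact: moving_dot_fixed. Qed.

Lemma fixed_moving_decomp v : exists2 t, t \in moving & fixed (v - t).
Proof.
have [t tT h] := orth_projection moving v; exists t => //; exact: fixed_of_dot.
Qed.

End Moving.

Ltac dotring := apply: dot_ext => ?; rewrite ?(dotDl, dotBl, dotNl, dotZl, dot0l); ring.

(** * Weight-zero vectors and the dimension they force *)

Section KernelPair.
Variables (R : realType) (n : nat) (A B C : 'M[R]_n) (T : {vspace 'cV[R]_n}).
Hypotheses (skA : A^T = - A) (skB : B^T = - B) (skC : C^T = - C).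
Hypothesis AB : forall v : 'cV[R]_n, A *m (B *m v) = B *m (A *m v) + C *m v.
Hypothesis AC : forall v : 'cV[R]_n, A *m (C *m v) = C *m (A *m v) - B *m v.
Hypothesis BC : forall v : 'cV[R]_n, A *m v = 0 -> B *m (C *m v) = C *m (B *m v).
Hypotheses (TA : forall v : 'cV[R]_n, A *m v \in T)
  (TB : forall v : 'cV[R]_n, B *m v \in T) (TC : forall v : 'cV[R]_n, C *m v \in T).
Hypothesis T0 : forall v, v \in T -> A *m v = 0 -> B *m v = 0 -> v = 0.
Implicit Types u v w x y : 'cV[R]_n.

Lemma skew_dotvv (D : 'M[R]_n) v : D^T = - D -> dot (D *m v) v = 0.
Proof. by move=> skD; have := skew_dot skD v v; rewrite (dotC v); lra. Qed.

Section KernelVector.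
Variable x : 'cV[R]_n.
Hypotheses (Ax : A *m x = 0) (x0 : x != 0) (xT : x \in T).

Lemma kerA_B : A *m (B *m x) = C *m x. Proof. by rewrite AB Ax mulmx0 add0r. Qed.
Lemma kerA_C : A *m (C *m x) = - (B *m x). Proof. by rewrite AC Ax mulmx0 add0r. Qed.
Lemma dot_kerA_B y : A *m y = 0 -> dot (B *m x) y = 0.
Proof.
by move=> Ay; rewrite -[B *m x]opprK -kerA_C dotNl (skew_dot skA) Ay dot0r !oppr0.
Qed.
Lemma dot_kerA_C y : A *m y = 0 -> dot (C *m x) y = 0.
Proof. by move=> Ay; rewrite -kerA_B (skew_dot skA) Ay dot0r oppr0. Qed.
Lemma dot_C_B : dot (C *m x) (B *m x) = 0.
Proof. by rewrite -kerA_B skew_dotvv. Qed.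
Lemma dot_C_C : dot (C *m x) (C *m x) = dot (B *m x) (B *m x).
Proof. by rewrite -{1}kerA_B (skew_dot skA) kerA_C dotNr opprK. Qed.
Lemma B_neq0 : B *m x != 0.
Proof. by apply: contra_neq x0 => Bx; apply: T0. Qed.
Lemma C_neq0 : C *m x != 0.
Proof.
apply: contra_neq B_neq0 => Cx; apply: dot_eq0; rewrite -dot_C_C Cx; exact: dot0l.
Qed.
Lemma orth_triple : orth [:: x; B *m x; C *m x].
Proof.
rewrite /= x0 B_neq0 C_neq0 dotC dot_kerA_B // [dot x _]dotC dot_kerA_C //.
by rewrite dotC dot_C_B eqxx.
Qed.
End KernelVector.

(** Here [t] is the part of [B y] orthogonal to [B x] and [C x]. Asking [B] and [C] to commute on
    the kernel of [A] covers every [B] orthogonal to a unit [A] in su(2), whatever its length, as in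
    [lin3_kernel4]. *)
Lemma kernel_pair_family x y : A *m x = 0 -> x != 0 -> x \in T ->
  A *m y = 0 -> y != 0 -> y \in T -> dot x y = 0 ->
  exists t, [/\ t \in T, A *m (A *m t) = - t &
    orth [:: x; y; B *m x; C *m x; t; A *m t]].
Proof.
move=> Ax x0 xT Ay y0 yT xy.
have Bx0 := B_neq0 Ax x0 xT; have Cx0 := C_neq0 Ax x0 xT.
pose a := dot (B *m y) (B *m x) / dot (B *m x) (B *m x).
pose b := dot (B *m y) (C *m x) / dot (C *m x) (C *m x).
pose t := B *m y - a *: (B *m x) - b *: (C *m x).
have AtE : A *m t = C *m y - a *: (C *m x) + b *: (B *m x).
  by rewrite /t !mulmxBr -!scalemxAr !kerA_B // kerA_C // scalerN opprK.
have AAt : A *m (A *m t) = - t.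
  rewrite AtE mulmxDr mulmxBr -!scalemxAr !kerA_B // !kerA_C // /t; dotring.
have t0 : t != 0.
  (* If [t] vanishes, [y' = y - a x] satisfies [B y' = b C x] and [C y' = - b B x]. Commutation on
     [y'], paired with [x], equates [b |B x|^2] with its negative, so [b = 0], [y' = 0], and [y] is
     parallel to [x], against orthogonality. *)
  apply/eqP => t0.
  have By : B *m y = a *: (B *m x) + b *: (C *m x).
    by apply/eqP; rewrite -subr_eq0 opprD addrA -/t t0.
  pose y' := y - a *: x.
  have Ay' : A *m y' = 0 by rewrite /y' mulmxBr -scalemxAr Ay Ax scaler0 subrr.
  have By' : B *m y' = b *: (C *m x) by rewrite /y' mulmxBr -scalemxAr By; dotring.
  have Cy' : C *m y' = - b *: (B *m x).
    by rewrite -kerA_B // By' -scalemxAr kerA_C // scalerN scaleNr.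
  have := BC Ay'; rewrite By' Cy' -!scalemxAr => /(congr1 (fun w => dot w x)).
  rewrite !dotZl (skew_dot skB) (skew_dot skC) (dot_C_C Ax) => h.
  have Bx1 := dot_gt0 Bx0.
  have b0 : b = 0.
    have /eqP : b * dot (B *m x) (B *m x) = 0 by lra.
    by rewrite mulf_eq0 (gt_eqF Bx1) orbF => /eqP.
  have y'0 : y' = 0.
    apply: T0 => //; first by rewrite rpredB // rpredZ.
    by rewrite By' b0 scale0r.
  have yE : y = a *: x by apply/eqP; rewrite -subr_eq0 -/y' y'0.
  have : a * dot x x = 0 by rewrite -dotZr -yE.
  move=> /eqP; rewrite mulf_eq0 (gt_eqF (dot_gt0 x0)) orbF => /eqP a0.
  by rewrite yE a0 scale0r eqxx in y0.
have tB : dot t (B *m x) = 0.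
  rewrite /t !dotBl !dotZl dot_C_B // mulr0 subr0 /a divfK ?subrr //.
  by rewrite gt_eqF // dot_gt0.
have tC : dot t (C *m x) = 0.
  rewrite /t !dotBl !dotZl (dotC (B *m x)) dot_C_B // mulr0 subr0 /b divfK ?subrr //.
  by rewrite gt_eqF // dot_gt0.
have tk k : A *m k = 0 -> dot t k = 0.
  move=> Ak; rewrite /t !dotBl !dotZl !dot_kerA_B // dot_kerA_C //; lra.
have tT : t \in T by rewrite /t !rpredB // rpredZ.
clearbody t; clear AtE.
have kB k : A *m k = 0 -> dot k (B *m x) = 0 by move=> Ak; rewrite dotC dot_kerA_B.
have kC k : A *m k = 0 -> dot k (C *m x) = 0 by move=> Ak; rewrite dotC dot_kerA_C.
have kt k : A *m k = 0 -> dot k t = 0 by move=> Ak; rewrite dotC tk.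
have kA k : A *m k = 0 -> dot k (A *m t) = 0.
  by move=> Ak; rewrite dotC (skew_dot skA) Ak dot0r oppr0.
have BCx : dot (B *m x) (C *m x) = 0 by rewrite dotC dot_C_B.
have Bt : dot (B *m x) t = 0 by rewrite dotC.
have Ct : dot (C *m x) t = 0 by rewrite dotC.
have BAt : dot (B *m x) (A *m t) = 0.
  by rewrite dotC (skew_dot skA) kerA_B // tC oppr0.
have CAt : dot (C *m x) (A *m t) = 0.
  by rewrite dotC (skew_dot skA) kerA_C // dotNr tB !oppr0.
have tAt : dot t (A *m t) = 0 by rewrite dotC skew_dotvv.
have At0 : A *m t != 0.
  apply: contra_neq t0 => At0.
  by have := AAt; rewrite At0 mulmx0 => /esym/eqP; rewrite oppr_eq0 => /eqP.
exists t; split=> //; rewrite /= x0 y0 Bx0 Cx0 t0 At0 xy (kB x) // (kB y) // (kC x) // (kC y) //.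
rewrite (kt x) // (kt y) // (kA x) // (kA y) //.
by rewrite BCx Bt Ct BAt CAt tAt !eqxx.
Qed.

Lemma kernel_pair x y : A *m x = 0 -> x != 0 -> x \in T ->
  A *m y = 0 -> y != 0 -> y \in T -> dot x y = 0 -> (6 <= \dim T)%N.
Proof.
move=> Ax x0 xT Ay y0 yT xy; have [t [tT _ ot]] := kernel_pair_family Ax x0 xT Ay y0 yT xy.
apply: (orth_size ot) => v.
by rewrite !inE => /or4P[/eqP->//|/eqP->//|/eqP->//|/or3P[]/eqP-> //].
Qed.

End KernelPair.

(** * The su(2) brackets on the moving part *)

Section Su2Triple.
Variables (R : realType) (n : nat) (A1 A2 A3 : 'M[R]_n).
Hypotheses (sk1 : A1^T = - A1) (sk2 : A2^T = - A2) (sk3 : A3^T = - A3).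
Hypotheses (br12 : A1 *m A2 - A2 *m A1 = A3) (br23 : A2 *m A3 - A3 *m A2 = A1)
  (br31 : A3 *m A1 - A1 *m A3 = A2).
Implicit Types u v w : 'cV[R]_n.
Local Notation T := (moving A1 A2 A3).
Local Notation fixed := (fixed A1 A2 A3).

Lemma com12 v : A1 *m (A2 *m v) = A2 *m (A1 *m v) + A3 *m v.
Proof. by rewrite -br12 mulmxBl !mulmxA addrC subrK. Qed.
Lemma com23 v : A2 *m (A3 *m v) = A3 *m (A2 *m v) + A1 *m v.
Proof. by rewrite -[in RHS]br23 mulmxBl !mulmxA addrC subrK. Qed.
Lemma com13 v : A1 *m (A3 *m v) = A3 *m (A1 *m v) - A2 *m v.
Proof. by rewrite -[in RHS]br31 mulmxBl !mulmxA opprB addrC subrK. Qed.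

Lemma fixed12 v : A1 *m v = 0 -> A2 *m v = 0 -> fixed v.
Proof.
move=> v1 v2; split=> //; have := com12 v; rewrite v1 v2 !mulmx0 add0r => <- //.
Qed.

Lemma moving_ker12 v : v \in T -> A1 *m v = 0 -> A2 *m v = 0 -> v = 0.
Proof. by move=> vT v1 v2; apply: (moving_fixed sk1 sk2 sk3 vT); exact: fixed12. Qed.

Lemma su2_kernel_pair (x y : 'cV[R]_n) : A1 *m x = 0 -> x != 0 -> x \in T ->
  A1 *m y = 0 -> y != 0 -> y \in T -> dot x y = 0 -> (6 <= \dim T)%N.
Proof.
apply: (kernel_pair sk1 sk2 sk3 com12 com13).
- by move=> v v1; rewrite com23 v1 addr0.
- by move=> v; exact: moving1.
- by move=> v; exact: moving2.
- by move=> v; exact: moving3.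
- exact: moving_ker12.
Qed.

Lemma su2_kernel_cube (x y : 'cV[R]_n) : A1 *m x = 0 -> x != 0 -> x \in T ->
  A1 *m y = 0 -> y != 0 -> y \in T -> dot x y = 0 -> \dim T = 6 ->
  forall v, v \in T -> A1 *m (A1 *m (A1 *m v)) = - (A1 *m v).
Proof.
move=> x1 x0 xT y1 y0 yT xy dT v vT.
have BC (w : 'cV[R]_n) : A1 *m w = 0 -> A2 *m (A3 *m w) = A3 *m (A2 *m w).
  by move=> w1; rewrite com23 w1 addr0.
have [t [tT tt ot]] := kernel_pair_family sk1 sk2 sk3 com12 com13 BC
  (moving2 A1 A2 A3) (moving3 A1 A2 A3) moving_ker12 x1 x0 xT y1 y0 yT xy.
have sub : {subset [:: x; y; A2 *m x; A3 *m x; t; A1 *m t] <= T}.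
  move=> b; rewrite !inE => /or4P[/eqP->//|/eqP->//|/eqP->|/or3P[]/eqP-> //].
  - exact: moving2.
  - exact: moving3.
  - exact: moving1.
have x12 : A1 *m (A2 *m x) = A3 *m x by exact: (kerA_B com12).
have x13 : A1 *m (A3 *m x) = - (A2 *m x) by exact: (kerA_C com13).
rewrite (orth_expand ot sub _ vT) ?dT // /proj !mulmx_sumr -sumrN big_seq [RHS]big_seq.
apply: eq_bigr => b bs; rewrite -!scalemxAr -scalerN; congr (_ *: _).
move: bs; rewrite !inE => /or4P[/eqP->|/eqP->|/eqP->|/or3P[]/eqP->].
- by rewrite x1 !mulmx0 oppr0.
- by rewrite y1 !mulmx0 oppr0.
- by rewrite x12 x13 mulmxN x12.
- by rewrite x13 mulmxN x12 mulmxN x13.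
- by rewrite tt mulmxN.
- by rewrite tt !mulmxN tt.
Qed.

Lemma su2_orth_triple (x : 'cV[R]_n) : A1 *m x = 0 -> x != 0 -> x \in T -> orth [:: x; A2 *m x; A3 *m x].
Proof.
exact: (orth_triple sk1 com12 com13 moving_ker12).
Qed.

(** Skew operators on a plane commute, and in su(2) every element is a bracket. The vector [v] may
    be 0, which covers the case of a line. *)
Lemma plane_fixed u v (a1 a2 a3 b1 b2 b3 : R) : u != 0 ->
  A1 *m u = a1 *: v -> A2 *m u = a2 *: v -> A3 *m u = a3 *: v ->
  A1 *m v = b1 *: u -> A2 *m v = b2 *: u -> A3 *m v = b3 *: u -> fixed u.
Proof.
move=> u0 u1 u2 u3 v1 v2 v3; have uu := dot_gt0 u0.
have key (A : 'M[R]_n) a b : A^T = - A -> A *m u = a *: v -> A *m v = b *: u ->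
    b * dot u u = - (a * dot v v).
  by move=> skA uA vA; rewrite -dotZl -vA (skew_dot skA) uA dotZr.
have k1 := key _ _ _ sk1 u1 v1; have k2 := key _ _ _ sk2 u2 v2; have k3 := key _ _ _ sk3 u3 v3.
have zero (a b a' b' : R) : b * dot u u = - (a * dot v v) -> b' * dot u u = - (a' * dot v v) ->
    a' * b - a * b' = 0.
  move=> h h'; have /eqP : (a' * b - a * b') * dot u u = 0.
    by rewrite mulrBl -!mulrA h h'; ring.
  by rewrite mulf_eq0 (gt_eqF uu) orbF => /eqP.
split.
- have h := com23 u; rewrite u2 u3 -!scalemxAr v2 v3 !scalerA in h.
  have -> : A1 *m u = (a3 * b2 - a2 * b3) *: u.
    by rewrite scalerBl h addrAC subrr add0r.
  by rewrite (zero _ _ _ _ k2 k3) scale0r.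
- have h := com13 u; rewrite u1 u3 -!scalemxAr v1 v3 !scalerA in h.
  have -> : A2 *m u = (a1 * b3 - a3 * b1) *: u by rewrite scalerBl h u2 subKr.
  by rewrite (zero _ _ _ _ k3 k1) scale0r.
- have h := com12 u; rewrite u1 u2 -!scalemxAr v1 v2 !scalerA in h.
  have -> : A3 *m u = (a2 * b1 - a1 * b2) *: u.
    by rewrite scalerBl h addrAC subrr add0r.
  by rewrite (zero _ _ _ _ k1 k2) scale0r.
Qed.

(** The orthogonal complement of [s] in T is stable and of dimension at most 2, so by [plane_fixed]
    it consists of fixed vectors, and T has no nonzero one. *)
Lemma small_complement s : orth s -> {subset s <= T} ->
  (forall A v, A \in [:: A1; A2; A3] -> (forall b, b \in s -> dot v b = 0) ->
     forall b, b \in s -> dot (A *m v) b = 0) ->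
  (\dim T <= (size s).+2)%N -> (\dim T <= size s)%N.
Proof.
move=> os sT stable dT; rewrite leqNgt; apply/negP => sd.
have [u uT [u0 us]] := orth_extend os sd sT.
have ous : orth (u :: s) by rewrite /= u0 os andbT; apply/allP => b /us ->.
have usT : {subset u :: s <= T} by move=> b; rewrite inE => /orP[/eqP->//|/sT].
have AT A w : A \in [:: A1; A2; A3] -> A *m w \in T.
  rewrite !inE => /or3P[] /eqP ->; [exact: moving1|exact: moving2|exact: moving3].
have skA A : A \in [:: A1; A2; A3] -> A^T = - A.
  by rewrite !inE => /or3P[] /eqP ->.
(* [v] completes [u] to an orthogonal basis of the complement, or is 0 if [u] already spans it. *)
have [v [vs vu hv]] : exists v, [/\ forall b, b \in s -> dot v b = 0, dot v u = 0 &
    forall w, w \in T -> (forall b, b \in s -> dot w b = 0) -> dot w u = 0 ->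
      exists a, w = a *: v].
  have [d1|d1] := leqP (\dim T) (size (u :: s)).
    exists 0; split=> [b _||w wT ws wu]; rewrite ?dot0l //.
    exists 0; rewrite scale0r; apply: (orth_complete ous usT d1 wT) => b.
    by rewrite inE => /orP[/eqP ->|/ws].
  have [v vT [v0 vs]] := orth_extend ous d1 usT.
  exists v; split=> [b bs||w wT ws wu]; try by apply: vs; rewrite inE ?bs ?eqxx ?orbT.
  exists (dot w v / dot v v); apply/eqP; rewrite -subr_eq0; apply/eqP.
  have ovs : orth [:: v, u & s] by rewrite orth_cons v0 ous andbT; apply/allP => b /vs ->.
  apply: (@orth_complete _ _ [:: v, u & s] T) => //.
  - by move=> b; rewrite inE => /orP[/eqP->//|/usT].
  - by rewrite rpredB // rpredZ.
  move=> b; rewrite inE => /orP[/eqP ->|bus].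
    by rewrite dotBl dotZl divfK ?subrr // gt_eqF // dot_gt0.
  rewrite dotBl dotZl (vs b bus) mulr0 subr0.
  by move: bus; rewrite inE => /orP[/eqP ->|/ws].
have expu A : A \in [:: A1; A2; A3] -> exists a, A *m u = a *: v.
  move=> hA; apply: hv; first exact: AT.
    exact: stable hA us.
  by rewrite skew_dotvv // skA.
have expv A : A \in [:: A1; A2; A3] -> exists b, A *m v = b *: u.
  move=> hA; pose b := dot (A *m v) u / dot u u.
  have [|||c E] := hv (A *m v - b *: u).
  - by rewrite rpredB ?AT // rpredZ.
  - by move=> x xs; rewrite dotBl dotZl (us x xs) mulr0 subr0; apply: (stable A v hA vs).
  - by rewrite dotBl dotZl divfK ?subrr // gt_eqF // dot_gt0.
  exists b; apply/eqP; rewrite -subr_eq0; apply/eqP/dot_eq0.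
  rewrite {2}E dotZr dotBl dotZl [dot u v]dotC vu (skew_dotvv _ (skA _ hA)); ring.
have m1 : A1 \in [:: A1; A2; A3] by rewrite !inE eqxx.
have m2 : A2 \in [:: A1; A2; A3] by rewrite !inE eqxx orbT.
have m3 : A3 \in [:: A1; A2; A3] by rewrite !inE eqxx !orbT.
have [a1 e1] := expu _ m1; have [a2 e2] := expu _ m2; have [a3 e3] := expu _ m3.
have [b1 f1] := expv _ m1; have [b2 f2] := expv _ m2; have [b3 f3] := expv _ m3.
have := moving_fixed sk1 sk2 sk3 uT (plane_fixed u0 e1 e2 e3 f1 f2 f3).
by move=> h; rewrite h eqxx in u0.
Qed.

Lemma dim_moving_ge3 : A1 != 0 -> (3 <= \dim T)%N.
Proof.
move=> A10; rewrite ltnNge; apply/negP => d2.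
have : (\dim T <= 0)%N by apply: (@small_complement [::]).
rewrite leqn0 dimv_eq0 => /eqP T0; case/eqP: A10.
apply/matrixP => i j; rewrite mxE.
have := moving1 A1 A2 A3 (delta_mx j ord0); rewrite T0 memv0 -colE => /eqP.
by move/(congr1 (fun M : 'cV_n => M i ord0)); rewrite !mxE.
Qed.

Definition lin3 (y1 y2 y3 : R) : 'M[R]_n := y1 *: A1 + y2 *: A2 + y3 *: A3.

Lemma lin3_mul y1 y2 y3 v :
  lin3 y1 y2 y3 *m v = y1 *: (A1 *m v) + y2 *: (A2 *m v) + y3 *: (A3 *m v).
Proof. by rewrite !mulmxDl -!scalemxAl. Qed.

Lemma lin3_skew y1 y2 y3 : (lin3 y1 y2 y3)^T = - lin3 y1 y2 y3.
Proof. by rewrite /lin3 !raddfD /= !linearZ /= sk1 sk2 sk3 !scalerN. Qed.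

Lemma lin3_moving y1 y2 y3 v : lin3 y1 y2 y3 *m v \in T.
Proof.
rewrite lin3_mul; apply: rpredD; [apply: rpredD|]; apply: rpredZ;
  [exact: moving1|exact: moving2|exact: moving3].
Qed.

Lemma lin3_com y1 y2 y3 z1 z2 z3 v :
  lin3 y1 y2 y3 *m (lin3 z1 z2 z3 *m v) = lin3 z1 z2 z3 *m (lin3 y1 y2 y3 *m v) +
  lin3 (y2 * z3 - y3 * z2) (y3 * z1 - y1 * z3) (y1 * z2 - y2 * z1) *m v.
Proof.
rewrite !lin3_mul !mulmxDr -!scalemxAr com12 com23 com13; dotring.
Qed.

(** The kernel of a skew operator on T has the parity of dim T, so [u] comes with a second,
    orthogonal kernel vector. In a basis of the algebra adapted to y, [kernel_pair] then forces
    dimension 6. *)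
Lemma lin3_kernel4 y1 y2 y3 u : u \in T -> u != 0 -> (y1, y2, y3) != (0, 0, 0) ->
  lin3 y1 y2 y3 *m u = 0 -> \dim T = 4 -> False.
Proof.
move=> uT u0 y0 yu dT.
wlog y_unit : y1 y2 y3 y0 yu / y1 ^+ 2 + y2 ^+ 2 + y3 ^+ 2 = 1.
  move=> hw; pose N := y1 ^+ 2 + y2 ^+ 2 + y3 ^+ 2.
  have N0 : 0 < N.
    rewrite lt_neqAle; apply/andP; split; last by rewrite !addr_ge0 ?sqr_ge0.
    apply: contra_neq y0 => /esym N0.
    have s1 := sqr_ge0 y1; have s2 := sqr_ge0 y2; have s3 := sqr_ge0 y3.
    have z (y : R) : y ^+ 2 = 0 -> y = 0 by move/eqP; rewrite sqrf_eq0 => /eqP.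
    have [h1 h2 h3] : [/\ y1 ^+ 2 = 0, y2 ^+ 2 = 0 & y3 ^+ 2 = 0].
      move: s1 s2 s3 N0; rewrite /N; move: (y1 ^+ 2) (y2 ^+ 2) (y3 ^+ 2) => a b c.
      by move=> *; split; lra.
    by rewrite (z _ h1) (z _ h2) (z _ h3).
  pose r := (Num.sqrt N)^-1.
  have r0 : r != 0 by rewrite invr_neq0 // gt_eqF // sqrtr_gt0.
  have rN : r ^+ 2 * N = 1 by rewrite /r exprVn sqr_sqrtr ?ltW // mulVf // gt_eqF.
  apply: (hw (r * y1) (r * y2) (r * y3)).
  - apply: contra_neq y0 => -[/eqP + /eqP + /eqP].
    by rewrite !mulf_eq0 (negbTE r0) /= => /eqP -> /eqP -> /eqP ->.
  - rewrite lin3_mul -!scalerA -!scalerDr -lin3_mul yu scaler0 //.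
  - by rewrite !exprMn -!mulrDr.
(* A nonzero vector p orthogonal to y; the choice (0, y3, -y2) fails exactly when y lies on the
   first axis. *)
pose p1 := if (y2 == 0) && (y3 == 0) then - y3 else 0 : R.
pose p2 := if (y2 == 0) && (y3 == 0) then 0 else y3 : R.
pose p3 := if (y2 == 0) && (y3 == 0) then y1 else - y2 : R.
have yp : y1 * p1 + y2 * p2 + y3 * p3 = 0.
  rewrite /p1 /p2 /p3; case: ifP => [/andP[/eqP -> /eqP ->]|_]; ring.
have pp : 0 < p1 ^+ 2 + p2 ^+ 2 + p3 ^+ 2.
  have s1 := sqr_ge0 y1; have s2 := sqr_ge0 y2; have s3 := sqr_ge0 y3.
  rewrite /p1 /p2 /p3; case: ifPn => [/andP[/eqP z2 /eqP z3]|].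
    move: y_unit; rewrite z2 z3 oppr0 expr0n /= !addr0 !add0r => ->; exact: ltr01.
  rewrite negb_and expr0n add0r sqrrN addrC => /orP[] h.
  - by apply: ltr_pwDl => //; rewrite exprn_even_gt0.
  - by apply: ltr_wpDl => //; rewrite exprn_even_gt0.
pose A := lin3 y1 y2 y3; pose B := lin3 p1 p2 p3.
pose C := lin3 (y2 * p3 - y3 * p2) (y3 * p1 - y1 * p3) (y1 * p2 - y2 * p1).
have AB v : A *m (B *m v) = B *m (A *m v) + C *m v by exact: lin3_com.
have AC v : A *m (C *m v) = C *m (A *m v) - B *m v.
  rewrite /A /C lin3_com -/A -/C; congr (_ + _); rewrite -mulNmx; congr (_ *m _).
  rewrite /B /lin3 !opprD -[- (p1 *: _)]scaleNr -[- (p2 *: _)]scaleNr -[- (p3 *: _)]scaleNr; congr (_ *: _ + _ *: _ + _ *: _).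
  - transitivity (y1 * (y1 * p1 + y2 * p2 + y3 * p3) - p1 * (y1 ^+ 2 + y2 ^+ 2 + y3 ^+ 2)).
      by ring.
    by rewrite yp y_unit mulr0 mulr1 sub0r.
  - transitivity (y2 * (y1 * p1 + y2 * p2 + y3 * p3) - p2 * (y1 ^+ 2 + y2 ^+ 2 + y3 ^+ 2)).
      by ring.
    by rewrite yp y_unit mulr0 mulr1 sub0r.
  - transitivity (y3 * (y1 * p1 + y2 * p2 + y3 * p3) - p3 * (y1 ^+ 2 + y2 ^+ 2 + y3 ^+ 2)).
      by ring.
    by rewrite yp y_unit mulr0 mulr1 sub0r.
have BC v : A *m v = 0 -> B *m (C *m v) = C *m (B *m v).
  move=> Av; rewrite /B /C lin3_com; set D := (X in _ + X = _).
  suff -> : D = 0 by rewrite addr0.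
  rewrite /D (_ : lin3 _ _ _ = (p1 ^+ 2 + p2 ^+ 2 + p3 ^+ 2) *: A).
    by rewrite -scalemxAl Av scaler0.
  rewrite /A /lin3 !scalerDr !scalerA; congr (_ *: _ + _ *: _ + _ *: _).
  - transitivity ((p1 ^+ 2 + p2 ^+ 2 + p3 ^+ 2) * y1 - p1 * (y1 * p1 + y2 * p2 + y3 * p3)).
      by ring.
    by rewrite yp mulr0 subr0.
  - transitivity ((p1 ^+ 2 + p2 ^+ 2 + p3 ^+ 2) * y2 - p2 * (y1 * p1 + y2 * p2 + y3 * p3)).
      by ring.
    by rewrite yp mulr0 subr0.
  - transitivity ((p1 ^+ 2 + p2 ^+ 2 + p3 ^+ 2) * y3 - p3 * (y1 * p1 + y2 * p2 + y3 * p3)).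
      by ring.
    by rewrite yp mulr0 subr0.
have T0 v : v \in T -> A *m v = 0 -> B *m v = 0 -> v = 0.
  move=> vT Av Bv; apply: (moving_fixed sk1 sk2 sk3 vT).
  have Cv : C *m v = 0 by have := AB v; rewrite Av Bv !mulmx0 add0r.
  have Av' := lin3_mul y1 y2 y3 v; have Bv' := lin3_mul p1 p2 p3 v.
  have Cv' := lin3_mul (y2 * p3 - y3 * p2) (y3 * p1 - y1 * p3) (y1 * p2 - y2 * p1) v.
  rewrite -/A Av in Av'; rewrite -/B Bv in Bv'; rewrite -/C Cv in Cv'.
  (* By Lagrange's identity [D] is the squared length of the cross product of y and p, that is, the
     determinant of y, p and their cross product. The combinations below are Cramer's rule for this
     basis. *)
  pose D := (y1 ^+ 2 + y2 ^+ 2 + y3 ^+ 2) * (p1 ^+ 2 + p2 ^+ 2 + p3 ^+ 2) -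
    (y1 * p1 + y2 * p2 + y3 * p3) ^+ 2.
  have D0 : D != 0 by rewrite /D y_unit yp mul1r expr0n subr0 gt_eqF.
  have key w : [/\ dot (A1 *m v) w = 0, dot (A2 *m v) w = 0 & dot (A3 *m v) w = 0].
    have hA := congr1 (fun x => dot x w) Av'; have hB := congr1 (fun x => dot x w) Bv'.
    have hC := congr1 (fun x => dot x w) Cv'.
    move: hA hB hC; rewrite /= dot0l !dotDl !dotZl.
    set X1 := dot _ w; set X2 := dot _ w; set X3 := dot _ w => hA hB hC.
    have z (X : R) : D * X = 0 -> X = 0.
      by move/eqP; rewrite mulf_eq0 (negbTE D0) => /eqP.
    pose c1 := y2 * p3 - y3 * p2; pose c2 := y3 * p1 - y1 * p3; pose c3 := y1 * p2 - y2 * p1.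
    split; apply: z.
    - rewrite (_ : _ * _ = (p2 * c3 - p3 * c2) * (y1 * X1 + y2 * X2 + y3 * X3)
        + (c2 * y3 - c3 * y2) * (p1 * X1 + p2 * X2 + p3 * X3)
        + c1 * (c1 * X1 + c2 * X2 + c3 * X3)); last by rewrite /D /c1 /c2 /c3; ring.
      by rewrite -hA -hB -hC !mulr0 !addr0.
    - rewrite (_ : _ * _ = (p3 * c1 - p1 * c3) * (y1 * X1 + y2 * X2 + y3 * X3)
        + (c3 * y1 - c1 * y3) * (p1 * X1 + p2 * X2 + p3 * X3)
        + c2 * (c1 * X1 + c2 * X2 + c3 * X3)); last by rewrite /D /c1 /c2 /c3; ring.
      by rewrite -hA -hB -hC !mulr0 !addr0.
    - rewrite (_ : _ * _ = (p1 * c2 - p2 * c1) * (y1 * X1 + y2 * X2 + y3 * X3)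
        + (c1 * y2 - c2 * y1) * (p1 * X1 + p2 * X2 + p3 * X3)
        + c3 * (c1 * X1 + c2 * X2 + c3 * X3)); last by rewrite /D /c1 /c2 /c3; ring.
      by rewrite -hA -hB -hC !mulr0 !addr0.
  by split; apply: dot_ext => w; rewrite dot0l; case: (key w).
have [||||v vT [v0 Av uv]] := @odd_kernel _ _ A [:: u] T (lin3_skew _ _ _) (fun v _ => lin3_moving _ _ _ v).
- by rewrite /= u0.
- by move=> b; rewrite inE => /eqP ->.
- by move=> b; rewrite inE => /eqP ->.
- by rewrite dT.
have := kernel_pair (lin3_skew _ _ _) (lin3_skew _ _ _) (lin3_skew _ _ _) AB AC BC
  (lin3_moving _ _ _) (lin3_moving _ _ _) (lin3_moving _ _ _) T0 yu u0 uT Av v0 vT.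
by rewrite dotC uv ?inE ?eqxx // dT => /(_ erefl).
Qed.

(** On [A2 (A3 k)] the square of [A1] is -4, a weight excluded by the cubic relation, so this vector
    vanishes. Then [A2 (A2 k) + k] is killed by all three operators. *)
Lemma weight1_table k : k \in T -> A1 *m k = 0 ->
  (forall v, v \in T -> A1 *m (A1 *m (A1 *m v)) = - (A1 *m v)) ->
  [/\ A2 *m (A3 *m k) = 0, A3 *m (A2 *m k) = 0, A2 *m (A2 *m k) = - k &
      A3 *m (A3 *m k) = - k].
Proof.
move=> kT k1 cube.
have q32 : A2 *m (A3 *m k) = A3 *m (A2 *m k) by rewrite com23 k1 addr0.
have q1 : A1 *m (A2 *m (A3 *m k)) = A3 *m (A3 *m k) - A2 *m (A2 *m k).
  by rewrite com12 com13 k1 mulmx0 sub0r mulmxN addrC.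
have r22 : A1 *m (A2 *m (A2 *m k)) = 2 *: (A2 *m (A3 *m k)).
  by rewrite com12 com12 k1 mulmx0 add0r -q32 scaler_nat mulr2n.
have r33 : A1 *m (A3 *m (A3 *m k)) = - 2 *: (A2 *m (A3 *m k)).
  by rewrite com13 com13 k1 mulmx0 sub0r mulmxN -q32 -opprD scaleNr scaler_nat mulr2n.
set q := A2 *m (A3 *m k) in q32 q1 r22 r33 *.
have qT : q \in T by exact: moving2.
have p1 : A1 *m (A1 *m q) = - 4 *: q by rewrite q1 mulmxBr r22 r33; dotring.
have q0 : q = 0.
  have := cube q qT; rewrite p1 -scalemxAr => h.
  have h0 : A1 *m q = 0.
    apply: dot_ext => w; have := congr1 (fun v => dot v w) h.
    by rewrite dotZl dotNl dot0l; lra.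
  by have /eqP := p1; rewrite h0 mulmx0 eq_sym scaler_eq0 oppr_eq0 pnatr_eq0 /= => /eqP.
have p0 : A3 *m (A3 *m k) = A2 *m (A2 *m k).
  by apply/eqP; rewrite -subr_eq0 -q1 q0 mulmx0.
pose z := A2 *m (A2 *m k) + k.
have z0 : z = 0.
  have z1 : A1 *m z = 0 by rewrite mulmxDr r22 q0 scaler0 k1 addr0.
  have z3 : A3 *m z = 0.
    have := com23 (A2 *m k); rewrite -q32 q0 mulmx0 com12 k1 mulmx0 add0r.
    by rewrite mulmxDr => <-.
  have z2 : A2 *m z = 0.
    by have := com13 z; rewrite z1 z3 !mulmx0 sub0r => /esym/eqP; rewrite oppr_eq0 => /eqP.
  by apply: moving_ker12 => //; rewrite rpredD // moving2.
have e22 : A2 *m (A2 *m k) = - k by apply/eqP; rewrite -addr_eq0 -/z z0.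
by split=> //; rewrite ?p0 // -q32.
Qed.

End Su2Triple.

(** * Traceless symmetric matrices of size 3 *)

Local Notation ax1 := (ord0 : 'I_3).
Local Notation ax2 := (lift ord0 ord0 : 'I_3).
Local Notation ax3 := (lift ord0 (lift ord0 ord0) : 'I_3).

Section Matrix3.
Variable R : realType.

Lemma ord3P (P : 'I_3 -> Prop) : P ax1 -> P ax2 -> P ax3 -> forall i, P i.
Proof.
move=> h0 h1 h2 [[|[|[|//]]] hi].
- by rewrite (_ : Ordinal hi = ax1) //; apply: val_inj.
- by rewrite (_ : Ordinal hi = ax2) //; apply: val_inj.
- by rewrite (_ : Ordinal hi = ax3) //; apply: val_inj.
Qed.

Definition mat3 (a b c d e f g h k : R) : 'M[R]_3 :=
  \matrix_(i, j) nth 0 (nth [::] [:: [:: a; b; c]; [:: d; e; f]; [:: g; h; k]] i) j.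

(** The matrix of the cross product with y. *)
Definition hat (y1 y2 y3 : R) : 'M[R]_3 := mat3 0 (- y3) y2 y3 0 (- y1) (- y2) y1 0.

Lemma mul3E (S U : 'M[R]_3) i j :
  (S *m U) i j = S i ax1 * U ax1 j + S i ax2 * U ax2 j + S i ax3 * U ax3 j.
Proof. by rewrite mxE !big_ord_recl big_ord0 addr0 addrA. Qed.

Lemma trace3E (S : 'M[R]_3) : \tr S = S ax1 ax1 + S ax2 ax2 + S ax3 ax3.
Proof. by rewrite /mxtrace !big_ord_recl big_ord0 addr0 addrA. Qed.

Lemma hat_comm (S : 'M[R]_3) :
  let com y1 y2 y3 := hat y1 y2 y3 *m S - S *m hat y1 y2 y3 in
  [/\ com 1 0 0 ax1 ax1 = 0, com 0 0 1 ax1 ax1 = - S ax2 ax1 - S ax1 ax2,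
      com 0 0 1 ax1 ax2 = S ax1 ax1 - S ax2 ax2, com 0 0 1 ax1 ax3 = - S ax2 ax3 &
      [/\ com 0 1 0 ax1 ax1 = S ax3 ax1 + S ax1 ax3, com 0 1 0 ax1 ax3 = S ax3 ax3 - S ax1 ax1,
        com 1 0 0 ax3 ax3 = S ax2 ax3 + S ax3 ax2, com 1 0 0 ax2 ax3 = S ax2 ax2 - S ax3 ax3 &
        com 0 1 0 ax3 ax3 = - S ax1 ax3 - S ax3 ax1 /\ com 0 0 1 ax3 ax3 = 0]].
Proof.
have E (M N : 'M[R]_3) i j : (M - N) i j = M i j - N i j by rewrite !mxE.
by do !split; rewrite /= E !mul3E /hat !mxE /=; ring.
Qed.

(** By Newton's identities equal power sums give equal monic cubics. The largest root of one is then
    a root of the other, hence at most its largest; the smallest roots are treated by negation. *)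
Lemma sorted_roots_unique (a b c a' b' c' : R) :
  b <= a -> c <= b -> b' <= a' -> c' <= b' ->
  a + b + c = a' + b' + c' -> a ^+ 2 + b ^+ 2 + c ^+ 2 = a' ^+ 2 + b' ^+ 2 + c' ^+ 2 ->
  a ^+ 3 + b ^+ 3 + c ^+ 3 = a' ^+ 3 + b' ^+ 3 + c' ^+ 3 ->
  [/\ a = a', b = b' & c = c'].
Proof.
have char (x1 x2 x3 y1 y2 y3 u : R) :
    x1 + x2 + x3 = y1 + y2 + y3 -> x1 ^+ 2 + x2 ^+ 2 + x3 ^+ 2 = y1 ^+ 2 + y2 ^+ 2 + y3 ^+ 2 ->
    x1 ^+ 3 + x2 ^+ 3 + x3 ^+ 3 = y1 ^+ 3 + y2 ^+ 3 + y3 ^+ 3 ->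
    (u - x1) * (u - x2) * (u - x3) = (u - y1) * (u - y2) * (u - y3).
  move=> h1 h2 h3.
  have newton (z1 z2 z3 : R) : let s1 := z1 + z2 + z3 in
      let s2 := z1 ^+ 2 + z2 ^+ 2 + z3 ^+ 2 in let s3 := z1 ^+ 3 + z2 ^+ 3 + z3 ^+ 3 in
      (u - z1) * (u - z2) * (u - z3) =
      u ^+ 3 - s1 * u ^+ 2 + (s1 ^+ 2 - s2) / 2 * u - (s1 ^+ 3 - 3 * s1 * s2 + 2 * s3) / 6.
    by rewrite /=; field.
  by rewrite !newton /= h1 h2 h3.
have top (x1 x2 x3 y1 y2 y3 : R) : x2 <= x1 -> x3 <= x2 -> y2 <= y1 -> y3 <= y2 ->
    x1 + x2 + x3 = y1 + y2 + y3 -> x1 ^+ 2 + x2 ^+ 2 + x3 ^+ 2 = y1 ^+ 2 + y2 ^+ 2 + y3 ^+ 2 ->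
    x1 ^+ 3 + x2 ^+ 3 + x3 ^+ 3 = y1 ^+ 3 + y2 ^+ 3 + y3 ^+ 3 -> x1 <= y1.
  move=> x12 x23 y12 y23 h1 h2 h3; have := char _ _ _ _ _ _ x1 h1 h2 h3.
  rewrite subrr !mul0r => /esym/eqP.
  by rewrite !mulf_eq0 !subr_eq0 => /orP[/orP[]|] /eqP ->; lra.
move=> ab bc ab' bc' h1 h2 h3.
have aa : a = a'.
  by apply: le_anti; rewrite (top a b c a' b' c') // (top a' b' c' a b c) // -?h1 -?h2 -?h3.
have cc : c = c'.
  have top' (x1 x2 x3 y1 y2 y3 : R) : x2 <= x1 -> x3 <= x2 -> y2 <= y1 -> y3 <= y2 ->
      x1 + x2 + x3 = y1 + y2 + y3 -> x1 ^+ 2 + x2 ^+ 2 + x3 ^+ 2 = y1 ^+ 2 + y2 ^+ 2 + y3 ^+ 2 ->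
      x1 ^+ 3 + x2 ^+ 3 + x3 ^+ 3 = y1 ^+ 3 + y2 ^+ 3 + y3 ^+ 3 -> - x3 <= - y3.
    move=> x12 x23 y12 y23 k1 k2 k3; apply: (top _ (- x2) (- x1) _ (- y2) (- y1)).
    1-4: by rewrite lerN2.
    - by lra.
    - by rewrite !sqrrN; lra.
    - have c3 (u : R) : (- u) ^+ 3 = - u ^+ 3 by ring.
      by rewrite !c3; lra.
  apply: oppr_inj; apply: le_anti.
  by rewrite (top' a b c a' b' c') // (top' a' b' c' a b c) // -?h1 -?h2 -?h3.
by split=> //; lra.
Qed.

End Matrix3.

(** A nested pair instead of a conjunction, so that the whole table serves as one rewriting rule.
    The weights of [A1] are 0 on [x], 1 on [y, z] and 2 on [p, q]. *)
Definition weight2_relations (R : realType) (n : nat) (A1 A2 A3 : 'M[R]_n)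
    (x y z p q : 'cV[R]_n) : Prop :=
  (A1 *m y = z) * (A1 *m z = - y) * (A1 *m p = 2 *: q) * (A1 *m q = - 2 *: p) *
   (A2 *m x = y) * (A2 *m y = - 3 *: x + 2^-1 *: p) * (A2 *m z = 2^-1 *: q) *
   (A2 *m p = - 2 *: y) * (A2 *m q = - 2 *: z) *
   (A3 *m x = z) * (A3 *m y = 2^-1 *: q) * (A3 *m z = - 3 *: x - 2^-1 *: p) *
   (A3 *m p = 2 *: z) * (A3 *m q = - 2 *: y).

Section Weight2.
Variables (R : realType) (n : nat) (A1 A2 A3 : 'M[R]_n) (T : {vspace 'cV[R]_n}).
Hypotheses (sk1 : A1^T = - A1) (sk2 : A2^T = - A2) (sk3 : A3^T = - A3).
Variables x y z p q : 'cV[R]_n.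
Hypotheses (orth5 : orth [:: x; y; z; p; q]) (sub5 : {subset [:: x; y; z; p; q] <= T})
  (dT : \dim T = 5%N) (xx : dot x x = 1) (A1x : A1 *m x = 0).
Hypothesis table :
  weight2_relations A1 A2 A3 x y z p q.
Implicit Types v t : 'cV[R]_n.

Definition quad_frame : 'I_3 -> 'I_3 -> 'cV[R]_n := fun i j => nth 0 (nth [::]
  [:: [:: x; 2^-1 *: z; - 2^-1 *: y];
      [:: 2^-1 *: z; - 2^-1 *: x - 4^-1 *: p; - 4^-1 *: q];
      [:: - 2^-1 *: y; - 4^-1 *: q; - 2^-1 *: x + 4^-1 *: p]] i) j.

(* The equivariant isomorphism of T with the traceless symmetric matrices, on which [lin3]
   acts through [hat] by commutators; x is sent to a multiple of diag (2, -1, -1). *)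
Definition quad v : 'M[R]_3 := \matrix_(i, j) dot v (quad_frame i j).

Lemma quad_entry v i j : quad v i j = dot v (quad_frame i j).
Proof. exact: mxE. Qed.

Lemma quad_frame_sym i j : quad_frame i j = quad_frame j i.
Proof. by elim/ord3P: i; elim/ord3P: j. Qed.

Lemma quad_frameT i j : quad_frame i j \in T.
Proof.
have [[xT yT] [zT pT qT]] : (x \in T /\ y \in T) /\ [/\ z \in T, p \in T & q \in T].
  by do !split; apply: sub5; rewrite !inE eqxx ?orbT.
elim/ord3P: i; elim/ord3P: j; rewrite /quad_frame //=; try by apply: rpredZ.
  by rewrite rpredB // rpredZ.
by rewrite rpredD // rpredZ.
Qed.

Lemma quad_tr v : (quad v)^T = quad v.
Proof. by apply/matrixP => i j; rewrite !mxE quad_frame_sym. Qed.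

Lemma quadE v : quad v =
  mat3 (dot v x) (dot v z / 2) (- dot v y / 2)
       (dot v z / 2) (- dot v x / 2 - dot v p / 4) (- dot v q / 4)
       (- dot v y / 2) (- dot v q / 4) (- dot v x / 2 + dot v p / 4).
Proof.
apply/matrixP => i j; rewrite !mxE.
elim/ord3P: i; elim/ord3P: j; rewrite /quad_frame /= ?dotDr ?dotNr ?dotZr //; by field.
Qed.

Lemma quad_trace v : \tr (quad v) = 0.
Proof. rewrite quadE trace3E !mxE /=; by field. Qed.

Let skewE := (skew_dot sk1, skew_dot sk2, skew_dot sk3).

Lemma quad_lin3 y1 y2 y3 v : quad (lin3 A1 A2 A3 y1 y2 y3 *m v) =
  hat y1 y2 y3 *m quad v - quad v *m hat y1 y2 y3.
Proof.
have E (M N : 'M[R]_3) i j : (M - N) i j = M i j - N i j by rewrite !mxE.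
rewrite !quadE lin3_mul; apply/matrixP => i j; rewrite E !mul3E.
have hx : dot (y1 *: (A1 *m v) + y2 *: (A2 *m v) + y3 *: (A3 *m v)) x =
   - (y2 * dot v y + y3 * dot v z).
  by rewrite !dotDl !dotZl !skewE A1x !table dot0r; ring.
have hy : dot (y1 *: (A1 *m v) + y2 *: (A2 *m v) + y3 *: (A3 *m v)) y =
   - (y1 * dot v z + y2 * (- 3 * dot v x + dot v p / 2) + y3 * (dot v q / 2)).
  by rewrite !dotDl !dotZl !skewE !table !dotDr !dotZr; ring.
have hz : dot (y1 *: (A1 *m v) + y2 *: (A2 *m v) + y3 *: (A3 *m v)) z =
   - (- y1 * dot v y + y2 * (dot v q / 2) + y3 * (- 3 * dot v x - dot v p / 2)).
  by rewrite !dotDl !dotZl !skewE !table !dotDr !dotNr !dotZr; ring.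
have hp : dot (y1 *: (A1 *m v) + y2 *: (A2 *m v) + y3 *: (A3 *m v)) p =
   - (y1 * 2 * dot v q - y2 * 2 * dot v y + y3 * 2 * dot v z).
  by rewrite !dotDl !dotZl !skewE !table !dotZr; ring.
have hq : dot (y1 *: (A1 *m v) + y2 *: (A2 *m v) + y3 *: (A3 *m v)) q =
   - (- y1 * 2 * dot v p - y2 * 2 * dot v z - y3 * 2 * dot v y).
  by rewrite !dotDl !dotZl !skewE !table !dotZr; ring.
rewrite !mxE hx hy hz hp hq.
by elim/ord3P: i; elim/ord3P: j; rewrite /=; field.
Qed.

Lemma quadD v t : quad (v + t) = quad v + quad t.
Proof. by apply/matrixP => i j; rewrite !mxE dotDl. Qed.

Lemma quadZ a v : quad (a *: v) = a *: quad v.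
Proof. by apply/matrixP => i j; rewrite !mxE dotZl. Qed.

Lemma quad_eq0 z0 : (forall t, t \in T -> dot t z0 = 0) -> quad z0 = 0.
Proof. by move=> h; apply/matrixP => i j; rewrite !mxE dotC h ?quad_frameT. Qed.

Lemma weight2_norms : [/\ dot y y = 3, dot z z = 3, dot p p = 12 & dot q q = 12].
Proof.
have [[xy xz] [xp yz] [yq zp zq]] :
    [/\ dot x y = 0 /\ dot x z = 0, dot x p = 0 /\ dot y z = 0 &
     [/\ dot y q = 0, dot z p = 0 & dot z q = 0]].
  have := orth5; rewrite /= => /and3P[_ /and5P[/eqP-> /eqP-> /eqP-> _ _]].
  by move=> /and3P[_ /and4P[/eqP-> _ /eqP-> _] /and3P[_ /and3P[/eqP-> /eqP-> _] _]].
have yy : dot y y = 3.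
  have := skew_dot sk2 x y; rewrite !table dotDr !dotZr xx xp; lra.
have zz : dot z z = 3.
  have := skew_dot sk3 x z; rewrite !table dotDr dotNr !dotZr xx xp; lra.
split=> //.
  have := skew_dot sk2 p y; rewrite !table dotDr !dotZr !dotZl (dotC p x) xp yy; lra.
have := skew_dot sk2 q z; rewrite !table !dotZr !dotZl zz; lra.
Qed.

Lemma quad_norm t : t \in T -> \tr (quad t *m quad t) = 3 / 2 * dot t t.
Proof.
move=> tT; have [yy zz pp qq] := weight2_norms.
rewrite {4}(orth_expand orth5 sub5 _ tT) ?dT // /proj !big_cons big_nil xx yy zz pp qq.
rewrite !dotDr !dotZr dot0r quadE trace3E !mul3E !mxE /=; by field.
Qed.

Lemma quad_inj t t' : t \in T -> t' \in T -> quad t = quad t' -> t = t'.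
Proof.
move=> tT t'T E; apply/eqP; rewrite -subr_eq0; apply/eqP/dot_eq0.
have dT' : t - t' \in T by rewrite rpredB.
have q0 : quad (t - t') = 0 by rewrite -scaleN1r quadD quadZ E scaleN1r subrr.
have := quad_norm dT'; rewrite q0 mulmx0 mxtrace0; lra.
Qed.

(** Schur's lemma made explicit: applying the operators to [v] turns the upper left entry
    successively into all the others, so this entry determines an equivariant symmetric matrix. *)
Lemma quad_unique (Y : 'cV[R]_n -> 'M[R]_3) (lam : R) :
  (forall v, (Y v)^T = Y v) ->
  (forall v, [/\ Y (A1 *m v) = hat 1 0 0 *m Y v - Y v *m hat 1 0 0,
     Y (A2 *m v) = hat 0 1 0 *m Y v - Y v *m hat 0 1 0 &
     Y (A3 *m v) = hat 0 0 1 *m Y v - Y v *m hat 0 0 1]) ->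
  (forall v, Y v ax1 ax1 = lam * quad v ax1 ax1) -> forall v, Y v = lam *: quad v.
Proof.
move=> Ys YA Y0.
have sym (S : 'cV[R]_n -> 'M[R]_3) v i j : (forall v, (S v)^T = S v) -> S v j i = S v i j.
  by move=> h; rewrite -[in LHS]h mxE.
have XA v : [/\ quad (A1 *m v) = hat 1 0 0 *m quad v - quad v *m hat 1 0 0,
     quad (A2 *m v) = hat 0 1 0 *m quad v - quad v *m hat 0 1 0 &
     quad (A3 *m v) = hat 0 0 1 *m quad v - quad v *m hat 0 0 1].
  by rewrite -!quad_lin3 /lin3 !scale1r !scale0r !addr0 !add0r.
have Y01 v : Y v ax1 ax2 = lam * quad v ax1 ax2.
  have := Y0 (A3 *m v); have [_ _ ->] := YA v; have [_ _ ->] := XA v.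
  have [_ -> _ _ _] := hat_comm (Y v); have [_ -> _ _ _] := hat_comm (quad v).
  by rewrite (sym Y v ax1 ax2) // (sym quad v ax1 ax2) //; [lra|exact: quad_tr].
have Y02 v : Y v ax1 ax3 = lam * quad v ax1 ax3.
  have := Y0 (A2 *m v); have [_ -> _] := YA v; have [_ -> _] := XA v.
  have [_ _ _ _ [-> _ _ _ _]] := hat_comm (Y v).
  have [_ _ _ _ [-> _ _ _ _]] := hat_comm (quad v).
  by rewrite (sym Y v ax1 ax3) // (sym quad v ax1 ax3) //; [lra|exact: quad_tr].
have Y11 v : Y v ax2 ax2 = lam * quad v ax2 ax2.
  have := Y01 (A3 *m v); have [_ _ ->] := YA v; have [_ _ ->] := XA v.
  have [_ _ -> _ _] := hat_comm (Y v); have [_ _ -> _ _] := hat_comm (quad v).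
  rewrite Y0; lra.
have Y12 v : Y v ax2 ax3 = lam * quad v ax2 ax3.
  have := Y02 (A3 *m v); have [_ _ ->] := YA v; have [_ _ ->] := XA v.
  have [_ _ _ -> _] := hat_comm (Y v); have [_ _ _ -> _] := hat_comm (quad v).
  lra.
have Y22 v : Y v ax3 ax3 = lam * quad v ax3 ax3.
  have := Y02 (A2 *m v); have [_ -> _] := YA v; have [_ -> _] := XA v.
  have [_ _ _ _ [_ -> _ _ _]] := hat_comm (Y v).
  have [_ _ _ _ [_ -> _ _ _]] := hat_comm (quad v).
  rewrite Y0; lra.
have Zs v : (lam *: quad v)^T = lam *: quad v by rewrite linearZ /= quad_tr.
have Ze v i j : (lam *: quad v) i j = lam * quad v i j by rewrite !mxE.
move=> v; apply/matrixP => i j.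
elim/ord3P: i; elim/ord3P: j; rewrite Ze //.
- by rewrite (sym Y v ax1 ax2) // (sym quad v ax1 ax2) //; exact: quad_tr.
- by rewrite (sym Y v ax1 ax3) // (sym quad v ax1 ax3) //; exact: quad_tr.
- by rewrite (sym Y v ax2 ax3) // (sym quad v ax2 ax3) //; exact: quad_tr.
Qed.

Definition cubic v : R := \tr (quad v *m quad v *m quad v).

Lemma cubicE v : cubic v = \tr (quad v *m quad v *m quad v).
Proof. by []. Qed.

Lemma cubicZ a v : cubic (a *: v) = a ^+ 3 * cubic v.
Proof. by rewrite /cubic quadZ -!(scalemxAl, scalemxAr) !scalerA mxtraceZ; congr (_ * _); ring. Qed.

Lemma cubic_x : cubic x = 3 / 4.
Proof.
have := orth5; rewrite /= => /and3P[_ /and5P[/eqP xy /eqP xz /eqP xp /eqP xq _] _].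
by rewrite /cubic quadE trace3E !mul3E !mxE /= xx xy xz xp xq; field.
Qed.

Lemma continuous_cubic (S : topologicalType) (f : S -> 'cV[R]_n) :
  continuous f -> continuous (fun a => cubic (f a)).
Proof.
move=> fc.
have qc : continuous (fun a => quad (f a)).
  apply: continuous_mx => i j; rewrite (_ : (fun _ => _) = (fun a => dot (f a) (quad_frame i j))).
    by apply: continuous_dot => //; exact: cst_continuous.
  by apply/funext => a; rewrite mxE.
rewrite (_ : (fun _ => _) = (fun a => (quad (f a) *m quad (f a) *m quad (f a)) ax1 ax1 +
  (quad (f a) *m quad (f a) *m quad (f a)) ax2 ax2 + (quad (f a) *m quad (f a) *m quad (f a)) ax3 ax3)).
  by do !apply: continuous_addR; apply: continuous_entry; do !apply: continuous_mulmx.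
by apply/funext => a; rewrite /cubic trace3E.
Qed.

End Weight2.

Lemma mx_exp_near (R : realType) (n : nat) (A : 'M[R]_n) (P : set 'M[R]_n) :
  nbhs (1%:M : 'M[R]_n) P -> exists2 e : R, 0 < e & forall t, `|t| < e -> P (mx_exp (t *: A)).
Proof.
move=> /nbhs_ballP[d /= d0 dP]; have [C C0 hC] := mx_exp_expansion A.
pose K := `|A| + `|A *m A| + C + 1.
have K0 : 0 < K by rewrite ltr_wpDl // !addr_ge0.
exists (Num.min 1 (d / K)); first by rewrite lt_min ltr01 divr_gt0.
move=> t; rewrite lt_min => /andP[t1 td]; apply: dP; split=> // i j.
rewrite /ball /= ltr_pdivlMr // in td *; rewrite distrC.
have := hC t (ltW t1) i j; have := coord_le_norm A i j; have := coord_le_norm (A *m A) i j.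
rewrite !mxE; set a := (A i j); set b := (\sum_(_ < n) _); set E := mx_exp _ i j; set o := (_ *+ _).
move=> hb ha h.
have -> : E - o = (E - (o + t * a + t ^+ 2 / 2 * b)) + (t * a + t ^+ 2 / 2 * b) by ring.
apply: le_lt_trans td; apply: le_trans (ler_normD _ _) _.
have t2 : `|t| ^+ 2 <= `|t| by rewrite expr2 ler_piMl // ltW.
have t3 : `|t| ^+ 3 <= `|t|.
  by rewrite exprS ler_piMr // exprn_ile1 // ltW.
have e1 : `|t * a + t ^+ 2 / 2 * b| <= `|t| * (`|A| + `|A *m A|).
  apply: le_trans (ler_normD _ _) _; rewrite mulrDr lerD //.
    by rewrite normrM ler_wpM2l.
  rewrite normrM (normrM (t ^+ 2)) normrX normfV (ger0_norm (ler0n R 2)) -mulrA.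
  apply: le_trans (_ : `|t| ^+ 2 * `|b| <= _).
    by rewrite ler_wpM2l ?exprn_ge0 // ler_piMl // invf_le1 // ler1n.
  by apply: ler_pM => //; rewrite exprn_ge0.
have e2 : C * `|t| ^+ 3 <= C * `|t| by rewrite ler_wpM2l.
apply: le_trans (lerD h e1) _; rewrite /K.
have : 0 <= `|t| by []. lra.
Qed.

(** * A basis of the Lie algebra *)

Section Su2Basis.
Variable R : realType.

(* The basis is [- i / 2] times the Pauli matrices. *)
Definition su2_mx (y1 y2 y3 : R) : 'M[complex R]_2 := \matrix_(i, j)
  nth 0 (nth [::] [:: [:: Complex 0 (- y3 / 2); Complex (- y2 / 2) (- y1 / 2)];
                      [:: Complex (y2 / 2) (- y1 / 2); Complex 0 (y3 / 2)]] i) j.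

Lemma ord2P (P : 'I_2 -> Prop) : P ord0 -> P (lift ord0 ord0) -> forall i, P i.
Proof.
move=> h0 h1 [[|[|//]] hi].
- by rewrite (_ : Ordinal hi = ord0) //; apply: val_inj.
- by rewrite (_ : Ordinal hi = lift ord0 ord0) //; apply: val_inj.
Qed.

Lemma complex_ext (a b : complex R) : complex.Re a = complex.Re b -> complex.Im a = complex.Im b -> a = b.
Proof. by case: a b => [a1 a2] [b1 b2] /= -> ->. Qed.

Lemma su2_mxP A : @su2 R A <-> exists y1 y2 y3, A = su2_mx y1 y2 y3.
Proof.
split=> [[hA hT]|[y1 [y2 [y3 ->]]]]; last first.
  split; last first.
    rewrite /mxtrace !big_ord_recl big_ord0 !mxE /=; apply: complex_ext => /=; lra.
  apply/matrixP => i j; rewrite !mxE; elim/ord2P: i; elim/ord2P: j; apply: complex_ext => /=; lra.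
have e i j := congr1 (fun M : 'M[complex R]_2 => M i j) hA.
have e00 := e ord0 ord0; have e01 := e ord0 (lift ord0 ord0).
have e11 := e (lift ord0 ord0) (lift ord0 ord0).
rewrite !mxE in e00 e01 e11.
have t := hT; rewrite /mxtrace !big_ord_recl big_ord0 addr0 in t.
exists (- 2 * complex.Im (A ord0 (lift ord0 ord0))), (- 2 * complex.Re (A ord0 (lift ord0 ord0))),
  (- 2 * complex.Im (A ord0 ord0)).
have r00 := congr1 (@complex.Re R) e00; have r01 := congr1 (@complex.Re R) e01; have i01 := congr1 (@complex.Im R) e01.
have rt := congr1 (@complex.Re R) t; have it := congr1 (@complex.Im R) t.
apply/matrixP => i j; rewrite mxE.
move: r00 r01 i01 rt it; move: (A) i j => M i j.
elim/ord2P: i; elim/ord2P: j; rewrite /=.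
all: case: (M ord0 ord0) => a1 a2; case: (M ord0 (lift ord0 ord0)) => b1 b2.
all: case: (M (lift ord0 ord0) ord0) => c1 c2.
all: case: (M (lift ord0 ord0) (lift ord0 ord0)) => d1 d2.
all: rewrite /= => r00 r01 i01 rt it; apply: complex_ext; rewrite /=; lra.
Qed.

Lemma su2_mxD (a y1 y2 y3 z1 z2 z3 : R) : a%:C%C *: su2_mx y1 y2 y3 + su2_mx z1 z2 z3 =
  su2_mx (a * y1 + z1) (a * y2 + z2) (a * y3 + z3).
Proof.
apply/matrixP => i j; rewrite !mxE; elim/ord2P: i; elim/ord2P: j; apply: complex_ext => /=; lra.
Qed.

Lemma su2_mx_bracket (y1 y2 y3 z1 z2 z3 : R) :
  lie_bracket (su2_mx y1 y2 y3) (su2_mx z1 z2 z3) =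
  su2_mx (y2 * z3 - y3 * z2) (y3 * z1 - y1 * z3) (y1 * z2 - y2 * z1).
Proof.
have E (M N : 'M[complex R]_2) i j : (M - N) i j = M i j - N i j by rewrite !mxE.
have P (M N : 'M[complex R]_2) i j : (M *m N) i j =
    M i ord0 * N ord0 j + M i (lift ord0 ord0) * N (lift ord0 ord0) j.
  by rewrite mxE !big_ord_recl big_ord0 addr0.
rewrite /lie_bracket; apply/matrixP => i j; rewrite E !P !mxE.
elim/ord2P: i; elim/ord2P: j; apply: complex_ext => /=; by field.
Qed.

Lemma su2_mx1_neq0 : su2_mx 1 0 0 <> su2_mx 0 0 0.
Proof.
move=> /(congr1 (fun M : 'M[complex R]_2 => complex.Im (M ord0 (lift ord0 ord0)))).
rewrite !mxE /=; lra.
Qed.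

Lemma su2_triple n (g : set 'M[R]_n) : isomorphic_to_su2 g ->
  exists A1 A2 A3 : 'M[R]_n,
  [/\ forall A, g A <-> exists y1 y2 y3, A = lin3 A1 A2 A3 y1 y2 y3,
      A1 *m A2 - A2 *m A1 = A3, A2 *m A3 - A3 *m A2 = A1,
      A3 *m A1 - A1 *m A3 = A2 & A1 != 0].
Proof.
move=> [phi [[phig inj surj] lin br]].
have S y1 y2 y3 : su2 (su2_mx y1 y2 y3) by apply/su2_mxP; exists y1, y2, y3.
have phi0 : phi (su2_mx 0 0 0) = 0.
  have := lin 1 _ _ (S 0 0 0) (S 0 0 0); rewrite su2_mxD mulr0 addr0 scale1r.
  by move=> /eqP; rewrite -subr_eq0 opprD addrA subrr sub0r oppr_eq0 => /eqP.
have phiE y1 y2 y3 : phi (su2_mx y1 y2 y3) =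
    lin3 (phi (su2_mx 1 0 0)) (phi (su2_mx 0 1 0)) (phi (su2_mx 0 0 1)) y1 y2 y3.
  have -> : su2_mx y1 y2 y3 = y1%:C%C *: su2_mx 1 0 0 + (y2%:C%C *: su2_mx 0 1 0 +
      (y3%:C%C *: su2_mx 0 0 1 + su2_mx 0 0 0)).
    by rewrite !su2_mxD !mulr1 !mulr0 !addr0 !add0r.
  have e3 : y3%:C%C *: su2_mx 0 0 1 + su2_mx 0 0 0 = su2_mx 0 0 y3.
    by rewrite su2_mxD !mulr1 !mulr0 !addr0.
  have e2 : y2%:C%C *: su2_mx 0 1 0 + su2_mx 0 0 y3 = su2_mx 0 y2 y3.
    by rewrite su2_mxD !mulr1 !mulr0 !addr0 add0r.
  by rewrite {1}e3 e2 lin // -e2 lin // -e3 lin // phi0 addr0 addrA.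
have brE y1 y2 y3 z1 z2 z3 : phi (su2_mx y1 y2 y3) *m phi (su2_mx z1 z2 z3) -
    phi (su2_mx z1 z2 z3) *m phi (su2_mx y1 y2 y3) =
    phi (su2_mx (y2 * z3 - y3 * z2) (y3 * z1 - y1 * z3) (y1 * z2 - y2 * z1)).
  by rewrite -su2_mx_bracket br.
exists (phi (su2_mx 1 0 0)), (phi (su2_mx 0 1 0)), (phi (su2_mx 0 0 1)); split.
- move=> A; split=> [/surj[M /su2_mxP[y1 [y2 [y3 ->]]] <-]|[y1 [y2 [y3 ->]]]].
    by exists y1, y2, y3.
  by rewrite -phiE; apply: phig; exact: S.
1-3: by rewrite brE; congr (phi (su2_mx _ _ _)); ring.
apply/eqP => p1; apply: su2_mx1_neq0; apply: inj; rewrite ?inE //.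
by rewrite p1 phi0.
Qed.

End Su2Basis.

(** * Compact groups with Lie algebra su(2) *)

Section Su2Group.
Variables (R : realType) (n : nat) (G : set 'M[R]_n).
Hypotheses (hG : is_orthogonal_subgroup G) (hGcompact : compact G).
Variables A1 A2 A3 : 'M[R]_n.
Hypothesis lieP : forall A, lie_algebra G A <->
  exists y1 y2 y3, A = lin3 A1 A2 A3 y1 y2 y3.
Hypotheses (br12 : A1 *m A2 - A2 *m A1 = A3) (br23 : A2 *m A3 - A3 *m A2 = A1)
  (br31 : A3 *m A1 - A1 *m A3 = A2).
Implicit Types (u v w z : 'cV[R]_n) (g h : 'M[R]_n).
Local Notation T := (moving A1 A2 A3).
Local Notation fixed := (fixed A1 A2 A3).
Local Notation lin3 := (lin3 A1 A2 A3).

Lemma lie_lin3 y1 y2 y3 : lie_algebra G (lin3 y1 y2 y3).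
Proof. by apply/lieP; exists y1, y2, y3. Qed.

Lemma lie1 : lie_algebra G A1.
Proof. by apply/lieP; exists 1, 0, 0; rewrite /lin3 scale1r !scale0r !addr0. Qed.
Lemma lie2 : lie_algebra G A2.
Proof. by apply/lieP; exists 0, 1, 0; rewrite /lin3 scale1r !scale0r addr0 add0r. Qed.
Lemma lie3 : lie_algebra G A3.
Proof. by apply/lieP; exists 0, 0, 1; rewrite /lin3 scale1r !scale0r !add0r. Qed.

Let sk1 := lie_skew hG lie1.
Let sk2 := lie_skew hG lie2.
Let sk3 := lie_skew hG lie3.

Lemma fixedP z : fixed z <-> forall A, lie_algebra G A -> A *m z = 0.
Proof.
split=> [[z1 z2 z3] A /lieP[y1 [y2 [y3 ->]]]|h].
  by rewrite lin3_mul z1 z2 z3 !scaler0 !addr0.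
by split; apply: h; [exact: lie1|exact: lie2|exact: lie3].
Qed.

(** Conjugation by [g] preserves the Lie algebra, so all of [G] preserves its common kernel, not
    only the identity component. *)
Lemma group_fixed g z : G g -> fixed z -> fixed (g *m z).
Proof.
move=> Gg /fixedP fz; apply/fixedP => A gA.
have := fz _ (lie_conj hG (orthogonal_tr hG Gg) gA); rewrite trmxK => h.
have : g *m (g^T *m A *m g *m z) = 0 by rewrite h mulmx0.
by rewrite !mulmxA (orthogonal_trK hG) // mul1mx.
Qed.

Lemma moving_of_dot v : (forall z, fixed z -> dot v z = 0) -> v \in T.
Proof.
move=> h; have [t tT fz] := fixed_moving_decomp sk1 sk2 sk3 v.
have : v - t = 0.
  apply: dot_eq0; rewrite {1}dotBl h // (moving_dot_fixed sk1 sk2 sk3 tT fz) subrr //.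
by move=> /eqP; rewrite subr_eq0 => /eqP ->.
Qed.

Lemma group_moving g v : G g -> v \in T -> g *m v \in T.
Proof.
move=> Gg vT; apply: moving_of_dot => z fz; rewrite dot_mulmx.
by apply: (moving_dot_fixed sk1 sk2 sk3 vT); apply: group_fixed => //; exact: (orthogonal_tr hG).
Qed.

Definition base_relation v (s : R) w : Prop :=
  (forall z, fixed z -> dot (w - v) z = 0) /\ dot w w = dot v v + s ^+ 2.

Lemma continuous_proj1 (S1 S2 : topologicalType) : continuous (@fst S1 S2).
Proof. by move=> x; exact: cvg_fst. Qed.
Lemma continuous_proj2 (S1 S2 : topologicalType) : continuous (@snd S1 S2).
Proof. by move=> x; exact: cvg_snd. Qed.

Lemma continuous_composition (S1 S2 S3 : topologicalType) (f : S1 -> S2) (g : S2 -> S3) :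
  continuous f -> continuous g -> continuous (fun x => g (f x)).
Proof. by move=> fc gc x; apply: continuous_comp; [exact: fc|exact: gc]. Qed.

Lemma closed_eqfun (S : topologicalType) (f g : S -> R) :
  continuous f -> continuous g -> closed [set x | f x = g x].
Proof.
move=> fc gc.
have -> : [set x | f x = g x] = (fun x => f x - g x) @^-1` [set x | x = 0].
  by apply/seteqP; split=> x /= => [->|/eqP]; rewrite ?subrr // subr_eq0 => /eqP.
apply: (@closed_comp _ _ (fun x => f x - g x)); last exact: closed_eq.
by move=> x _; apply: cvgB; [exact: fc|exact: gc].
Qed.

Section Charts.
Variable E : 'cV[R]_n -> R -> 'cV[R]_n -> Prop.
Let Phi v s w := base_relation v s w /\ E v s w.
Hypothesis E_equivariant : forall g v s w, G g -> E v s w -> E (g *m v) s (g *m w).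
Hypothesis E_total : forall v s, exists w, base_relation v s w /\ E v s w.
Hypothesis E_orbit : forall v s w w', base_relation v s w /\ E v s w ->
  base_relation v s w' /\ E v s w' -> exists2 g, G g & w' = g *m w.
Hypothesis E_refl : forall v, E v 0 v.
Hypothesis E_closed : closed [set p : 'cV[R]_n * ('cV[R]_n * R) | E p.2.1 p.2.2 p.1].

Lemma dot_le_norm v : dot v v <= n%:R * `|v| ^+ 2.
Proof.
rewrite dotE; apply: (@le_trans _ _ (\sum_(i < n) `|v| ^+ 2)).
  apply: ler_sum => i _; rewrite -expr2 -real_normK ?num_real //.
  by rewrite lerXn2r ?nnegrE //; exact: coord_le_norm.
by rewrite sumr_const card_ord mulr_natl.
Qed.

Lemma not_locally_euclidean_of d : ~ locally_euclidean R d (orbit_space hG).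
Proof.
(* The norm is the maximum of the coordinates, with [dot v v] at most [n] times its square; this
   accounts for the constant [n%:R + 1]. *)
apply: (@not_locally_euclidean R n G hG Phi _ _ _ _ _ _ (n%:R + 1)).
- move=> g v s w Gg [[h1 h2] h3]; split; last exact: E_equivariant.
  split=> [z fz|]; last by rewrite !dot_orthogonal //; exact: (orthogonalP hG).
  rewrite -mulmxBr dot_mulmx; apply: h1; apply: group_fixed => //; exact: (orthogonal_tr hG).
- exact: E_total.
- exact: E_orbit.
- by move=> v; split=> //; split=> [z _|]; rewrite ?subrr ?dot0l // expr0n addr0.
- move=> v s s0 [[_]]; rewrite dot0l => h _; have := dot_ge0 v.
  have : 0 < s ^+ 2 by rewrite exprn_even_gt0.
  lra.
- pose D1 := \bigcap_(z in [set z | fixed z])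
    [set p : 'cV[R]_n * ('cV[R]_n * R) | dot (p.1 - p.2.1) z = 0].
  pose D2 := [set p : 'cV[R]_n * ('cV[R]_n * R) | dot p.1 p.1 = dot p.2.1 p.2.1 + p.2.2 ^+ 2].
  have -> : [set p : 'cV[R]_n * ('cV[R]_n * R) | Phi p.2.1 p.2.2 p.1] =
      D1 `&` D2 `&` [set p | E p.2.1 p.2.2 p.1].
    by apply/seteqP; split=> [p [[h1 h2] h3]|p [[h1 h2] h3]].
  have c1 : continuous (fun p : 'cV[R]_n * ('cV[R]_n * R) => p.1) by exact: continuous_proj1.
  have c2 : continuous (fun p : 'cV[R]_n * ('cV[R]_n * R) => p.2.1).
    by apply: continuous_composition; [exact: continuous_proj2|exact: continuous_proj1].
  have c3 : continuous (fun p : 'cV[R]_n * ('cV[R]_n * R) => p.2.2).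
    by apply: continuous_composition; [exact: continuous_proj2|exact: continuous_proj2].
  apply: closedI => //; apply: closedI.
    apply: closed_bigI => z _; apply: closed_eqfun; last exact: cst_continuous.
    apply: continuous_dot; last exact: cst_continuous.
    by move=> p; apply: (@cvgB R 'cV[R]_n); [exact: c1|exact: c2].
  apply: closed_eqfun; first exact: continuous_dot.
  apply: continuous_addR; first exact: continuous_dot.
  exact: continuous_mulR.
- by rewrite addr_ge0.
- move=> v s w [[_ h] _].
  have h1 : `|w| ^+ 2 <= dot w w.
    rewrite -[`|w|]/(mx_norm w); have [->|/mx_norm_neq0[[i j] ->]] := eqVneq (mx_norm w) 0.
      by rewrite expr0n dot_ge0.
    rewrite real_normK ?num_real //= dotE (bigD1 i) //= (ord1 j) -expr2 lerDl.
    by apply: sumr_ge0 => k _; rewrite -expr2 sqr_ge0.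
  have h2 := dot_le_norm v.
  have h3 : `|w| ^+ 2 <= ((n%:R + 1) * (`|v| + `|s|)) ^+ 2.
    apply: le_trans h1 _; rewrite h -(real_normK (num_real s)).
    have a0 : 0 <= `|v| by []. have b0 : 0 <= `|s| by []. have n0 : 0 <= n%:R :> R by [].
    have ab : 0 <= `|v| * `|s| by rewrite mulr_ge0.
    move: h2 a0 b0 n0 ab; move: (dot v v) (`|v|) (`|s|) (n%:R : R) => q a b m h2 a0 b0 m0 ab.
    apply: (@le_trans _ _ ((m + 1) * (a + b) ^+ 2)).
      have : m * a ^+ 2 + b ^+ 2 <= (m + 1) * (a + b) ^+ 2; last by lra.
      rewrite -subr_ge0 (_ : _ - _ = m * (b ^+ 2 + a * b *+ 2) + a ^+ 2 + a * b *+ 2); last by ring.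
      by rewrite !addr_ge0 ?mulr_ge0 ?addr_ge0 ?sqr_ge0 ?mulrn_wge0.
    rewrite exprMn ler_wpM2r ?sqr_ge0 // expr2 ler_peMl ?addr_ge0 // lerDr //.
  by rewrite -(@ler_pXn2r _ 2) ?nnegrE // mulr_ge0 ?addr_ge0.
Qed.

End Charts.

(** * Canonical forms, and moving parts of dimension 3 and 4 *)

Definition fixing : set 'M[R]_n := [set g | G g /\ forall z, fixed z -> g *m z = z].

Lemma closed_eqmx (S : topologicalType) p q (f g : S -> 'M[R]_(p, q)) :
  continuous f -> continuous g -> closed [set x | f x = g x].
Proof.
move=> fc gc.
have -> : [set x | f x = g x] = \bigcap_(i : 'I_p) \bigcap_(j : 'I_q) [set x | f x i j = g x i j].
  apply/seteqP; split=> [x /= fg i _ j _ /=|x h]; first by rewrite fg.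
  by apply/matrixP => i j; exact: h.
apply: closed_bigI => i _; apply: closed_bigI => j _.
by apply: closed_eqfun; exact: continuous_entry.
Qed.

Lemma continuous_mulmxr (v : 'cV[R]_n) : continuous (fun g : 'M[R]_n => g *m v).
Proof.
by apply: continuous_mulmx; [move=> x; exact: cvg_id|exact: cst_continuous].
Qed.

Lemma compact_fixing : compact fixing.
Proof.
have -> : fixing = G `&` \bigcap_(z in [set z | fixed z]) [set g | g *m z = z] by [].
apply: compact_closedI => //; apply: closed_bigI => z _.
by apply: closed_eqmx; [exact: continuous_mulmxr|exact: cst_continuous].
Qed.

Lemma fixing1 : fixing 1%:M.
Proof. by split=> [|z _]; [exact: orthogonal_subgroup_1 hG|rewrite mul1mx]. Qed.

Lemma fixing_exp A t g : lie_algebra G A -> fixing g -> fixing (mx_exp (t *: A) *m g).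
Proof.
move=> gA [Gg fg]; split=> [|z fz].
  by apply: (orthogonal_subgroup_mul hG).
rewrite -mulmxA fg //; apply: mx_exp_fix; rewrite -scalemxAl.
by have /fixedP -> := fz; rewrite ?scaler0.
Qed.

Lemma dot_fixed_moving z t : fixed z -> t \in T ->
  dot (z + t) (z + t) = dot z z + dot t t.
Proof.
move=> fz tT; rewrite !dotDl !dotDr (dotC z t) (moving_dot_fixed sk1 sk2 sk3 tT fz); ring.
Qed.

(** Two candidates for w have the same fixed component, which reduces the single-orbit property to
    matching two vectors of equal norm in T. *)
Lemma base_relation_split v s w w' : base_relation v s w -> base_relation v s w' ->
  exists z t t', [/\ fixed z, t \in T, t' \in T & [/\ w = z + t, w' = z + t' & dot t t = dot t' t']].
Proof.
move=> [h1 n1] [h2 n2]; have [t tT fz] := fixed_moving_decomp sk1 sk2 sk3 w.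
have wT : w' - w \in T.
  apply: moving_of_dot => z fz'; have := h1 z fz'; have := h2 z fz'; rewrite !dotBl; lra.
exists (w - t), t, (w' - w + t); split=> //; first exact: rpredD.
have w'E : w' = (w - t) + (w' - w + t) by dotring.
split=> //; first by rewrite subrK.
have e1 := dot_fixed_moving fz tT; rewrite subrK in e1.
have tT' : w' - w + t \in T by exact: rpredD.
have e2 := dot_fixed_moving fz tT'; rewrite -w'E in e2.
by lra.
Qed.

Lemma fixing_glue h h' w w' : fixing h -> fixing h' -> h *m w = h' *m w' ->
  exists2 g, G g & w' = g *m w.
Proof.
move=> [Gh _] [Gh' _] E; exists (h'^T *m h).
  by apply: (orthogonal_subgroup_mul hG) => //; exact: (orthogonal_tr hG).
by rewrite -mulmxA E mulmxA (orthogonalP hG) // mul1mx.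
Qed.

(** The choice of [u] dictates the normal form: a maximizer [h] of the pairing of [h *m t] with [u]
    satisfies both variational conditions. *)
Lemma canonical (H : set 'M[R]_n) t u : H `<=` fixing -> compact H -> H 1%:M ->
  (forall A h, lie_algebra G A -> H h -> exists2 e : R, 0 < e &
     forall t, `|t| < e -> H (mx_exp (t *: A) *m h)) ->
  t \in T -> exists2 h, H h & h *m t \in T /\ forall A, lie_algebra G A ->
    dot (A *m (h *m t)) u = 0 /\ 0 <= dot (A *m (h *m t)) (A *m u).
Proof.
move=> HG cH H1 He tT.
have [h Hh hP] := @maximum_principle R n H (lie_algebra G) t u cH (ex_intro _ _ H1)
  (fun A => @lie_skew R n G hG A) He.
exists h => //; split=> //; apply: group_moving => //; by have [] := HG h Hh.
Qed.

Lemma not_fixed_neq0 u : u \in T -> u != 0 -> exists2 A, lie_algebra G A & A *m u != 0.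
Proof.
move=> uT u0; apply: contrapT => h; case/eqP: u0.
apply: (moving_fixed sk1 sk2 sk3 uT); apply/fixedP => A gA.
by apply/eqP/negPn/negP => Au; apply: h; exists A.
Qed.

Lemma moving_direction u t : u \in T -> u != 0 -> t \in T ->
  exists2 e, e \in T & dot e e = 1 /\ t = Num.sqrt (dot t t) *: e.
Proof.
have unit v : v \in T -> v != 0 ->
    (Num.sqrt (dot v v))^-1 *: v \in T /\
    dot ((Num.sqrt (dot v v))^-1 *: v) ((Num.sqrt (dot v v))^-1 *: v) = 1.
  move=> vT v0; split; first exact: rpredZ.
  rewrite dotZl dotZr mulrA -invfM -expr2 sqr_sqrtr ?dot_ge0 // mulVf //.
  by rewrite gt_eqF // dot_gt0.
move=> uT u0 tT; have [t0|t0] := eqVneq t 0.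
  have [eT e1] := unit u uT u0; exists ((Num.sqrt (dot u u))^-1 *: u) => //.
  by rewrite t0 dot0l sqrtr0 scale0r.
have [eT e1] := unit t tT t0; exists ((Num.sqrt (dot t t))^-1 *: t) => //.
by split=> //; rewrite scalerA mulfV ?scale1r // gt_eqF // sqrtr_gt0 dot_gt0.
Qed.

(** The first variation places [h *m t] on the line through [u], the second makes its coefficient
    nonnegative, and the norm determines it. So [fixing] is transitive on the spheres of T. *)
Lemma line_slice_not_locally_euclidean u : u \in T -> u != 0 ->
  (forall v, v \in T -> dot (A1 *m v) u = 0 -> dot (A2 *m v) u = 0 ->
     dot (A3 *m v) u = 0 -> exists a, v = a *: u) ->
  forall d, ~ locally_euclidean R d (orbit_space hG).
Proof.
move=> uT u0 slice d.
have uu := dot_gt0 u0.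
apply: (@not_locally_euclidean_of (fun _ _ _ => True)) => //.
- move=> v s; have [t tT fz] := fixed_moving_decomp sk1 sk2 sk3 v.
  have [e eT [e1 te]] := moving_direction uT u0 tT.
  pose N := dot t t + s ^+ 2; have N0 : 0 <= N by rewrite addr_ge0 ?dot_ge0 ?sqr_ge0.
  exists ((v - t) + Num.sqrt N *: e); split=> //; split.
    move=> z fz'; rewrite !(dotDl, dotNl) dotZl (moving_dot_fixed sk1 sk2 sk3 tT fz').
    rewrite (moving_dot_fixed sk1 sk2 sk3 eT fz'); ring.
  have := dot_fixed_moving fz tT; rewrite subrK => ->.
  rewrite dot_fixed_moving ?rpredZ // dotZl dotZr mulrA -expr2 sqr_sqrtr // e1 /N; ring.
- move=> v s w w' [b1 _] [b2 _].
  have [z [t [t' [fz tT t'T [-> -> tt]]]]] := base_relation_split b1 b2.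
  have can x : x \in T -> exists2 h, fixing h & exists2 a, 0 <= a & h *m x = a *: u.
    move=> xT; have [h fh [hT hA]] : exists2 h, fixing h & h *m x \in T /\
        forall A, lie_algebra G A ->
        dot (A *m (h *m x)) u = 0 /\ 0 <= dot (A *m (h *m x)) (A *m u).
      apply: canonical => //; [exact: compact_fixing|exact: fixing1|].
      by move=> A h gA fh; exists 1 => // r _; exact: fixing_exp.
    have [a xa] := slice (h *m x) hT (hA _ lie1).1 (hA _ lie2).1 (hA _ lie3).1.
    exists h => //; exists a => //; have [A gA Au] := not_fixed_neq0 uT u0.
    have [_] := hA _ gA; rewrite xa -scalemxAr dotZl pmulr_lge0 // dot_gt0 //.
  have [h fh [a a0 ta]] := can t tT; have [h' fh' [a' a'0 ta']] := can t' t'T.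
  apply: (fixing_glue fh fh'); rewrite !mulmxDr.
  have [Gh ->] := fh => //; have [Gh' ->] := fh' => //.
  rewrite ta ta'; congr (_ + _ *: _).
  have : (a * a) * dot u u = (a' * a') * dot u u.
    have := tt; rewrite -(dot_orthogonal t t (orthogonalP hG Gh)).
    rewrite -(dot_orthogonal t' t' (orthogonalP hG Gh')) ta ta' !dotZl !dotZr; lra.
  rewrite -!expr2 => /(mulIf (lt0r_neq0 uu)) /eqP.
  by rewrite eqrXn2 // => /eqP.
Qed.

Lemma moving_stable A v : A \in [:: A1; A2; A3] -> A *m v \in T.
Proof.
by rewrite !inE => /or3P[] /eqP ->; [exact: moving1|exact: moving2|exact: moving3].
Qed.

Lemma kernel1_odd s : orth s -> {subset s <= T} -> (forall b, b \in s -> A1 *m b = 0) ->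
  odd (\dim T - size s) ->
  exists2 x, x \in T & [/\ x != 0, A1 *m x = 0 & forall b, b \in s -> dot x b = 0].
Proof. by apply: (odd_kernel sk1) => v _; exact: moving1. Qed.

Lemma dim3_not_locally_euclidean : \dim T = 3%N ->
  forall d, ~ locally_euclidean R d (orbit_space hG).
Proof.
move=> dT; have [|||x xT [x0 x1 _]] := @kernel1_odd [::] isT; rewrite ?dT //.
have ox := su2_orth_triple sk1 sk2 sk3 br12 br31 x1 x0 xT.
apply: (line_slice_not_locally_euclidean xT x0) => v vT _ v2 v3.
exists (dot v x / dot x x); apply/eqP; rewrite -subr_eq0; apply/eqP.
apply: (orth_complete ox (T := T)).
- move=> b; rewrite !inE => /or3P[] /eqP -> //; [exact: moving2|exact: moving3].
- by rewrite dT.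
- by rewrite rpredB // rpredZ.
rewrite (skew_dot sk2) in v2; rewrite (skew_dot sk3) in v3.
have o2 : dot x (A2 *m x) = 0 by rewrite dotC skew_dotvv.
have o3 : dot x (A3 *m x) = 0 by rewrite dotC skew_dotvv.
move=> b; rewrite !inE => /or3P[] /eqP ->; rewrite dotBl dotZl.
- by rewrite divfK ?subrr // gt_eqF // dot_gt0.
- rewrite o2; lra.
- rewrite o3; lra.
Qed.

(** If the slice contained a vector [v'] orthogonal to [u], the three vectors [A u] would lie in the
    plane orthogonal to [u] and [v']. A linear relation among them is a nonzero element of the
    algebra killing [u], against [lin3_kernel4]. *)
Lemma dim4_not_locally_euclidean : \dim T = 4%N ->
  forall d, ~ locally_euclidean R d (orbit_space hG).
Proof.
move=> dT.
have [||u uT [u0 _]] := @orth_extend R n [::] T isT; rewrite ?dT //.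
apply: (line_slice_not_locally_euclidean uT u0) => v vT v1 v2 v3.
exists (dot v u / dot u u); apply/eqP; rewrite -subr_eq0; set v' := _ - _.
apply/negPn/negP => v'0.
have v'u : dot v' u = 0 by rewrite dotBl dotZl divfK ?subrr // gt_eqF // dot_gt0.
have v'T : v' \in T by rewrite rpredB // rpredZ.
have v'A A : A \in [:: A1; A2; A3] -> dot (A *m u) v' = 0.
  move=> hA.
  have skA : A^T = - A by move: hA; rewrite !inE => /or3P[] /eqP ->.
  rewrite dotBr dotZr skew_dotvv // mulr0 subr0 (skew_dot skA) dotC.
  by move: hA; rewrite !inE => /or3P[] /eqP ->; rewrite ?v1 ?v2 ?v3 oppr0.
have uA A : A \in [:: A1; A2; A3] -> dot (A *m u) u = 0.
  by rewrite !inE => /or3P[] /eqP ->; rewrite skew_dotvv.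
have o2 : orth [:: v'; u] by rewrite /= v'0 u0 v'u eqxx.
have [b|c [oc cT sc]] := @orth_full R n [:: v'; u] T o2.
  by rewrite !inE => /orP[] /eqP ->.
rewrite size_cat dT addn2 in sc; case: c oc cT sc => [//|e1 [//|e2 [|//]]] oc cT _.
pose p A := dot (A *m u) e1 / dot e1 e1; pose q A := dot (A *m u) e2 / dot e2 e2.
have expA A : A \in [:: A1; A2; A3] -> A *m u = p A *: e1 + q A *: e2.
  move=> hA; rewrite {1}(orth_expand oc cT _ (moving_stable u hA)) ?dT //.
  by rewrite /proj /= !big_cons big_nil v'A // uA // !mul0r !scale0r !addr0.
pose B i : 'M[R]_n := [:: A1; A2; A3]`_i.
pose M : 'M[R]_(3, 2) := \matrix_(i, j) (if j == ord0 then p (B i) else q (B i)).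
have /rowV0Pn[y yM y0] : kermx M != 0.
  rewrite kermx_eq0 /row_free; apply/negP => /eqP h.
  by have := rank_leq_col M; rewrite h.
have yMe : y *m M = 0 by apply/sub_kermxP.
pose i0 : 'I_3 := ord0; pose i1 : 'I_3 := lift ord0 ord0; pose i2 : 'I_3 := lift ord0 (lift ord0 ord0).
have h1 := congr1 (fun N : 'rV_ _ => N ord0 ord0) yMe.
have h2 := congr1 (fun N : 'rV_ _ => N ord0 (lift ord0 ord0)) yMe.
rewrite !mxE !big_ord_recl big_ord0 !mxE /= addr0 -/i0 -/i1 -/i2 in h1.
rewrite !mxE !big_ord_recl big_ord0 !mxE /= addr0 -/i0 -/i1 -/i2 in h2.
apply: (@lin3_kernel4 R n A1 A2 A3 sk1 sk2 sk3 br12 br23 br31 (y ord0 i0) (y ord0 i1) (y ord0 i2) u) => //.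
  apply: contra_neq y0 => -[e0 e1' e2']; apply/rowP => i; rewrite mxE.
  by case: i => -[|[|[|//]]] hi; [rewrite -[RHS]e0|rewrite -[RHS]e1'|rewrite -[RHS]e2'];
    congr (y _ _); apply: val_inj.
rewrite lin3_mul !expA ?inE ?eqxx ?orbT //.
apply: dot_ext => w; rewrite !(dotDl, dotZl) dot0l.
transitivity ((y ord0 i0 * p A1 + (y ord0 i1 * p A2 + y ord0 i2 * p A3)) * dot e1 w +
  (y ord0 i0 * q A1 + (y ord0 i1 * q A2 + y ord0 i2 * q A3)) * dot e2 w); first by ring.
by rewrite h1 h2 !mul0r addr0.
Qed.

(** The unknown [k] is the value of [A2^2 + A3^2] on [x]. The brackets force it to be -6, minus
    l(l+1) for l = 2. *)
Lemma weight2_table_abstract (x y z p q : 'cV[R]_n) (k : R) :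
  A1 *m y = z -> A1 *m z = - y -> A1 *m p = 2 *: q -> A1 *m q = - 2 *: p ->
  A2 *m x = y -> A3 *m x = z ->
  A2 *m y = (k / 2) *: x + 2^-1 *: p -> A3 *m z = (k / 2) *: x - 2^-1 *: p ->
  A2 *m z = 2^-1 *: q -> A3 *m y = 2^-1 *: q -> q != 0 ->
  (forall v, v \in T ->
    A1 *m (A1 *m (A1 *m (A1 *m (A1 *m (A1 *m v))))) + 5 *: (A1 *m (A1 *m (A1 *m (A1 *m v)))) +
    4 *: (A1 *m (A1 *m v)) = 0) ->
  weight2_relations A1 A2 A3 x y z p q.
Proof.
move=> A1y A1z A1p A1q A2x A3x e22 e33 e23 e32 q_neq0 six.
(* A weight-3 pair. The sixth-degree relation has roots only at weights 0, 1 and 2, so both vectors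
   vanish. *)
pose s := A2 *m p - A3 *m q; pose t := A2 *m q + A3 *m p.
have A1s : A1 *m s = 3 *: t.
  rewrite /s mulmxBr (com12 br12) (com13 br31) A1p A1q -!scalemxAr /t; dotring.
have A1t : A1 *m t = - 3 *: s.
  rewrite /t mulmxDr (com12 br12) (com13 br31) A1p A1q -!scalemxAr /s; dotring.
have sT : s \in T by rewrite rpredB ?moving2 ?moving3.
have s0 : s = 0.
  have A1Z a w : A1 *m (a *: w) = a *: (A1 *m w) by rewrite -scalemxAr.
  have := six _ sT; rewrite !(A1s, A1t, A1Z) => h; apply: dot_ext => w.
  have := congr1 (fun v => dot v w) h; rewrite !(dotDl, dotZl) dot0l; lra.
have t0 : t = 0.
  have := A1s; rewrite s0 mulmx0 => /esym/eqP; rewrite scaler_eq0 pnatr_eq0 /= => /eqP //.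
have A3q : A3 *m q = A2 *m p by apply/eqP; rewrite eq_sym -subr_eq0 -/s s0.
have A3p : A3 *m p = - (A2 *m q) by apply/eqP; rewrite -addr_eq0 addrC -/t t0.
(* The scalar by which [A2] sends [p] to [y] and [q] to [z]; the bracket of [A2] and [A3] on [p]
   gives [- m / 2 = m / 2 + 2]. *)
pose m := k / 2 + 1.
have A2q : A2 *m q = m *: z.
  have := com23 br23 y; rewrite e32 -!scalemxAr e22 mulmxDr -!scalemxAr A3p A1y A3x => h.
  apply: dot_ext => w; have := congr1 (fun v => dot v w) h.
  rewrite ?(dotDl, dotZl, dotNl) /m; lra.
have A2p : A2 *m p = m *: y.
  have := com23 br23 z; rewrite e23 -!scalemxAr e33 mulmxBr -!scalemxAr A3q A1z A2x => h.
  apply: dot_ext => w; have := congr1 (fun v => dot v w) h.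
  rewrite ?(dotDl, dotZl, dotNl) ?(dotDl, dotZl, dotNl) /m; lra.
have m2 : m = - 2.
  have := com23 br23 p; rewrite A3p A2q A2p A1p mulmxN -!scalemxAr e23 e32 => h.
  have /eqP : (m + 2) *: q = 0.
    apply: dot_ext => w; have := congr1 (fun v => dot v w) h.
    rewrite ?(dotDl, dotZl, dotNl) dot0l; lra.
  by rewrite scaler_eq0 (negbTE q_neq0) orbF addr_eq0 => /eqP.
have k6 : k / 2 = - 3 by have := m2; rewrite /m; lra.
rewrite /weight2_relations A3p A3q A2p A2q e22 e33 k6 m2 A1y A1z A1p A1q.
by do !split => //; rewrite scaleNr opprK.
Qed.

(** * Weight vectors of a five-dimensional moving part *)

Section DimFive.
Variable x : 'cV[R]_n.
Hypotheses (xT : x \in T) (Ax : A1 *m x = 0) (xx : dot x x = 1) (dT : \dim T = 5%N).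

Let x_neq0 : x != 0.
Proof. by apply/eqP => x0; move/eqP: xx; rewrite x0 dot0l eq_sym oner_eq0. Qed.

Definition wt_y := A2 *m x.
Definition wt_z := A3 *m x.
Definition wt_q := 2 *: (A2 *m (A3 *m x)).
Definition wt_p := A2 *m (A2 *m x) - A3 *m (A3 *m x).
Local Notation y := wt_y.
Local Notation z := wt_z.
Local Notation p := wt_p.
Local Notation q := wt_q.

Lemma kerA1_line w : w \in T -> A1 *m w = 0 -> w = dot w x *: x.
Proof.
move=> wT w1; apply/eqP; rewrite -subr_eq0; apply/negPn/negP => w0.
have : (6 <= \dim T)%N.
  apply: (su2_kernel_pair sk1 sk2 sk3 br12 br23 br31 Ax x_neq0 xT _ w0).
  - by rewrite mulmxBr -scalemxAr Ax w1 scaler0 subrr.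
  - by rewrite rpredB // rpredZ.
  - by rewrite dotBr dotZr xx mulr1 (dotC x) subrr.
by rewrite dT.
Qed.

Let q32 : A3 *m (A2 *m x) = A2 *m (A3 *m x).
Proof. by rewrite (com23 br23) Ax addr0. Qed.

Let A1y : A1 *m y = z.
Proof. by rewrite (com12 br12) Ax mulmx0 add0r. Qed.
Let A1z : A1 *m z = - y.
Proof. by rewrite (com13 br31) Ax mulmx0 add0r. Qed.
Let A1q : A1 *m q = - 2 *: p.
Proof.
rewrite /q -scalemxAr (com12 br12) [A1 *m (A3 *m x)]A1z mulmxN; rewrite /p /y; dotring.
Qed.
Let A1p : A1 *m p = 2 *: q.
Proof.
rewrite /p mulmxBr (com12 br12) [A1 *m (A2 *m x)]A1y /z q32 (com13 br31) [A1 *m (A3 *m x)]A1z.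
by rewrite mulmxN /y q32 /q; dotring.
Qed.

Let yT : y \in T. Proof. exact: moving2. Qed.
Let zT : z \in T. Proof. exact: moving3. Qed.
Let qT : q \in T. Proof. by rewrite rpredZ // moving2. Qed.
Let pT : p \in T. Proof. by rewrite rpredB ?moving2 ?moving3. Qed.

(** [A2^2 + A3^2] commutes with [A1], hence preserves its kernel in T, which is the line of [x]. *)
Let casimir : exists k, A2 *m (A2 *m x) + A3 *m (A3 *m x) = k *: x.
Proof.
exists (dot (A2 *m (A2 *m x) + A3 *m (A3 *m x)) x); apply: kerA1_line.
  by rewrite rpredD ?moving2 ?moving3.
rewrite mulmxDr (com12 br12) [A1 *m (A2 *m x)]A1y /z q32 (com13 br31) [A1 *m (A3 *m x)]A1z.
rewrite mulmxN /y q32; dotring.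
Qed.

Let orth3 : orth [:: x; y; z].
Proof. exact: (su2_orth_triple sk1 sk2 sk3 br12 br31 Ax x_neq0 xT). Qed.

(** Otherwise [x, y, z] would span a stable subspace whose complement in T has dimension 2,
    contradicting [small_complement]. *)
Let p_neq0 : p != 0.
Proof.
apply/eqP => p0; have q0 : q = 0.
  by have := A1p; rewrite p0 mulmx0 => /esym/eqP; rewrite scaler_eq0 pnatr_eq0 /= => /eqP.
have [k kE] := casimir.
have e22 : A2 *m y = (k / 2) *: x.
  have pE := p0; rewrite /p in pE; apply: dot_ext => w.
  have := congr1 (fun v => dot v w) kE; have := congr1 (fun v => dot v w) pE.
  rewrite !(dotBl, dotDl, dotZl) dot0l /y; lra.
have e33 : A3 *m z = (k / 2) *: x.
  have pE := p0; rewrite /p in pE; apply: dot_ext => w.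
  have := congr1 (fun v => dot v w) kE; have := congr1 (fun v => dot v w) pE.
  rewrite !(dotBl, dotDl, dotZl) dot0l /z; lra.
have e23 : A2 *m z = 0 by have /eqP := q0; rewrite /q scaler_eq0 pnatr_eq0 /= => /eqP.
have e32 : A3 *m y = 0 by rewrite -[RHS]e23; exact: q32.
have : (\dim T <= size [:: x; y; z])%N; last by rewrite dT.
apply: (small_complement sk1 sk2 sk3 br12 br23 br31 orth3); last by rewrite dT.
- by move=> b; rewrite !inE => /or3P[] /eqP ->.
move=> A v hA vs b.
have [vx vy vz] : [/\ dot v x = 0, dot v y = 0 & dot v z = 0].
  by split; apply: vs; rewrite !inE eqxx ?orbT.
have skA : A^T = - A by move: hA; rewrite !inE => /or3P[] /eqP ->.
rewrite !inE (skew_dot skA).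
move: hA; rewrite !inE => /or3P[] /eqP -> /or3P[] /eqP ->.
- by rewrite Ax dot0r oppr0. - by rewrite A1y vz oppr0. - by rewrite A1z dotNr vy !oppr0.
- by rewrite [A2 *m x](_ : _ = y) // vy oppr0.
- by rewrite e22 dotZr vx mulr0 oppr0. - by rewrite e23 dot0r oppr0.
- by rewrite [A3 *m x](_ : _ = z) // vz oppr0.
- by rewrite e32 dot0r oppr0. - by rewrite e33 dotZr vx mulr0 oppr0.
Qed.

Let q_neq0 : q != 0.
Proof.
apply: contra_neq p_neq0 => q0; have := A1q; rewrite q0 mulmx0 => /esym/eqP.
by rewrite scaler_eq0 oppr_eq0 pnatr_eq0 /= => /eqP.
Qed.

Let dotA1 v w : dot v (A1 *m w) = - dot (A1 *m v) w. Proof. by rewrite (skew_dot sk1) opprK. Qed.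
Let dotA2 v w : dot v (A2 *m w) = - dot (A2 *m v) w. Proof. by rewrite (skew_dot sk2) opprK. Qed.
Let dotA3 v w : dot v (A3 *m w) = - dot (A3 *m v) w. Proof. by rewrite (skew_dot sk3) opprK. Qed.

Lemma weight2_orth : orth [:: x; y; z; p; q].
Proof.
have xp : dot x p = 0.
  have := dotA1 x q; rewrite A1q Ax dot0l oppr0 dotZr; lra.
have xq : dot x q = 0.
  have := dotA1 x p; rewrite A1p Ax dot0l oppr0 dotZr; lra.
have pq : dot p q = 0.
  have := dotA1 p p; rewrite A1p dotZr dotZl (dotC q); lra.
have yq1 : 2 * dot y q = - dot z p.
  have := dotA1 y p; rewrite A1p A1y dotZr; lra.
have yq2 : - 2 * dot y p = - dot z q.
  have := dotA1 y q; rewrite A1q A1y dotZr; lra.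
have zq1 : 2 * dot z q = dot y p.
  have := dotA1 z p; rewrite A1p A1z dotZr dotNl; lra.
have zq2 : - 2 * dot z p = dot y q.
  have := dotA1 z q; rewrite A1q A1z dotZr dotNl; lra.
have [yq yp zp zq] : [/\ dot y q = 0, dot y p = 0, dot z p = 0 & dot z q = 0].
  by split; lra.
have /and3P[_ /and3P[/eqP xy /eqP xz _] /and3P[y0 /andP[/eqP yz _] /andP[z0 _]]] := orth3.
by rewrite /= x_neq0 xy xz xp xq y0 yz yp yq z0 zp zq p_neq0 pq q_neq0 !eqxx.
Qed.

Lemma weight2_sub : {subset [:: x; y; z; p; q] <= T}.
Proof. by move=> b; rewrite !inE => /or4P[/eqP->|/eqP->|/eqP->|/orP[]/eqP->]. Qed.

Let six v : v \in T ->
  A1 *m (A1 *m (A1 *m (A1 *m (A1 *m (A1 *m v))))) + 5 *: (A1 *m (A1 *m (A1 *m (A1 *m v)))) +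
  4 *: (A1 *m (A1 *m v)) = 0.
Proof.
move=> vT; pose f (M : 'M[R]_n) := M *m v.
pose D := A1 *m A1 *m A1 *m A1 *m A1 *m A1 + 5 *: (A1 *m A1 *m A1 *m A1) + 4 *: (A1 *m A1).
have DE w : D *m w = A1 *m (A1 *m (A1 *m (A1 *m (A1 *m (A1 *m w))))) +
    5 *: (A1 *m (A1 *m (A1 *m (A1 *m w)))) + 4 *: (A1 *m (A1 *m w)).
  by rewrite /D !mulmxDl -!scalemxAl -!mulmxA.
rewrite -DE (orth_expand weight2_orth weight2_sub _ vT) ?dT // /proj mulmx_sumr big_seq big1 // => b.
have A1N w : A1 *m (- w) = - (A1 *m w) by rewrite mulmxN.
have A1Z a w : A1 *m (a *: w) = a *: (A1 *m w) by rewrite -scalemxAr.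
rewrite !inE => bs; rewrite -scalemxAr (_ : D *m b = 0) ?scaler0 // DE.
move: bs => /or4P[/eqP->|/eqP->|/eqP->|/orP[]/eqP->].
- by rewrite Ax !mulmx0 !scaler0 !addr0.
- by rewrite !(A1y, A1z, A1N); dotring.
- by rewrite !(A1y, A1z, A1N); dotring.
- by rewrite !(A1p, A1q, A1Z); dotring.
- by rewrite !(A1p, A1q, A1Z); dotring.
Qed.

Let raising : exists k, [/\ A2 *m y = (k / 2) *: x + 2^-1 *: p,
  A3 *m z = (k / 2) *: x - 2^-1 *: p, A2 *m z = 2^-1 *: q & A3 *m y = 2^-1 *: q].
Proof.
have [k kE] := casimir; exists k.
have e23 : A2 *m z = 2^-1 *: q by rewrite /q scalerA mulVf ?scale1r // pnatr_eq0.
split=> //; last by rewrite -e23; exact: q32.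
  apply: dot_ext => w; have := congr1 (fun v => dot v w) kE.
  rewrite /p !(dotBl, dotDl, dotZl, dotNl) /y; lra.
apply: dot_ext => w; have := congr1 (fun v => dot v w) kE.
rewrite /p !(dotDl, dotNl, dotZl) /z; lra.
Qed.

Lemma weight2_table :
  weight2_relations A1 A2 A3 x y z p q.
Proof.
have [k [e22 e33 e23 e32]] := raising.
by apply: (weight2_table_abstract A1y A1z A1p A1q _ _ e22 e33 e23 e32 q_neq0 (@six)).
Qed.

End DimFive.

(** * The trace form and the adjoint action of G *)

Lemma mx_ext_mul (B C : 'M[R]_n) : (forall v : 'cV[R]_n, B *m v = C *m v) -> B = C.
Proof.
by move=> h; apply/matrixP => i j; have /colP/(_ i) := h (delta_mx j ord0);
  rewrite -!colE !mxE.
Qed.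

Lemma trace_orth : [/\ \tr (A1 *m A2) = 0, \tr (A2 *m A3) = 0 & \tr (A3 *m A1) = 0].
Proof.
have key (X Y Z : 'M[R]_n) : Y *m Z - Z *m Y = X -> \tr (X *m Y) = 0.
  by move=> <-; rewrite mulmxBl raddfB /= -mulmxA [X in X - _]mxtrace_mulC subrr.
by split; apply: key; [exact: br23|exact: br31|exact: br12].
Qed.

Lemma trace_sq : \tr (A2 *m A2) = \tr (A1 *m A1) /\ \tr (A3 *m A3) = \tr (A1 *m A1).
Proof.
have c (X Y Z : 'M[R]_n) : \tr (X *m Y *m Z) = \tr (Y *m Z *m X).
  by rewrite -mulmxA mxtrace_mulC.
have e1 : \tr (A1 *m A1) = \tr (A1 *m A2 *m A3) - \tr (A1 *m A3 *m A2).
  by rewrite -{2}br23 mulmxBr raddfB /= !mulmxA.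
have e2 : \tr (A2 *m A2) = \tr (A2 *m A3 *m A1) - \tr (A2 *m A1 *m A3).
  by rewrite -{2}br31 mulmxBr raddfB /= !mulmxA.
have e3 : \tr (A3 *m A3) = \tr (A3 *m A1 *m A2) - \tr (A3 *m A2 *m A1).
  by rewrite -{2}br12 mulmxBr raddfB /= !mulmxA.
have c1 := c A1 A2 A3; have c2 := c A3 A1 A2.
have d1 := c A1 A3 A2; have d2 := c A2 A1 A3.
by split; lra.
Qed.

(** The trace form is invariant under brackets and therefore proportional to the standard product of
    coefficients; it stands in for the Killing form. *)
Lemma trace_lin3 (y1 y2 y3 z1 z2 z3 : R) : \tr (lin3 y1 y2 y3 *m lin3 z1 z2 z3) =
  (y1 * z1 + y2 * z2 + y3 * z3) * \tr (A1 *m A1).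
Proof.
have [t12 t23 t31] := trace_orth; have [t22 t33] := trace_sq.
have t21 : \tr (A2 *m A1) = 0 by rewrite mxtrace_mulC.
have t32 : \tr (A3 *m A2) = 0 by rewrite mxtrace_mulC.
have t13 : \tr (A1 *m A3) = 0 by rewrite mxtrace_mulC.
rewrite /lin3 !(mulmxDl, mulmxDr) -!(scalemxAl, scalemxAr) !(mxtraceD, mxtraceZ).
rewrite t12 t23 t31 t21 t32 t13 t22 t33; ring.
Qed.

Lemma trace_A1_neq0 : A1 != 0 -> \tr (A1 *m A1) != 0.
Proof.
move=> A10; have -> : \tr (A1 *m A1) = - \sum_i \sum_j A1 i j ^+ 2.
  rewrite /mxtrace -sumrN; apply: eq_bigr => i _; rewrite mxE -sumrN; apply: eq_bigr => j _.
  have := congr1 (fun M : 'M[R]_n => M i j) sk1; rewrite !mxE => ->; rewrite mulrN expr2 //.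
rewrite oppr_eq0; apply: contra_neq A10 => /psumr_eq0P h.
apply/matrixP => i j; rewrite mxE; apply/eqP; rewrite -sqrf_eq0; apply/eqP.
have /psumr_eq0P := h (fun i _ => sumr_ge0 _ (fun j _ => sqr_ge0 (A1 i j))) i isT.
by apply=> // k _; exact: sqr_ge0.
Qed.

Lemma lin3_inj (y1 y2 y3 z1 z2 z3 : R) : A1 != 0 -> lin3 y1 y2 y3 = lin3 z1 z2 z3 ->
  [/\ y1 = z1, y2 = z2 & y3 = z3].
Proof.
move=> /trace_A1_neq0 k0 E.
have h a b c : (y1 * a + y2 * b + y3 * c) = (z1 * a + z2 * b + z3 * c).
  by apply: (mulIf k0); rewrite -!trace_lin3 E.
by split; [have := h 1 0 0|have := h 0 1 0|have := h 0 0 1]; lra.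
Qed.

(** Conjugation by [g] preserves the trace form, so [r] is orthogonal, and it preserves brackets, so
    the columns of [r] multiply like the axes under the cross product. The last conjunct restates
    the latter through [hat]. *)
Lemma adjoint_rotation g : A1 != 0 -> G g -> exists r : 'M[R]_3,
  [/\ r^T *m r = 1%:M,
      forall j, g *m (lin3 (j == ax1)%:R (j == ax2)%:R (j == ax3)%:R) *m g^T =
        lin3 (r ax1 j) (r ax2 j) (r ax3 j) &
      forall j, r *m hat (j == ax1)%:R (j == ax2)%:R (j == ax3)%:R =
        hat (r ax1 j) (r ax2 j) (r ax3 j) *m r].
Proof.
move=> A10 Gg; have k0 := trace_A1_neq0 A10.
pose b (j : 'I_3) := lin3 (j == ax1)%:R (j == ax2)%:R (j == ax3)%:R.
have bE : [/\ b ax1 = A1, b ax2 = A2 & b ax3 = A3].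
  by rewrite /b /lin3 /= !scale1r !scale0r !addr0 !add0r.
have /choice[c hc] : forall j, exists t : R * R * R, g *m b j *m g^T = lin3 t.1.1 t.1.2 t.2.
  move=> j; have /lieP[y1 [y2 [y3 E]]] := lie_conj hG Gg (lie_lin3 (j == ax1)%:R (j == ax2)%:R (j == ax3)%:R).
  by exists (y1, y2, y3).
pose r : 'M[R]_3 := \matrix_(i, j) (if i == ax1 then (c j).1.1 else if i == ax2 then (c j).1.2 else (c j).2).
have rE j : [/\ r ax1 j = (c j).1.1, r ax2 j = (c j).1.2 & r ax3 j = (c j).2] by rewrite !mxE.
have hr j : g *m b j *m g^T = lin3 (r ax1 j) (r ax2 j) (r ax3 j).
  by have [-> -> ->] := rE j; rewrite hc.
clear rE; clearbody r; have gO := orthogonalP hG Gg.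
have mulg (X Y : 'M[R]_n) : g *m X *m g^T *m (g *m Y *m g^T) = g *m (X *m Y) *m g^T.
  by rewrite -!mulmxA; congr (_ *m _); congr (_ *m _); rewrite !mulmxA gO mul1mx.
have cross j l m : b j *m b l - b l *m b j = b m ->
    [/\ r ax1 m = r ax2 j * r ax3 l - r ax3 j * r ax2 l,
        r ax2 m = r ax3 j * r ax1 l - r ax1 j * r ax3 l &
        r ax3 m = r ax1 j * r ax2 l - r ax2 j * r ax1 l].
  move=> E; apply: lin3_inj A10 _; rewrite -hr -E mulmxBr mulmxBl -!mulg !hr.
  apply: mx_ext_mul => v; rewrite mulmxBl -!mulmxA (lin3_com br12 br23 br31).
  by rewrite addrAC subrr add0r.
have [b0 b1 b2] := bE.
have [] := @cross ax1 ax2 ax3; first by rewrite b0 b1 b2.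
move=> x0 x1 x2; have [] := @cross ax2 ax3 ax1; first by rewrite b0 b1 b2.
move=> y0 y1 y2; have [] := @cross ax3 ax1 ax2; first by rewrite b0 b1 b2.
move=> z0 z1 z2.
exists r; split=> //.
- apply/matrixP => j l; rewrite mul3E !mxE.
  have := trace_lin3 (j == ax1)%:R (j == ax2)%:R (j == ax3)%:R (l == ax1)%:R (l == ax2)%:R (l == ax3)%:R.
  have -> : \tr (b j *m b l) = \tr (g *m b j *m g^T *m (g *m b l *m g^T)).
    by rewrite mulg [RHS]mxtrace_mulC !mulmxA gO mul1mx.
  rewrite !hr trace_lin3 => /(mulIf k0).
  by elim/ord3P: j; elim/ord3P: l => /= ->; rewrite /=; ring.
move=> j; apply/matrixP => k l; rewrite !mul3E /hat.
elim/ord3P: j; elim/ord3P: k; elim/ord3P: l; rewrite !mxE /=; lra.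
Qed.

(** * Dimension 5: the cubic invariant *)

Section CubicInvariant.
Variables x y z p q : 'cV[R]_n.
Hypotheses (orth5 : orth [:: x; y; z; p; q]) (sub5 : {subset [:: x; y; z; p; q] <= T})
  (dT : \dim T = 5%N) (xx : dot x x = 1) (A1x : A1 *m x = 0).
Hypothesis table :
  weight2_relations A1 A2 A3 x y z p q.
Hypothesis kerA1 : forall w, w \in T -> A1 *m w = 0 -> w = dot w x *: x.
Hypothesis A1_neq0 : A1 != 0.
Local Notation quad := (quad x y z p q).
Local Notation cubic := (cubic x y z p q).
Local Notation frame := (quad_frame x y z p q).

Let xT : x \in T. Proof. by apply: sub5; rewrite inE eqxx. Qed.
Let x_neq0 : x != 0. Proof. by have := orth5; rewrite /= => /andP[]. Qed.
Let norm_quad := quad_norm sk2 sk3 orth5 sub5 dT xx table.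
Let quad_comm := quad_lin3 sk1 sk2 sk3 A1x table.

(** Conjugating [quad (g *m v)] back by the adjoint rotation of [g] gives another equivariant map, a
    multiple of [quad] by [quad_unique]; comparing norms leaves the factor 1 or -1. *)
Lemma group_cubic g : G g -> exists2 lam : R, lam ^+ 2 = 1 &
  forall v, cubic (g *m v) = lam * cubic v.
Proof.
move=> Gg; have [r [rr hr rhat]] := adjoint_rotation A1_neq0 Gg.
have rr' : r *m r^T = 1%:M by exact: mulmx1C.
pose Y v := r^T *m quad (g *m v) *m r.
have conjM (S U : 'M[R]_3) : r^T *m S *m r *m (r^T *m U *m r) = r^T *m (S *m U) *m r.
  by rewrite -!mulmxA; congr (_ *m (_ *m _)); rewrite !mulmxA rr' mul1mx.
have conj_tr (S : 'M[R]_3) : \tr (r^T *m S *m r) = \tr S.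
  by rewrite mxtrace_mulC !mulmxA rr' mul1mx.
have Ysym v : (Y v)^T = Y v by rewrite /Y !trmx_mul trmxK quad_tr mulmxA.
have gO := orthogonalP hG Gg.
have Yact j v : Y (lin3 (j == ax1)%:R (j == ax2)%:R (j == ax3)%:R *m v) =
    hat (j == ax1)%:R (j == ax2)%:R (j == ax3)%:R *m Y v -
    Y v *m hat (j == ax1)%:R (j == ax2)%:R (j == ax3)%:R.
  set B := lin3 _ _ _; set h := hat _ _ _.
  have -> : Y (B *m v) = r^T *m quad (g *m B *m g^T *m (g *m v)) *m r.
    by rewrite /Y !mulmxA -[in RHS](mulmxA (g *m B)) gO mulmx1.
  rewrite /B hr quad_comm mulmxBr mulmxBl.
  have e1 : hat (r ax1 j) (r ax2 j) (r ax3 j) = r *m h *m r^T.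
    by rewrite /h rhat -mulmxA rr' mulmx1.
  by rewrite e1 /Y !mulmxA rr mul1mx -!mulmxA rr mulmx1 !mulmxA.
have YA v : [/\ Y (A1 *m v) = hat 1 0 0 *m Y v - Y v *m hat 1 0 0,
     Y (A2 *m v) = hat 0 1 0 *m Y v - Y v *m hat 0 1 0 &
     Y (A3 *m v) = hat 0 0 1 *m Y v - Y v *m hat 0 0 1].
  have [b1 b2 b3] : [/\ lin3 1 0 0 = A1, lin3 0 1 0 = A2 & lin3 0 0 1 = A3].
    by rewrite /lin3 !scale1r !scale0r !addr0 !add0r.
  have a1 : Y (lin3 1 0 0 *m v) = hat 1 0 0 *m Y v - Y v *m hat 1 0 0 := Yact ax1 v.
  have a2 : Y (lin3 0 1 0 *m v) = hat 0 1 0 *m Y v - Y v *m hat 0 1 0 := Yact ax2 v.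
  have a3 : Y (lin3 0 0 1 *m v) = hat 0 0 1 *m Y v - Y v *m hat 0 0 1 := Yact ax3 v.
  by rewrite b1 in a1; rewrite b2 in a2; rewrite b3 in a3.
(* [c] represents the upper left entry of [Y] as a linear form. Equivariance puts it in the kernel
   of [A1], hence on the line of [x]. *)
pose c := g^T *m \sum_i \sum_j (r i ax1 * r j ax1) *: frame i j.
have cE v : Y v ax1 ax1 = dot v c.
  rewrite /Y /c -dot_mulmx; move: (g *m v) => w.
  rewrite dotC dot_suml; under [RHS]eq_bigr do rewrite dot_suml.
  rewrite exchange_big mxE; apply: eq_bigr => j _ /=.
  rewrite mxE mulr_suml; apply: eq_bigr => i _; rewrite dotZl (dotC _ w) -quad_entry [r^T _ _]mxE. ring.
have cT : c \in T.
  apply: group_moving; first exact: (orthogonal_tr hG).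
  apply: rpred_sum => i _; apply: rpred_sum => j _; apply: rpredZ; exact: quad_frameT.
have c1 : A1 *m c = 0.
  apply: dot_ext => v; rewrite dot0l (skew_dot sk1) dotC -cE.
  have [-> _ _] := YA v; have [-> _ _ _ _] := hat_comm (Y v); exact: oppr0.
have Y0 v : Y v ax1 ax1 = dot c x * quad v ax1 ax1.
  by rewrite cE {1}(kerA1 cT c1) dotZr quad_entry.
have YE := quad_unique sk1 sk2 sk3 A1x table Ysym YA Y0.
have lam2 : dot c x ^+ 2 = 1.
  have := congr1 (fun M : 'M[R]_3 => \tr (M *m M)) (YE x).
  have -> : \tr (Y x *m Y x) = \tr (quad (g *m x) *m quad (g *m x)).
    by rewrite /Y conjM conj_tr.
  rewrite -!(scalemxAl, scalemxAr) !mxtraceZ !norm_quad ?group_moving //.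
  rewrite dot_orthogonal // xx; lra.
exists (dot c x) => // v.
have -> : cubic (g *m v) = \tr (Y v *m Y v *m Y v).
  by rewrite /Y !conjM conj_tr.
rewrite YE -!(scalemxAl, scalemxAr) !mxtraceZ -/(cubic v).
move: lam2 (cubic v); move: (dot c x) => l l2 d.
by rewrite !mulrA -expr2 l2 mul1r.
Qed.

Definition fixing5 : set 'M[R]_n := [set g | fixing g /\ forall v, cubic (g *m v) = cubic v].

Lemma compact_fixing5 : compact fixing5.
Proof.
have -> : fixing5 = fixing `&` \bigcap_(v in [set: 'cV[R]_n]) [set g | cubic (g *m v) = cubic v].
  by apply/seteqP; split=> [g [fg h]|g [fg h]]; split=> // v;
    [move=> _; exact: h|exact: (h v I)].
apply: compact_closedI; first exact: compact_fixing.
apply: closed_bigI => v _; apply: closed_eqfun; last exact: cst_continuous.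
by apply: continuous_cubic; exact: continuous_mulmxr.
Qed.

(* The character [group_cubic] is trivial near the identity, as [cubic x] is nonzero. *)
Lemma fixing5_exp A g : lie_algebra G A -> fixing5 g -> exists2 e : R, 0 < e &
  forall t, `|t| < e -> fixing5 (mx_exp (t *: A) *m g).
Proof.
move=> gA [fg hg]; have cx := cubic_x orth5 xx.
have : nbhs (1%:M : 'M[R]_n) [set h : 'M[R]_n | 0 < cubic (h *m x)].
  have cc : continuous (fun h : 'M[R]_n => cubic (h *m x)).
    by apply: continuous_cubic; exact: continuous_mulmxr.
  apply: (cc 1%:M [set r : R | 0 < r]); apply: open_nbhs_nbhs; split; first exact: open_gt.
  by rewrite /= mul1mx cx divr_gt0.
move=> /mx_exp_near-/(_ A)[e e0 he]; exists e => // t te; split; first exact: fixing_exp.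
move=> v; have [lam lam2 hlam] := group_cubic (gA t); rewrite -mulmxA hlam hg.
have := he t te; rewrite /= hlam cx => l0.
suff -> : lam = 1 by rewrite mul1r.
have : (lam - 1) * (lam + 1) = 0 by rewrite -subr_sqr lam2 expr1n subrr.
by move=> /eqP; rewrite mulf_eq0 subr_eq0 addr_eq0 => /orP[] /eqP l1 //; lra.
Qed.

(** The linear form of [u] is the pairing with diag (1, 0, -1). Its first variation kills the
    off-diagonal entries and its second sorts the diagonal. *)
Lemma canonical5 t : t \in T -> exists2 h, fixing5 h & h *m t \in T /\ exists a b c,
  [/\ b <= a, c <= b & quad (h *m t) = mat3 a 0 0 0 b 0 0 0 c].
Proof.
move=> tT; pose u := frame ax1 ax1 - frame ax3 ax3.
have [h fh [hT hA]] : exists2 h, fixing5 h & h *m t \in T /\ forall A, lie_algebra G A ->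
    dot (A *m (h *m t)) u = 0 /\ 0 <= dot (A *m (h *m t)) (A *m u).
  apply: canonical => //.
  - by move=> g [].
  - exact: compact_fixing5.
  - by split=> [|v]; [exact: fixing1|rewrite mul1mx].
  - exact: fixing5_exp.
exists h => //; split=> //; set v := h *m t in hT hA *.
have du w : dot w u = quad w ax1 ax1 - quad w ax3 ax3 by rewrite /u dotBr !quad_entry.
have [b1 b2 b3] : [/\ lin3 1 0 0 = A1, lin3 0 1 0 = A2 & lin3 0 0 1 = A3].
  by rewrite /lin3 !scale1r !scale0r !addr0 !add0r.
have q1 w := quad_comm 1 0 0 w; have q2 w := quad_comm 0 1 0 w; have q3 w := quad_comm 0 0 1 w.
rewrite b1 in q1; rewrite b2 in q2; rewrite b3 in q3.
have sym w i j : quad w j i = quad w i j by rewrite -[in LHS]quad_tr mxE.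
have comE w : [/\ quad (A1 *m w) ax1 ax1 = 0, quad (A3 *m w) ax1 ax1 = - 2 * quad w ax1 ax2,
      quad (A3 *m w) ax1 ax2 = quad w ax1 ax1 - quad w ax2 ax2,
      quad (A2 *m w) ax1 ax1 = 2 * quad w ax1 ax3 &
      [/\ quad (A1 *m w) ax3 ax3 = 2 * quad w ax2 ax3,
          quad (A1 *m w) ax2 ax3 = quad w ax2 ax2 - quad w ax3 ax3,
          quad (A2 *m w) ax3 ax3 = - 2 * quad w ax1 ax3 & quad (A3 *m w) ax3 ax3 = 0]].
  have := hat_comm (quad w); rewrite /= -q1 -q2 -q3.
  move=> [-> -> -> _ [-> _ -> -> [-> ->]]].
  rewrite (sym w ax1 ax2) (sym w ax1 ax3) (sym w ax2 ax3).
  by split; [..|split] => //; ring.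
have [u1 _] := hA _ lie1; have [u2 _] := hA _ lie2; have [u3 _] := hA _ lie3.
have [_ p1] := hA _ lie1; have [_ p3] := hA _ lie3.
have [c1 c2 c3 c4 [c5 c6 c7 c8]] := comE v.
rewrite du c1 c5 in u1; rewrite du c4 c7 in u2; rewrite du c2 c8 in u3.
have {}p1 : quad v ax3 ax3 <= quad v ax2 ax2.
  have [d1 _ _ _ [d5 _ _ _]] := comE (A1 *m v).
  move: p1; rewrite -oppr_le0 -(skew_dot sk1) du d1 d5 c6; lra.
have {}p3 : quad v ax2 ax2 <= quad v ax1 ax1.
  have [_ d2 _ _ [_ _ _ d8]] := comE (A3 *m v).
  move: p3; rewrite -oppr_le0 -(skew_dot sk3) du d2 d8 c3; lra.
exists (quad v ax1 ax1), (quad v ax2 ax2), (quad v ax3 ax3); split=> //.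
have z12 : quad v ax1 ax2 = 0 by lra.
have z13 : quad v ax1 ax3 = 0 by lra.
have z23 : quad v ax2 ax3 = 0 by lra.
apply/matrixP => i j; rewrite [RHS]mxE; elim/ord3P: i; elim/ord3P: j; rewrite /= //.
- by rewrite sym. - by rewrite sym. - by rewrite sym.
Qed.

Lemma cubic_moving t z0 : fixed z0 -> cubic (z0 + t) = cubic t.
Proof.
move=> fz; rewrite !cubicE quadD (quad_eq0 sub5) ?add0r // => b bT.
exact: (moving_dot_fixed sk1 sk2 sk3 bT fz).
Qed.

(** On a half circle from [e] to [-e], scaled to the larger radius [rho], the cubic runs between
    [rho ^+ 3 * cubic e] and its negative. The required value is that of [e] at the smaller radius,
    so the intermediate value theorem reaches it. *)
Lemma cubic_total v (s : R) : exists w, base_relation v s w /\ cubic w = cubic v.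
Proof.
have [t tT fz] := fixed_moving_decomp sk1 sk2 sk3 v.
have [e eT [e1 te]] := moving_direction xT x_neq0 tT.
have e0 : e != 0 by apply/eqP => e0; move/eqP: e1; rewrite e0 dot0l eq_sym oner_eq0.
have [|||f0 f0T [f00 f0e]] := @orth_extend R n [:: e] T.
- by rewrite /= e0.
- by rewrite dT.
- by move=> b; rewrite inE => /eqP ->.
have [f fT [f1 fe]] : exists2 f, f \in T & dot f f = 1 /\ dot e f = 0.
  exists ((Num.sqrt (dot f0 f0))^-1 *: f0); first exact: rpredZ.
  have ef0 : dot e f0 = 0 by rewrite dotC f0e ?inE.
  rewrite dotZl !dotZr mulrA -invfM -expr2 sqr_sqrtr ?dot_ge0 // mulVf ?gt_eqF ?dot_gt0 //.
  by rewrite ef0 mulr0.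
pose N := dot t t + s ^+ 2; have N0 : 0 <= N by rewrite addr_ge0 ?dot_ge0 ?sqr_ge0.
pose rho := Num.sqrt N; have rho0 : 0 <= rho by exact: sqrtr_ge0.
pose m (tau : R) := tau *: e + Num.sqrt (1 - tau ^+ 2) *: f.
have mT tau : m tau \in T by rewrite rpredD // rpredZ.
have mm tau : tau \in `[-1, 1] -> dot (m tau) (m tau) = 1.
  rewrite in_itv /= => /andP[t1 t2].
  have t3 : 0 <= 1 - tau ^+ 2 by nra.
  rewrite /m !dotDl !dotDr !dotZl !dotZr e1 f1 (dotC f) fe.
  rewrite mulr1 !mulr0 addr0 add0r mulr1 -!expr2 sqr_sqrtr //; lra.
have mc : continuous m.
  apply: continuous_mx => i j.
  rewrite (_ : (fun _ => _) = (fun tau => tau * e i j + Num.sqrt (1 - tau * tau) * f i j)).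
    have idc : continuous (fun tau : R => tau) by move=> ?; exact: cvg_id.
    apply: continuous_addR; apply: continuous_mulR => //; try exact: cst_continuous.
    apply: (continuous_composition (f := fun tau : R => 1 - tau * tau) (g := @Num.sqrt R));
      last by move=> ?; exact: sqrt_continuous.
    apply: continuous_addR; first exact: cst_continuous.
    by apply: continuous_oppR; apply: continuous_mulR.
  by apply/funext => tau; rewrite !mxE expr2.
have ce : cubic t = Num.sqrt (dot t t) ^+ 3 * cubic e by rewrite {1}te cubicZ.
have cfc : continuous (fun tau => rho ^+ 3 * cubic (m tau)).
  by apply: continuous_mulR; [exact: cst_continuous|exact: continuous_cubic].
have m1 : m 1 = e by rewrite /m expr1n subrr sqrtr0 scale1r scale0r addr0.
have mN1 : m (-1) = - 1 *: e by rewrite /m sqrrN expr1n subrr sqrtr0 scale0r addr0.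
have st : Num.sqrt (dot t t) <= rho.
  by rewrite ler_sqrt // lerDl sqr_ge0.
have [|||tau tauI hc] := @IVT R (fun tau => rho ^+ 3 * cubic (m tau)) (-1) 1 (cubic t).
- by lra.
- exact: continuous_subspaceT.
- rewrite m1 mN1 cubicZ ce.
  have : Num.sqrt (dot t t) ^+ 3 <= rho ^+ 3 by rewrite lerXn2r ?nnegrE ?sqrtr_ge0.
  have : 0 <= Num.sqrt (dot t t) ^+ 3 by rewrite exprn_ge0 // sqrtr_ge0.
  move: (_ ^+ 3) (rho ^+ 3) (cubic e) => a b d a0 ab.
  have cN : (-1) ^+ 3 = -1 :> R by ring.
  rewrite cN ge_min le_max; have [d0|d0] := leP 0 d; apply/andP; split; apply/orP.
  + by left; nra. + by right; nra. + by right; nra. + by left; nra.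
exists (v - t + rho *: m tau); split; last first.
  rewrite cubic_moving // cubicZ hc -[v in RHS](subrK t v) cubic_moving //.
split=> [z0 fz'|].
  have rT : rho *: m tau \in T by exact: rpredZ.
  rewrite !(dotDl, dotNl) (moving_dot_fixed sk1 sk2 sk3 tT fz').
  rewrite (moving_dot_fixed sk1 sk2 sk3 rT fz'); ring.
have := dot_fixed_moving fz tT; rewrite subrK => ->.
rewrite dot_fixed_moving ?rpredZ // dotZl dotZr mulrA -expr2 sqr_sqrtr // mm // /N; ring.
Qed.

Lemma weight2_not_locally_euclidean d : ~ locally_euclidean R d (orbit_space hG).
Proof.
apply: (@not_locally_euclidean_of (fun v _ w => cubic w = cubic v)).
- by move=> g v s w Gg h; have [lam _ hl] := group_cubic Gg; rewrite !hl h.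
- exact: cubic_total.
- move=> v s w w' [b1 F1] [b2 F2].
  have [z0 [t [t' [fz tT t'T [wE w'E tt]]]]] := base_relation_split b1 b2.
  have cc : cubic t = cubic t'.
    by rewrite -(cubic_moving t fz) -(cubic_moving t' fz) -wE -w'E F1 F2.
  have [h fh [hT [a [b [c [ab bc E]]]]]] := canonical5 tT.
  have [h' fh' [hT' [a' [b' [c' [ab' bc' E']]]]]] := canonical5 t'T.
  have [fxh hcub] := fh; have [fxh' hcub'] := fh'.
  have [Gh hz] := fxh; have [Gh' hz'] := fxh'.
  (* Trace, norm and cubic are, up to scale, the first three power sums of the diagonal entries. *)
  have [aa bb cc'] : [/\ a = a', b = b' & c = c'].
    apply: sorted_roots_unique => //.
    - have := quad_trace x y z p q (h *m t); have := quad_trace x y z p q (h' *m t').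
      by rewrite E E' !trace3E !mxE /=; lra.
    - have := norm_quad hT; have := norm_quad hT'.
      rewrite !dot_orthogonal; [|exact: (orthogonalP hG)..].
      rewrite tt E E' !trace3E !mul3E !mxE /=; lra.
    - have := hcub t; have := hcub' t'; rewrite cc !cubicE.
      rewrite E E' !trace3E !mul3E !mxE /=; lra.
  apply: (fixing_glue fxh fxh'); rewrite wE w'E !mulmxDr hz // hz' //; congr (_ + _).
  apply: (quad_inj sk2 sk3 orth5 sub5 dT xx table) => //.
  by rewrite E E' aa bb cc'.
- by [].
- apply: closed_eqfun; apply: continuous_cubic.
    exact: continuous_proj1.
  by apply: continuous_composition; [exact: continuous_proj2|exact: continuous_proj1].
Qed.

End CubicInvariant.

(** A positive semidefinite 2 x 2 matrix is determined by its square: first its determinant, then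
    its trace, and dividing by the trace gives the entries. A zero trace makes both matrices
    vanish. *)
Lemma psd_sqrt_unique (a m b a' m' b' : R) :
  0 <= a -> 0 <= b -> m ^+ 2 <= a * b -> 0 <= a' -> 0 <= b' -> m' ^+ 2 <= a' * b' ->
  a ^+ 2 + m ^+ 2 = a' ^+ 2 + m' ^+ 2 -> m * (a + b) = m' * (a' + b') ->
  m ^+ 2 + b ^+ 2 = m' ^+ 2 + b' ^+ 2 -> [/\ a = a', m = m' & b = b'].
Proof.
move=> a0 b0 mab a'0 b'0 mab' p r q.
have detE : a * b - m ^+ 2 = a' * b' - m' ^+ 2.
  apply/eqP; rewrite -(@eqrXn2 _ 2) ?subr_ge0 //; apply/eqP.
  transitivity ((a ^+ 2 + m ^+ 2) * (m ^+ 2 + b ^+ 2) - (m * (a + b)) ^+ 2); first by ring.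
  by rewrite p q r; ring.
have trE : a + b = a' + b'.
  apply/eqP; rewrite -(@eqrXn2 _ 2) ?addr_ge0 //; apply/eqP.
  transitivity ((a ^+ 2 + m ^+ 2) + (m ^+ 2 + b ^+ 2) + 2 * (a * b - m ^+ 2)); first by ring.
  by rewrite p q detE; ring.
have [t0|t0] := eqVneq (a' + b') 0.
  have z (x y : R) : 0 <= x -> 0 <= y -> x + y = 0 -> x = 0 /\ y = 0 by move=> *; split; lra.
  have [a'z b'z] := z _ _ a'0 b'0 t0; have [az bz] := z _ _ a0 b0 (etrans trE t0).
  have mz (x : R) : x ^+ 2 <= 0 -> x = 0.
    by move=> x0; apply/eqP; rewrite -sqrf_eq0 eq_le x0 sqr_ge0.
  move: mab mab'; rewrite az bz a'z b'z !mulr0 => /mz -> /mz ->; by split.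
have mE : m = m' by apply: (mulIf t0); rewrite -[in LHS]trE.
have abE : a - b = a' - b'.
  apply: (mulIf t0); rewrite -{1}trE.
  transitivity ((a ^+ 2 + m ^+ 2) - (m ^+ 2 + b ^+ 2)); first by ring.
  by rewrite p q; ring.
by split=> //; lra.
Qed.

Lemma psd_of_form (a m b : R) : (forall x y : R, 0 <= a * y ^+ 2 - 2 * m * (x * y) + b * x ^+ 2) ->
  [/\ 0 <= a, 0 <= b & m ^+ 2 <= a * b].
Proof.
move=> h; have a0 : 0 <= a by have := h 0 1; lra.
have b0 : 0 <= b by have := h 1 0; lra.
split=> //.
have [az|az] := eqVneq a 0.
  have [bz|bz] := eqVneq b 0.
    have h1 := h 1 1; have h2 := h 1 (- 1); rewrite az bz in h1 h2.
    have -> : m = 0 by lra.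
    by rewrite expr0n az bz mulr0.
  have b1 : 0 < b by rewrite lt_neqAle eq_sym bz.
  have := h m b; rewrite az.
  have -> : 0 * b ^+ 2 - 2 * m * (m * b) + b * m ^+ 2 = b * - m ^+ 2 by ring.
  by rewrite pmulr_rge0 // oppr_ge0 mul0r.
have a1 : 0 < a by rewrite lt_neqAle eq_sym az.
have := h a m; have -> : a * m ^+ 2 - 2 * m * (a * m) + b * a ^+ 2 = a * (a * b - m ^+ 2) by ring.
by rewrite pmulr_rge0 // subr_ge0.
Qed.

(** * Dimension 6: two copies of R^3 *)

Section DimSix.
Variables x y : 'cV[R]_n.
Hypotheses (xT : x \in T) (yT : y \in T) (Ax : A1 *m x = 0) (Ay : A1 *m y = 0)
  (xx : dot x x = 1) (yy : dot y y = 1) (xy : dot x y = 0) (dT : \dim T = 6%N).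

Let neq0_of_dot v : dot v v = 1 -> v != 0.
Proof. by move=> h; apply/eqP => v0; move/eqP: h; rewrite v0 dot0l eq_sym oner_eq0. Qed.

Let cube := su2_kernel_cube sk1 sk2 sk3 br12 br23 br31 Ax (neq0_of_dot xx) xT Ay
  (neq0_of_dot yy) yT xy dT.

(** The signs make [k], [frame2 k], [frame3 k] rotate like the standard basis of R^3. *)
Definition frame2 (k : 'cV[R]_n) := A3 *m k.
Definition frame3 (k : 'cV[R]_n) := - (A2 *m k).

Lemma frame_table k : k \in T -> A1 *m k = 0 ->
  (A1 *m frame2 k = frame3 k) * (A1 *m frame3 k = - frame2 k) *
  (A2 *m k = - frame3 k) * (A2 *m frame2 k = 0) * (A2 *m frame3 k = k) *
  (A3 *m k = frame2 k) * (A3 *m frame2 k = - k) * (A3 *m frame3 k = 0).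
Proof.
move=> kT k1; have [t23 t32 t22 t33] := weight1_table sk1 sk2 sk3 br12 br23 br31 kT k1 cube.
rewrite /frame2 /frame3 !mulmxN t22 t23 t32 t33 !opprK oppr0 (com13 br31) (com12 br12) k1.
by rewrite !mulmx0 !add0r.
Qed.

Let tx := frame_table xT Ax.
Let ty := frame_table yT Ay.

Lemma frame_dots k l : k \in T -> l \in T -> A1 *m k = 0 -> A1 *m l = 0 ->
  (dot k (frame2 l) = 0) * (dot k (frame3 l) = 0) * (dot (frame2 k) l = 0) *
  (dot (frame3 k) l = 0) * (dot (frame2 k) (frame3 l) = 0) * (dot (frame3 k) (frame2 l) = 0) *
  (dot (frame2 k) (frame2 l) = dot k l) * (dot (frame3 k) (frame3 l) = dot k l).
Proof.
move=> kT lT k1 l1; have tk := frame_table kT k1; have tl := frame_table lT l1.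
have f2E m : m \in T -> A1 *m m = 0 -> frame2 m = - (A1 *m frame3 m).
  by move=> mT m1; rewrite (frame_table mT m1) opprK.
have f3E m : m \in T -> A1 *m m = 0 -> frame3 m = A1 *m frame2 m.
  by move=> mT m1; rewrite (frame_table mT m1).
have h1 m p : m \in T -> A1 *m m = 0 -> A1 *m p = 0 -> dot p (frame2 m) = 0.
  by move=> mT m1 p1; rewrite (f2E m) // dotNr dotC (skew_dot sk1) p1 dot0r !oppr0.
have h2 m p : m \in T -> A1 *m m = 0 -> A1 *m p = 0 -> dot p (frame3 m) = 0.
  by move=> mT m1 p1; rewrite (f3E m) // dotC (skew_dot sk1) p1 dot0r !oppr0.
have h5 m p : m \in T -> A1 *m m = 0 -> p \in T -> A1 *m p = 0 ->
    dot (frame2 m) (frame3 p) = 0.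
  move=> mT m1 pT p1; rewrite [frame2 m](_ : _ = A3 *m m) // (skew_dot sk3).
  by rewrite (frame_table pT p1) dot0r oppr0.
have h7 : dot (frame2 k) (frame2 l) = dot k l.
  by rewrite [frame2 k](_ : _ = A3 *m k) // (skew_dot sk3) tl dotNr opprK.
have h8 : dot (frame3 k) (frame3 l) = dot k l.
  by rewrite [frame3 k](_ : _ = - (A2 *m k)) // dotNl (skew_dot sk2) tl opprK.
have g1 := h1 l k lT l1 k1; have g2 := h2 l k lT l1 k1.
have g3 := h1 k l kT k1 l1; have g4 := h2 k l kT k1 l1.
have g5 := h5 k l kT k1 lT l1; have g6 := h5 l k lT l1 kT k1.
rewrite dotC in g3; rewrite dotC in g4; rewrite dotC in g6.
by do !split.
Qed.

Local Notation e1 := x.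
Local Notation e2 := (frame2 x).
Local Notation e3 := (frame3 x).
Local Notation f1 := y.
Local Notation f2 := (frame2 y).
Local Notation f3 := (frame3 y).

Let dxx := frame_dots xT xT Ax Ax.
Let dxy := frame_dots xT yT Ax Ay.
Let dyx := frame_dots yT xT Ay Ax.
Let dyy := frame_dots yT yT Ay Ay.
Let yx : dot y x = 0. Proof. by rewrite dotC. Qed.

Let frame2T k : frame2 k \in T. Proof. exact: moving3. Qed.
Let frame3T k : frame3 k \in T. Proof. by rewrite rpredN moving2. Qed.

Let frame := [:: e1; e2; e3; f1; f2; f3].

Let frame_orth : orth frame.
Proof.
rewrite /= !dxx !dxy !dyy xy !eqxx !andbT /=.
by apply/and5P; split; try (apply/andP; split); apply: neq0_of_dot; rewrite ?dxx ?dyy.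
Qed.

Let frame_sub : {subset frame <= T}.
Proof.
move=> b; rewrite !inE => /or4P[/eqP->//|/eqP->|/eqP->|/or3P[]/eqP-> //];
  by [exact: frame2T|exact: frame3T].
Qed.

Lemma frame_expand t : t \in T -> t = dot t e1 *: e1 + dot t e2 *: e2 + dot t e3 *: e3 +
  dot t f1 *: f1 + dot t f2 *: f2 + dot t f3 *: f3.
Proof.
move=> tT; rewrite {1}(orth_expand frame_orth frame_sub _ tT) ?dT // /proj /frame.
by rewrite !big_cons big_nil !dxx !dyy xx yy !divr1 addr0 !addrA.
Qed.

(* Up to the isotypic identification of the moving part with R^3 (x) R^2, the
   operators [Pee], [Pef], [Pff] are the symmetric matrices acting on the factor R^2. *)
Definition outer (u v : 'cV[R]_n) : 'M[R]_n := u *m v^T.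
Definition Pee := outer e1 e1 + outer e2 e2 + outer e3 e3.
Definition Pff := outer f1 f1 + outer f2 f2 + outer f3 f3.
Definition Pef := outer e1 f1 + outer e2 f2 + outer e3 f3 +
  (outer f1 e1 + outer f2 e2 + outer f3 e3).

Lemma outer_mul u v w : outer u v *m w = dot v w *: u.
Proof.
rewrite /outer -mulmxA [v^T *m w]mx11_scalar -/(dot v w) mul_mx_scalar //.
Qed.

Lemma outer_tr u v : (outer u v)^T = outer v u.
Proof. by rewrite /outer trmx_mul trmxK. Qed.

Lemma outer_trace u v : \tr (outer u v) = dot u v.
Proof. by rewrite /outer mxtrace_mulC /mxtrace big_ord1 -/(dot v u) dotC. Qed.

Lemma Pee_mul v : Pee *m v = dot e1 v *: e1 + dot e2 v *: e2 + dot e3 v *: e3.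
Proof. by rewrite !mulmxDl !outer_mul. Qed.
Lemma Pff_mul v : Pff *m v = dot f1 v *: f1 + dot f2 v *: f2 + dot f3 v *: f3.
Proof. by rewrite !mulmxDl !outer_mul. Qed.
Lemma Pef_mul v : Pef *m v = dot f1 v *: e1 + dot f2 v *: e2 + dot f3 v *: e3 +
  (dot e1 v *: f1 + dot e2 v *: f2 + dot e3 v *: f3).
Proof. by rewrite !mulmxDl !outer_mul. Qed.

(** Describes the symmetric operators on the factor R^2 without a basis, so that conjugation by any
    element of [G] visibly preserves the class. *)
Definition symcomm (B : 'M[R]_n) : Prop :=
  [/\ B^T = B, forall A, lie_algebra G A -> B *m A = A *m B &
      forall z, fixed z -> B *m z = 0].

Lemma symcomm_of B : B^T = B ->
  (forall A v, A \in [:: A1; A2; A3] -> B *m (A *m v) = A *m (B *m v)) ->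
  (forall z, fixed z -> B *m z = 0) -> symcomm B.
Proof.
move=> Bt BA B0; split=> // A /lieP[y1 [y2 [y3 ->]]].
apply/matrixP => i j.
have : B *m (lin3 y1 y2 y3 *m delta_mx j ord0) = lin3 y1 y2 y3 *m (B *m (delta_mx j ord0 : 'cV_n)).
  by rewrite !lin3_mul !mulmxDr -!scalemxAr !BA // !inE eqxx ?orbT.
by rewrite !mulmxA -!colE => /colP/(_ i); rewrite !mxE.
Qed.

Let dotA1 v w : dot v (A1 *m w) = - dot (A1 *m v) w. Proof. by rewrite (skew_dot sk1) opprK. Qed.
Let dotA2 v w : dot v (A2 *m w) = - dot (A2 *m v) w. Proof. by rewrite (skew_dot sk2) opprK. Qed.
Let dotA3 v w : dot v (A3 *m w) = - dot (A3 *m v) w. Proof. by rewrite (skew_dot sk3) opprK. Qed.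

Let kill_fixed u z : u \in T -> fixed z -> dot u z = 0.
Proof. exact: moving_dot_fixed. Qed.

Lemma symcomm_P : [/\ symcomm Pee, symcomm Pff & symcomm Pef].
Proof.
have tr1 : Pee^T = Pee by rewrite /Pee !raddfD /= !outer_tr.
have tr2 : Pff^T = Pff by rewrite /Pff !raddfD /= !outer_tr.
have tr3 : Pef^T = Pef by rewrite /Pef !raddfD /= !outer_tr addrC.
split; apply: symcomm_of => //.
- move=> A v; rewrite !inE => /or3P[] /eqP ->; rewrite !Pee_mul !(dotA1, dotA2, dotA3)
    !mulmxDr -!scalemxAr !tx ?Ax; dotring.
- move=> z fz; rewrite Pee_mul !kill_fixed //; dotring.
- move=> A v; rewrite !inE => /or3P[] /eqP ->; rewrite !Pff_mul !(dotA1, dotA2, dotA3)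
    !mulmxDr -!scalemxAr !ty ?Ay; dotring.
- move=> z fz; rewrite Pff_mul !kill_fixed //; dotring.
- move=> A v; rewrite !inE => /or3P[] /eqP ->; rewrite !Pef_mul !(dotA1, dotA2, dotA3)
    !mulmxDr -!scalemxAr !tx !ty ?Ax ?Ay; dotring.
- move=> z fz; rewrite Pef_mul !kill_fixed //; dotring.
Qed.

Lemma trace_P : [/\ \tr Pee = 3, \tr Pff = 3 & \tr Pef = 0].
Proof.
rewrite /Pee /Pff /Pef !raddfD /= !outer_trace !dxx !dyy !dxy !dyx xx yy xy yx.
by split; lra.
Qed.

Lemma kerA1_expand p : p \in T -> A1 *m p = 0 -> p = dot p e1 *: e1 + dot p f1 *: f1.
Proof.
move=> pT p1; rewrite {1}(frame_expand pT).
by rewrite !(frame_dots pT xT p1 Ax) !(frame_dots pT yT p1 Ay) !scale0r !addr0.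
Qed.

(** [B] preserves the plane of [x] and [y], the kernel of [A1] in T; commuting with [A2] and [A3]
    fixes its values on the rest of the frame. *)
Lemma symcomm_span B : symcomm B -> exists a b c, B = a *: Pee + b *: Pef + c *: Pff.
Proof.
move=> [Bt BA B0].
have dotB v w : dot (B *m v) w = dot v (B *m w) by rewrite dot_mulmx Bt.
have BA1 v : B *m (A1 *m v) = A1 *m (B *m v) by rewrite !mulmxA BA //; exact: lie1.
have BA2 v : B *m (A2 *m v) = A2 *m (B *m v) by rewrite !mulmxA BA //; exact: lie2.
have BA3 v : B *m (A3 *m v) = A3 *m (B *m v) by rewrite !mulmxA BA //; exact: lie3.
have BT k : k \in T -> B *m k \in T.
  by move=> kT; apply: moving_of_dot => z fz; rewrite dotB B0 // dot0r.
have Bk k : k \in T -> A1 *m k = 0 -> B *m k = dot (B *m k) e1 *: e1 + dot (B *m k) f1 *: f1.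
  by move=> kT k1; apply: kerA1_expand; rewrite ?BT // -BA1 k1 mulmx0.
pose a := dot (B *m e1) e1; pose b := dot (B *m e1) f1; pose c := dot (B *m f1) f1.
have Be : B *m e1 = a *: e1 + b *: f1 by exact: Bk.
have Bf : B *m f1 = b *: e1 + c *: f1.
  by rewrite {1}(Bk _ yT Ay) (_ : dot (B *m f1) e1 = b) // dotB dotC.
have Be2 : B *m e2 = a *: e2 + b *: f2 by rewrite BA3 Be mulmxDr -!scalemxAr.
have Bf2 : B *m f2 = b *: e2 + c *: f2 by rewrite BA3 Bf mulmxDr -!scalemxAr.
have Be3 : B *m e3 = a *: e3 + b *: f3.
  by rewrite mulmxN BA2 Be mulmxDr -!scalemxAr opprD -!scalerN.
have Bf3 : B *m f3 = b *: e3 + c *: f3.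
  by rewrite mulmxN BA2 Bf mulmxDr -!scalemxAr opprD -!scalerN.
exists a, b, c; apply: mx_ext_mul => v.
have [t tT fz] := fixed_moving_decomp sk1 sk2 sk3 v.
have vE u : u \in T -> dot u v = dot t u.
  by move=> uT; rewrite -{1}(subrK t v) dotDr kill_fixed // add0r dotC.
rewrite !mulmxDl -!scalemxAl Pee_mul Pef_mul Pff_mul !vE ?xT ?yT ?frame2T ?frame3T //.
rewrite -{1}(subrK t v) mulmxDr B0 // add0r {1}(frame_expand tT) !mulmxDr -!scalemxAr.
rewrite Be Be2 Be3 Bf Bf2 Bf3; dotring.
Qed.

(** Since [Pee] and [Pff] have trace 3, both diagonal entries of the Gram matrix grow by
    [s ^+ 2 / 2], and the squared norm by [s ^+ 2] as [base_relation] demands. *)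
Definition form6 (v : 'cV[R]_n) (s : R) (w : 'cV[R]_n) : Prop := forall B, symcomm B ->
  dot w (B *m w) = dot v (B *m v) + s ^+ 2 / 6 * \tr B.

Lemma form6_of v s w :
  dot w (Pee *m w) = dot v (Pee *m v) + s ^+ 2 / 2 ->
  dot w (Pff *m w) = dot v (Pff *m v) + s ^+ 2 / 2 ->
  dot w (Pef *m w) = dot v (Pef *m v) -> form6 v s w.
Proof.
move=> hee hff hef B /symcomm_span[a [b [c ->]]].
have [tee tff tef] := trace_P.
have trE : \tr (a *: Pee + b *: Pef + c *: Pff) = a * 3 + c * 3.
  by rewrite mxtraceD mxtraceD !mxtraceZ tee tff tef mulr0 addr0.
have formE u : dot u ((a *: Pee + b *: Pef + c *: Pff) *m u) =
    a * dot u (Pee *m u) + b * dot u (Pef *m u) + c * dot u (Pff *m u).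
  by rewrite mulmxDl mulmxDl -!scalemxAl !dotDr !dotZr.
by rewrite !formE hee hff hef trE; field.
Qed.

Lemma Pee_form v : dot v (Pee *m v) = dot e1 v ^+ 2 + dot e2 v ^+ 2 + dot e3 v ^+ 2.
Proof. rewrite Pee_mul !dotDr !dotZr !(dotC v); ring. Qed.
Lemma Pff_form v : dot v (Pff *m v) = dot f1 v ^+ 2 + dot f2 v ^+ 2 + dot f3 v ^+ 2.
Proof. rewrite Pff_mul !dotDr !dotZr !(dotC v); ring. Qed.
Lemma Pef_form v : dot v (Pef *m v) =
  2 * (dot e1 v * dot f1 v + dot e2 v * dot f2 v + dot e3 v * dot f3 v).
Proof. rewrite Pef_mul !dotDr !dotZr !(dotC v); ring. Qed.

Lemma cauchy3 (a1 a2 a3 b1 b2 b3 : R) :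
  (a1 * b1 + a2 * b2 + a3 * b3) ^+ 2 <=
  (a1 ^+ 2 + a2 ^+ 2 + a3 ^+ 2) * (b1 ^+ 2 + b2 ^+ 2 + b3 ^+ 2).
Proof.
rewrite -subr_ge0 (_ : _ - _ = (a1 * b2 - a2 * b1) ^+ 2 + (a1 * b3 - a3 * b1) ^+ 2 +
  (a2 * b3 - a3 * b2) ^+ 2); last by ring.
by rewrite !addr_ge0 // sqr_ge0.
Qed.

(** A Cholesky factorization of the enlarged Gram matrix: the two vectors of R^3 are taken as (a, 0,
    0) and (b, c, 0). *)
Lemma form6_total v s : exists w, base_relation v s w /\ form6 v s w.
Proof.
(* At s = 0 the leading Gram entry may vanish and could not be divided by. *)
have [->|s0] := eqVneq s 0.
  exists v; split; last by move=> B _; rewrite expr0n mul0r mul0r addr0.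
  by split=> [z _|]; rewrite ?subrr ?dot0l // expr0n addr0.
have [t tT fz] := fixed_moving_decomp sk1 sk2 sk3 v.
pose p := dot e1 v ^+ 2 + dot e2 v ^+ 2 + dot e3 v ^+ 2.
pose q := dot f1 v ^+ 2 + dot f2 v ^+ 2 + dot f3 v ^+ 2.
pose r := dot e1 v * dot f1 v + dot e2 v * dot f2 v + dot e3 v * dot f3 v.
have p0 : 0 <= p by rewrite !addr_ge0 // sqr_ge0.
have q0 : 0 <= q by rewrite !addr_ge0 // sqr_ge0.
have rpq : r ^+ 2 <= p * q by exact: cauchy3.
have s2 : 0 < s ^+ 2 by rewrite exprn_even_gt0.
pose p' := p + s ^+ 2 / 2; pose q' := q + s ^+ 2 / 2.
have p'0 : 0 < p' by rewrite ltr_wpDl // divr_gt0.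
pose a := Num.sqrt p'; have a0 : 0 < a by rewrite sqrtr_gt0.
have a2 : a ^+ 2 = p' by rewrite sqr_sqrtr // ltW.
have d0 : 0 <= q' - r ^+ 2 / p'.
  rewrite subr_ge0 ler_pdivrMr //; apply: le_trans rpq _.
  by rewrite mulrC ler_pM // lerDl divr_ge0 // ltW.
pose b := r / a; pose c := Num.sqrt (q' - r ^+ 2 / p').
have c2 : c ^+ 2 = q' - b ^+ 2 by rewrite sqr_sqrtr // /b exprMn exprVn a2.
have ab : a * b = r by rewrite /b mulrCA divff ?mulr1 // gt_eqF.
pose m := a *: e1 + b *: f1 + c *: f2.
have mT : m \in T by rewrite /m !rpredD // rpredZ.
have [m1 [m2 m3]] : dot e1 m = a /\ dot e2 m = 0 /\ dot e3 m = 0.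
  by rewrite /m !dotDr !dotZr !dxy xy xx !dxx; split; last split; ring.
have [n1 [n2 n3]] : dot f1 m = b /\ dot f2 m = c /\ dot f3 m = 0.
  by rewrite /m !dotDr !dotZr !dyx yx !dyy yy; split; last split; ring.
clearbody m.
have vE u : u \in T -> dot u (v - t + m) = dot u m.
  by move=> uT; rewrite dotDr (kill_fixed uT fz) add0r.
exists (v - t + m); split; last first.
  apply: form6_of; rewrite ?Pee_form ?Pff_form ?Pef_form !vE // ?m1 ?m2 ?m3 ?n1 ?n2 ?n3.
  - rewrite a2 /p' /p; ring.
  - rewrite c2 /q' /q; ring.
  - rewrite ab /r; ring.
split=> [z fz'|].
  rewrite !(dotDl, dotNl) (kill_fixed tT fz') (kill_fixed mT fz'); ring.
have tE u : u \in T -> dot t u = dot u v.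
  by move=> uT; rewrite -{1}(subrK t v) dotDr (kill_fixed uT fz) add0r dotC.
have tt : dot t t = p + q.
  rewrite {2}(frame_expand tT) !dotDr !dotZr !tE // /p /q; ring.
have mm : dot m m = p + q + s ^+ 2.
  rewrite {2}(frame_expand mT) !dotDr !dotZr !(dotC m) m1 m2 m3 n1 n2 n3.
  transitivity (a ^+ 2 + b ^+ 2 + c ^+ 2); first by ring.
  rewrite a2 c2 /p' /q'; by field.
rewrite dot_fixed_moving // mm; have := dot_fixed_moving fz tT; rewrite subrK tt => ->; ring.
Qed.

Definition fixing6 : set 'M[R]_n :=
  [set g | fixing g /\ [/\ g *m Pee = Pee *m g, g *m Pff = Pff *m g & g *m Pef = Pef *m g]].

Lemma compact_fixing6 : compact fixing6.
Proof.
have -> : fixing6 = fixing `&` ([set g | g *m Pee = Pee *m g] `&`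
    [set g | g *m Pff = Pff *m g] `&` [set g | g *m Pef = Pef *m g]).
  by apply/seteqP; split=> [g [fg [h1 h2 h3]]|g [fg [[h1 h2] h3]]].
apply: compact_closedI; first exact: compact_fixing.
have cl (B : 'M[R]_n) : closed [set g : 'M[R]_n | g *m B = B *m g].
  by apply: closed_eqmx; apply: continuous_mulmx;
    [move=> g; exact: cvg_id|exact: cst_continuous|exact: cst_continuous|move=> g; exact: cvg_id].
by apply: closedI; first apply: closedI.
Qed.

Lemma fixing6_exp A t g : lie_algebra G A -> fixing6 g -> fixing6 (mx_exp (t *: A) *m g).
Proof.
move=> gA [fg [h1 h2 h3]]; split; first exact: fixing_exp.
have [[_ c1 _] [_ c2 _] [_ c3 _]] := symcomm_P.
have com B : (forall A, lie_algebra G A -> B *m A = A *m B) -> g *m B = B *m g ->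
    mx_exp (t *: A) *m g *m B = B *m (mx_exp (t *: A) *m g).
  move=> BA gB; rewrite -mulmxA gB !mulmxA; congr (_ *m _).
  by rewrite -mx_exp_commute // -scalemxAl -scalemxAr BA.
by split; apply: com.
Qed.

Lemma fixing6_form g t B : fixing6 g -> g *m B = B *m g ->
  dot (g *m t) (B *m (g *m t)) = dot t (B *m t).
Proof.
move=> [[Gg _] _] gB; rewrite mulmxA -gB -mulmxA dot_orthogonal //.
exact: (orthogonalP hG Gg).
Qed.

(** With t read as a 3 x 2 matrix, the maximized form is the trace of its upper 2 x 2 block. The
    outcome is a polar decomposition: the last row is zero, and the block is symmetric by the first
    variation and positive semidefinite by the second. *)
Lemma canonical6 t : t \in T -> exists2 h, fixing6 h & exists a m b,
  h *m t = a *: e1 + m *: e2 + m *: f1 + b *: f2 /\ [/\ 0 <= a, 0 <= b & m ^+ 2 <= a * b].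
Proof.
move=> tT; pose u := e1 + f2.
have [h fh [hT hA]] : exists2 h, fixing6 h & h *m t \in T /\ forall A, lie_algebra G A ->
    dot (A *m (h *m t)) u = 0 /\ 0 <= dot (A *m (h *m t)) (A *m u).
  apply: canonical => //.
  - by move=> g [].
  - exact: compact_fixing6.
  - by split; [exact: fixing1|rewrite !mul1mx !mulmx1].
  - by move=> A g gA fg; exists 1 => // r _; exact: fixing6_exp.
exists h => //; set v := h *m t in hT hA *.
have [u1 _] := hA _ lie1; have [u2 _] := hA _ lie2; have [u3 _] := hA _ lie3.
move: u1 u2 u3; rewrite (skew_dot sk1) (skew_dot sk2) (skew_dot sk3) /u !mulmxDr.
rewrite !tx !ty Ax !dotDr ?(dotNr (frame3 _)) ?(dotNr y) ?dot0r => u1 u2 u3.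
have e30 : dot v e3 = 0 by lra.
have f30 : dot v f3 = 0 by lra.
have ef : dot v f1 = dot v e2 by lra.
exists (dot v e1), (dot v e2), (dot v f2); split.
  rewrite {1}(frame_expand hT) e30 f30 ef; dotring.
apply: psd_of_form => a b; have [_] := hA _ (lie_lin3 a b 0).
have Av : lin3 a b 0 *m v = a *: (A1 *m v) + b *: (A2 *m v) by rewrite lin3_mul scale0r addr0.
have Au : lin3 a b 0 *m u = a *: f3 + b *: - e3.
  by rewrite lin3_mul scale0r addr0 /u !mulmxDr !tx !ty Ax add0r addr0.
have s1 : dot (A1 *m v) f3 = dot v f2 by rewrite (skew_dot sk1) ty (dotNr f2) opprK.
have s2 : dot (A2 *m v) f3 = - dot v f1 by rewrite (skew_dot sk2) ty.
have s3 : dot (A1 *m v) e3 = dot v e2 by rewrite (skew_dot sk1) tx (dotNr e2) opprK.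
have s4 : dot (A2 *m v) e3 = - dot v e1 by rewrite (skew_dot sk2) tx.
rewrite Av Au !dotDl !dotDr !dotZl !dotZr !(dotNr e3) s1 s2 s3 s4 ef => h0.
apply: le_trans h0 _; rewrite le_eqVlt; apply/orP; left; apply/eqP; ring.
Qed.

Lemma dim6_not_locally_euclidean d : ~ locally_euclidean R d (orbit_space hG).
Proof.
have [[_ _ k1] [_ _ k2] [_ _ k3]] := symcomm_P.
apply: (@not_locally_euclidean_of form6).
- move=> g v s w Gg h B [Bt BA B0].
  have gO := orthogonalP hG Gg; have gO' := orthogonal_trK hG Gg.
  have sB : symcomm (g^T *m B *m g).
    split.
    - by rewrite !trmx_mul trmxK Bt mulmxA.
    - move=> A gA; have gA' := lie_conj hG Gg gA; have := BA _ gA' => E.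
      have E2 : g^T *m (B *m (g *m A *m g^T)) *m g = g^T *m (g *m A *m g^T *m B) *m g by rewrite E.
      move: E2; rewrite !mulmxA gO mul1mx -!(mulmxA _ g^T g) gO mulmx1 => ->.
      by [].
    - move=> z fz; rewrite -!mulmxA B0 ?mulmx0 //; exact: group_fixed.
  have trE : \tr (g^T *m B *m g) = \tr B by rewrite mxtrace_mulC !mulmxA gO' mul1mx.
  have := h _ sB; rewrite trE => E.
  have F x' : dot (g *m x') (B *m (g *m x')) = dot x' (g^T *m B *m g *m x').
    by rewrite dot_mulmx !mulmxA.
  by rewrite !F.
- exact: form6_total.
- move=> v s w w' [b1 F1] [b2 F2].
  have [z [t [t' [fz tT t'T [wE w'E tt]]]]] := base_relation_split b1 b2.
  have [sPee sPff sPef] := symcomm_P.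
  have formE B : symcomm B -> dot t (B *m t) = dot t' (B *m t').
    move=> sB; have := F1 _ sB; rewrite -(F2 _ sB) wE w'E.
    case: sB => Bt BA B0; rewrite !mulmxDr !(B0 z fz) !add0r !dotDl.
    by rewrite !(dotC z) ![dot (B *m _) z]dot_mulmx Bt (B0 z fz) !dot0r !add0r.
  have [h fh [a [m [b [ht [a0 b0 mab]]]]]] := canonical6 tT.
  have [h' fh' [a' [m' [b' [ht' [a'0 b'0 mab']]]]]] := canonical6 t'T.
  have co (x1 x2 x3 x4 : R) : let c := x1 *: e1 + x2 *: e2 + x3 *: f1 + x4 *: f2 in
      [/\ dot e1 c = x1, dot e2 c = x2, dot e3 c = 0, dot f1 c = x3 & dot f2 c = x4 /\ dot f3 c = 0].
    rewrite /= !dotDr !dotZr !dxx !dyy !dxy !dyx xx yy xy yx.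
    by split; [ring|ring|ring|ring|split; ring].
  have [c1 c2 c3 c4 [c5 c6]] := co a m m b; have [c1' c2' c3' c4' [c5' c6']] := co a' m' m' b'.
  (* The Gram matrix on R^2 is the square of the block found by [canonical6]. *)
  have [am mm bm] : [/\ a = a', m = m' & b = b'].
    apply: psd_sqrt_unique => //.
    - have := formE _ sPee; case: (fh) => _ [g1 g2 g3]; case: (fh') => _ [g1' g2' g3'].
      rewrite -(fixing6_form t fh g1) -(fixing6_form t' fh' g1') ht ht' !Pee_form.
      by rewrite c1 c2 c3 c1' c2' c3'; lra.
    - have := formE _ sPef; case: (fh) => _ [g1 g2 g3]; case: (fh') => _ [g1' g2' g3'].
      rewrite -(fixing6_form t fh g3) -(fixing6_form t' fh' g3') ht ht' !Pef_form.
      by rewrite c1 c2 c3 c1' c2' c3' c4 c4' c5 c5' c6 c6'; lra.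
    - have := formE _ sPff; case: (fh) => _ [g1 g2 g3]; case: (fh') => _ [g1' g2' g3'].
      rewrite -(fixing6_form t fh g2) -(fixing6_form t' fh' g2') ht ht' !Pff_form.
      by rewrite c4 c5 c6 c4' c5' c6'; lra.
  case: (fh) => fxh _; case: (fh') => fxh' _.
  apply: (fixing_glue fxh fxh'); rewrite wE w'E !mulmxDr.
  have [_ gz] := fxh; have [_ gz'] := fxh'.
  by rewrite (gz z fz) (gz' z fz) ht ht' am mm bm.
- by move=> v B _; rewrite expr0n mul0r mul0r addr0.
- have -> : [set p : 'cV[R]_n * ('cV[R]_n * R) | form6 p.2.1 p.2.2 p.1] =
    \bigcap_(B in [set B | symcomm B]) [set p | dot p.1 (B *m p.1) =
      dot p.2.1 (B *m p.2.1) + p.2.2 ^+ 2 / 6 * \tr B] by [].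
  have p1 : continuous (fun p : 'cV[R]_n * ('cV[R]_n * R) => p.1) by exact: continuous_proj1.
  have p2 : continuous (fun p : 'cV[R]_n * ('cV[R]_n * R) => p.2.1).
    by apply: continuous_composition; [exact: continuous_proj2|exact: continuous_proj1].
  have p3 : continuous (fun p : 'cV[R]_n * ('cV[R]_n * R) => p.2.2).
    by apply: continuous_composition; [exact: continuous_proj2|exact: continuous_proj2].
  have cB (f : 'cV[R]_n * ('cV[R]_n * R) -> 'cV[R]_n) (B : 'M[R]_n) : continuous f ->
      continuous (fun p => dot (f p) (B *m f p)).
    move=> fc; apply: continuous_dot => //; apply: continuous_mulmx => //.
    exact: cst_continuous.
  apply: closed_bigI => B _; apply: closed_eqfun; first exact: cB.
  apply: continuous_addR; first exact: cB.
  apply: continuous_mulR; last exact: cst_continuous.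
  apply: continuous_mulR; last exact: cst_continuous.
  exact: continuous_mulR.
Qed.

End DimSix.

Lemma kerA1_unit u : u \in T -> u != 0 -> A1 *m u = 0 -> exists e : 'cV[R]_n,
  [/\ e \in T, A1 *m e = 0, dot e e = 1 & forall b, dot u b = 0 -> dot e b = 0].
Proof.
move=> uT u0 u1; exists ((Num.sqrt (dot u u))^-1 *: u); split.
- exact: rpredZ.
- by rewrite -scalemxAr u1 scaler0.
- rewrite dotZl dotZr mulrA -invfM -expr2 sqr_sqrtr ?dot_ge0 // mulVf //.
  by rewrite gt_eqF // dot_gt0.
by move=> b ub; rewrite dotZl ub mulr0.
Qed.

Lemma dim5_not_locally_euclidean : A1 != 0 -> \dim T = 5%N ->
  forall d, ~ locally_euclidean R d (orbit_space hG).
Proof.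
move=> A10 dT d; have [|||u uT [u0 u1 _]] := @kernel1_odd [::] isT; rewrite ?dT //.
have [x [xT x1 xx _]] := kerA1_unit uT u0 u1.
have ox := weight2_orth xT x1 xx dT.
have sx := weight2_sub xT.
apply: (weight2_not_locally_euclidean ox sx dT xx x1 (weight2_table xT x1 xx dT)) => //.
exact: kerA1_line.
Qed.

(** The kernel of [A1] in T has even dimension, so one weight-zero vector brings a second one, and
    with it the two copies of R^3. *)
Lemma dim6_kernel_not_locally_euclidean u : u \in T -> u != 0 -> A1 *m u = 0 ->
  \dim T = 6%N -> forall d, ~ locally_euclidean R d (orbit_space hG).
Proof.
move=> uT u0 u1 dT d; have [x [xT x1 xx _]] := kerA1_unit uT u0 u1.
have x0 : x != 0 by apply/eqP => x0; move/eqP: xx; rewrite x0 dot0l eq_sym oner_eq0.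
have [||||w wT [w0 w1 wx]] := @kernel1_odd [:: x].
- by rewrite /= x0.
- by move=> b; rewrite inE => /eqP ->.
- by move=> b; rewrite inE => /eqP ->.
- by rewrite dT.
have [y [yT y1 yy hy]] := kerA1_unit wT w0 w1.
have xy : dot x y = 0 by rewrite dotC hy // wx // inE.
exact: (@dim6_not_locally_euclidean x y).
Qed.

(** * Irreducible components and the bound on q *)

Section Decomposition.
Variables (L : nat) (W : 'I_L -> {vspace 'cV[R]_n}).
Hypothesis hW : irreducible_decomposition (lie_algebra G) W.

Lemma skew_line A v c : A^T = - A -> A *m v = c *: v -> A *m v = 0.
Proof.
move=> skA E; have := skew_dotvv v skA; rewrite E dotZl => /eqP.
rewrite mulf_eq0 => /orP[/eqP->|/eqP/dot_eq0->]; rewrite ?scale0r ?scaler0 //.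
Qed.

Lemma dim1_killed i A v : \dim (W i) = 1%N -> lie_algebra G A -> v \in W i -> A *m v = 0.
Proof.
move=> d1 gA vW; have [_ _ /(_ i)[_ inv _]] := hW.
have [->|v0] := eqVneq v 0; first exact: mulmx0.
have lineE : <[v]>%VS = W i.
  by apply/eqP; rewrite eqEdim -memvE vW d1 dim_vline v0.
have := inv _ _ gA vW; rewrite -lineE => /vlineP[c cE].
exact: (skew_line (lie_skew hG gA) cE).
Qed.

Lemma moving_sub : (T <= \sum_(i | \dim (W i) != 1%N) W i)%VS.
Proof.
have [_ full irr] := hW.
have AU A v : lie_algebra G A -> A *m v \in (\sum_(i | \dim (W i) != 1%N) W i)%VS.
  move=> gA; have : v \in (\sum_i W i)%VS by rewrite full memvf.
  move=> /memv_sumP[w wW ->]; rewrite mulmx_sumr; apply: rpred_sum => i _.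
  have [d1|d1] := eqVneq (\dim (W i)) 1%N.
    by rewrite (dim1_killed d1 gA) ?wW ?mem0v.
  have [_ inv _] := irr i.
  by apply: (subvP (sumv_sup i d1 (subvv _))); apply: inv => //; exact: wW.
apply/subvP => v /memv_addP[a /memv_addP[b /memv_imgP[b' _ ->] [c /memv_imgP[c' _ ->] ->]]].
move=> [d /memv_imgP[d' _ ->] ->]; rewrite !lfunE /=.
by rewrite !rpredD // AU //; [exact: lie1|exact: lie2|exact: lie3].
Qed.

Lemma dim_moving_le : (\dim T <= \sum_(i < L | \dim (W i) != 1%N) \dim (W i))%N.
Proof.
apply: leq_trans (dimvS moving_sub) _.
exact: dimv_leq_sum.
Qed.

Lemma dim_moving_q : (\dim T <= 3 * q_of W)%N.
Proof.
apply: leq_trans dim_moving_le _; rewrite /q_of big_distrr /= big_mkcond /=.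
by apply: leq_sum => i _; case: ifP => // d1; lia.
Qed.

(** Twice n is at most five times the integer part of n / 2 unless n is 1 or 3. Without a component
    of dimension 3 this would give 12 <= 10. *)
Lemma exists_dim3 : \dim T = 6%N -> (q_of W <= 2)%N -> exists i, \dim (W i) = 3%N.
Proof.
move=> dT q2; apply: contrapT => no3.
have : (2 * \dim T <= 5 * q_of W)%N; last by lia.
have h : (2 * \dim T <= 2 * \sum_(i < L | \dim (W i) != 1%N) \dim (W i))%N.
  by rewrite leq_mul2l dim_moving_le.
apply: leq_trans h _; rewrite /q_of !big_distrr /= big_mkcond /=; apply: leq_sum => i _.
have d3 : \dim (W i) <> 3%N by move=> h; apply: no3; exists i.
by case: ifP => // d1; lia.
Qed.

(** Odd dimension gives [A1] a kernel vector in [W i], and its projection to T remains in the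
    kernel. A zero projection would make the vector fixed, and its span an invariant line in an
    irreducible space of dimension 3. *)
Lemma dim3_kernel i : \dim (W i) = 3%N -> exists2 u, u \in T & u != 0 /\ A1 *m u = 0.
Proof.
move=> d3; have [_ _ /(_ i)[W0 inv irr]] := hW.
have [|||||u uW [u0 u1 _]] := @odd_kernel R n A1 [::] (W i) sk1.
- by move=> v vW; apply: inv => //; exact: lie1.
- by [].
- by [].
- by [].
- by rewrite d3.
have [t tT fz] := fixed_moving_decomp sk1 sk2 sk3 u.
exists t => //; split.
  apply/eqP => t0; move: fz; rewrite t0 subr0 => /fixedP fu.
  have [||l0|lW] := irr <[u]>%VS.
  - by rewrite -memvE.
  - by move=> A v gA /vlineP[c ->]; rewrite -scalemxAr fu // scaler0 mem0v.
  - by move: u0; rewrite -memv0 -l0 memv_line.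
  - by move: d3; rewrite -lW dim_vline u0.
have [z1 _ _] := fz; rewrite -[RHS]u1 -[in RHS](subrK t u) mulmxDr z1 add0r //.
Qed.

Lemma orbit_space_not_locally_euclidean d : A1 != 0 -> (q_of W <= 2)%N ->
  ~ locally_euclidean R d (orbit_space hG).
Proof.
move=> A10 q2; have le6 := dim_moving_q; have ge3 := dim_moving_ge3 sk1 sk2 sk3 br12 br23 br31 A10.
have [dT|dT|dT|dT] : [\/ \dim T = 3%N, \dim T = 4%N, \dim T = 5%N | \dim T = 6%N].
  have : [|| \dim T == 3, \dim T == 4, \dim T == 5 | \dim T == 6]%N by lia.
  by move=> /or4P[] /eqP ->; constructor.
- exact: dim3_not_locally_euclidean.
- exact: dim4_not_locally_euclidean.
- exact: dim5_not_locally_euclidean.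
have [i /dim3_kernel[u uT [u0 u1]]] := exists_dim3 dT q2.
exact: (dim6_kernel_not_locally_euclidean uT u0 u1 dT).
Qed.

End Decomposition.

End Su2Group.

Theorem mainTheorem2 (R : realType) (n : nat) (G : set 'M[R]_n)
    (hG : is_orthogonal_subgroup G) (hGcompact : compact G)
    (hsu2 : isomorphic_to_su2 (lie_algebra G))
    (L : nat) (W : 'I_L -> {vspace 'cV[R]_n})
    (hW : irreducible_decomposition (lie_algebra G) W)
    (hmanifold : topological_manifold R (orbit_space hG)) :
  (2 < q_of W)%N.
Proof.
rewrite ltnNge; apply/negP => q2.
have [_ _ [d euclidean]] := hmanifold.
have [A1 [A2 [A3 [lieP br12 br23 br31 A10]]]] := su2_triple hsu2.
exact: (orbit_space_not_locally_euclidean hGcompact lieP br12 br23 br31 hW A10 q2 euclidean).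
Qed.
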